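(* Let $\mathcal W$ and $\mathcal S$ be the even parts of $W(m,n;\underline t)$ and $S(m,n;\underline t)$ over a field $\mathbb F$ of characteristic $p>3$, with $m,n\ge3$, and regard $\mathcal W$ as an $\mathcal S$-module via the adjoint action. Then $$\mathrm{Der}(\mathcal S,\mathcal W)=\mathrm{ad}(\mathcal W)\oplus\mathrm{span}_{\mathbb F}\{(\mathrm{ad}\,D_i)^{p^{r_i}}\mid i\in Y_0,\ 1\le r_i<t_i\},$$ where $\mathrm{ad}\,E$ (for $E\in\mathcal W$) denotes the map $\mathcal S\to\mathcal W$, $X\mapsto [E,X]$, and $(\mathrm{ad}\,D_i)^{p^{r_i}}$ denotes its restriction to $\mathcal S$.
   Context: $\mathbb F$ is a field of characteristic $p>3$; $m,n\ge 3$; $\underline t=(t_1,\dots,t_m)$ positive integers, $\pi_i=p^{t_i}-1$. $Y_0=\{1,\dots,m\}$, $Y_1=\{m+1,\dots,m+n\}$, $Y=Y_0\cup Y_1$, $\tau(r)=\bar0$ on $Y_0$, $\bar1$ on $Y_1$. $\mathfrak A=\mathfrak A(m,n;\underline t)$ is the supercommutative superalgebra with basis $x^{(\alpha)}x^u$ ($\alpha\in\mathbb N_0^m$, $\alpha_i\le\pi_i$; $u$ an increasing sequence in $Y_1$, $x^u$ the corresponding product of odd generators $x_k$, $k\in Y_1$), with divided-power multiplication $x^{(\alpha)}x^{(\beta)}=\prod_i\binom{\alpha_i+\beta_i}{\alpha_i}x^{(\alpha+\beta)}$ (zero if some index exceeds $\pi_i$), anticommuting $x_k$, and parity of $x^{(\alpha)}x^u$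 equal to $|u|\bmod2$. $D_i$ ($i\in Y_0$) lowers $\alpha$ by $\varepsilon_i$, $D_k$ ($k\in Y_1$) is the odd partial derivative $\partial/\partial x_k$; $D_r$ has parity $\tau(r)$. $W=W(m,n;\underline t)=\{\sum f_rD_r:f_r\in\mathfrak A\}$ with the supercommutator bracket $[fD_r,gD_s]=fD_r(g)D_s-(-1)^{\mathrm p(fD_r)\mathrm p(gD_s)}gD_s(f)D_r$; the $\mathbb Z$-degree of $x^{(\alpha)}x^uD_r$ is $|\alpha|+|u|-1$. For $r,s\in Y$ and homogeneous $f\in\mathfrak A$, $D_{rs}(f)=(-1)^{\tau(r)\tau(s)}D_r(f)D_s-(-1)^{(\tau(r)+\tau(s))\mathrm p(f)}D_s(f)D_r$; $S=S(m,n;\underline t)=\mathrm{span}\{D_{rs}(f)\}$. $\mathcal W=W_{\bar0}$, $\mathcal S=S_{\bar0}$. For a Lie algebra $\mathfrak g$ and a $\mathfrak g$-module $V$, $\mathrm{Der}(\mathfrak g,V)$ is the space of linear maps $D:\mathfrak g\to V$ with $D([x,y])=x\cdot D(y)-y\cdot D(x)$. *)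

(* Defs.v *)
From HB Require Import structures.
From mathcomp Require Import all_boot all_order all_algebra.
Set Implicit Arguments. Unset Strict Implicit. Unset Printing Implicit Defensive.
Import Order.TTheory GRing.Theory.
Local Open Scope ring_scope.

(* Divided-power superalgebra A(m,n;t), the Lie superalgebra W(m,n;t),
   its special subalgebra S(m,n;t), and their even parts, all over a field F.
   Odd indices Y_1 = {m+1,...,m+n} are encoded by 'I_n (k <-> m+1+k),
   even indices Y_0 = {1,...,m} by 'I_m; Y = 'I_m + 'I_n (inl = even). *)

Section SuperW.
Variables (F : fieldType) (p m n : nat) (t : 'I_m -> nat).

Definition piexp (i : 'I_m) : nat := (p ^ t i).-1.
Definition expo := {dffun forall i : 'I_m, 'I_(piexp i).+1}.
(* a basis monomial x^(alpha) x^u, u a subset of the odd generators *)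
Definition mono := (expo * {set 'I_n})%type.
Definition Alg := {ffun mono -> F^o}.

Definition mono_el (mu : mono) : Alg := [ffun nu => (nu == mu)%:R].
Definition mpar (mu : mono) : bool := odd #|mu.2|.

Definition addexp (a b : expo) : expo := [ffun i => inord (a i + b i)].
Definition inv_count (u v : {set 'I_n}) : nat :=
  #|[set ab : 'I_n * 'I_n | [&& ab.1 \in u, ab.2 \in v & (ab.2 < ab.1)%N]]|.
Definition mulb (mu nu : mono) : Alg :=
  if [forall i, (mu.1 i + nu.1 i <= piexp i)%N] && [disjoint mu.2 & nu.2] then
    ((\prod_(i < m) 'C(mu.1 i + nu.1 i, mu.1 i))%:R * (-1) ^+ inv_count mu.2 nu.2)
      *: mono_el (addexp mu.1 nu.1, mu.2 :|: nu.2)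
  else 0.
Definition mulA (f g : Alg) : Alg :=
  \sum_(mu : mono) \sum_(nu : mono) (f mu * g nu) *: mulb mu nu.
Definition oneA : Alg := mono_el ([ffun i => ord0], set0).

Definition Y := ('I_m + 'I_n)%type.
Definition tau (r : Y) : bool := if r is inr _ then true else false.

Definition Db (r : Y) (mu : mono) : Alg :=
  match r with
  | inl i => if (0 < mu.1 i)%N then
               mono_el ([ffun j => inord (mu.1 j - (j == i))], mu.2)
             else 0
  | inr k => if k \in mu.2 then
               (-1) ^+ #|[set a in mu.2 | (a < k)%N]| *: mono_el (mu.1, mu.2 :\ k)
             else 0
  end.
Definition DA (r : Y) (f : Alg) : Alg := \sum_(mu : mono) f mu *: Db r mu.

(* W: elements sum_r f_r D_r, encoded by the coefficient family (f_r)_r *)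
Definition Wt := {ffun Y -> Alg}.
Definition fD (f : Alg) (r : Y) : Wt := [ffun s => if s == r then f else 0].
Definition Dr (r : Y) : Wt := fD oneA r.

Definition Alg_par (b : bool) (f : Alg) : Prop := forall mu, f mu != 0 -> mpar mu = b.
Definition evenW (E : Wt) : Prop := forall r, Alg_par (tau r) (E r).

(* action of E = sum_r f_r D_r on A, and the bracket.  For homogeneous even
   elements the supercommutator sign is +1, so on W_0 the bracket
   [sum f_r D_r, sum g_s D_s] = sum_s (E(g_s) - E'(f_s)) D_s.
   This is only used on even elements. *)
Definition appW (E : Wt) (g : Alg) : Alg := \sum_(r : Y) mulA (E r) (DA r g).
Definition brW (E E' : Wt) : Wt := [ffun s => appW E (E' s) - appW E' (E s)].

Definition Drs (r s : Y) (mu : mono) : Wt :=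
  (-1) ^+ (tau r && tau s) *: fD (DA r (mono_el mu)) s
  - (-1) ^+ ((tau r (+) tau s) && mpar mu) *: fD (DA s (mono_el mu)) r.

Definition inS (E : Wt) : Prop :=
  exists c : Y -> Y -> mono -> F,
    E = \sum_(r : Y) \sum_(s : Y) \sum_(mu : mono) c r s mu *: Drs r s mu.
Definition inSS (E : Wt) : Prop := inS E /\ evenW E.

(* Der(S_0, W_0), W_0 an S_0-module by the adjoint action; a map S_0 -> W_0
   is represented by a function Wt -> Wt, only its values on S_0 matter. *)
Definition isDer (D : Wt -> Wt) : Prop :=
  [/\ (forall (a : F) x y, inSS x -> inSS y -> D (a *: x + y) = a *: D x + D y),
      (forall x, inSS x -> evenW (D x)) &
      (forall x y, inSS x -> inSS y -> D (brW x y) = brW x (D y) - brW y (D x))].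

End SuperW.

(* Main.v *)
(* A derivation D : S_0 -> W_0 is first normalised by inner derivations.
   The fields Z_i = D(D_i) satisfy D_i(Z_j) = D_j(Z_i); bracketing with elements of
   S_0 that do not involve x_i shows that Z_i has no term of top degree in x_i, so
   the system D_i(E) = - Z_i can be integrated, and D may be assumed to kill every
   D_i.  It then maps the torus elements h_ik = x_i D_i + xi_k d_k to fields with
   constant coefficients, and dividing by weights makes it kill the torus; a
   combination of the xi_k d_k makes it kill all xi_a d_b and xi_k xi_l D_j too.
   Now D preserves weights.  If it kills all [D_i, y], then D(y) has constant
   coefficients, so D(y) = 0 unless the weight of y, taken modulo p, is that of
   such a field.  As p > 3, this excludes x_i^(a) x_q D_j; when a is not a power of
   p some binomial C(a, b) is nonzero in F and x_i^(a) D_j is a bracket; for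
   a = p^r the value D(x_i^(a) D_j) is a multiple of D_j, which is removed by
   subtracting a multiple of (ad D_i)^(p^r).  Brackets of the elements killed so
   far yield all of S_0.
   The sum is direct because for r > 0 the D_j-coefficient of [E, x_i^(p^r) D_j]
   has no constant term. *)
Require Import Defs.
From HB Require Import structures.
From mathcomp Require Import all_boot all_order all_algebra.
From mathcomp Require Import zify ring.
Import GRing.Theory.
Local Open Scope ring_scope.

Set Implicit Arguments.
Unset Strict Implicit.
Unset Printing Implicit Defensive.

(** * Monomials and the product *)

(** The torus has to lie in S_0. The field x_i D_i alone does not, since its divergence is 1; adding
    xi_k d_k, of superdivergence -1, repairs this, and so the torus elements carry two indices.
    Weights take values in F, hence see exponents only modulo p. As x_i^(p^k) has weight 0 for k >
    0, no torus argument separates x_i^(p^k) D_j from D_j, and this is the room that (ad D_i)^(p^k)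
    occupies. The bound p > 3 comes from comparing a weight difference 2 with the differences -1, 0,
    1 that constant fields allow: 1, 2 and 3 must be nonzero. Generation is delicate because
    brackets produce binomials and weights as coefficients, which may vanish in F, and because
    exponents may be at the top or all odd generators may occur. The case distinctions serve to find
    one bracket with a nonzero coefficient, usually with the help of an index different from two
    given ones. *)

Definition eadd m (a b : {ffun 'I_m -> nat}) : {ffun 'I_m -> nat} :=
  [ffun i => (a i + b i)%N].
Definition esub m (a b : {ffun 'I_m -> nat}) : {ffun 'I_m -> nat} :=
  [ffun i => (a i - b i)%N].
Definition eps m (i : 'I_m) (c : nat) : {ffun 'I_m -> nat} :=
  [ffun j => if j == i then c else 0%N].
Definition ezero m : {ffun 'I_m -> nat} := [ffun=> 0%N].
Arguments ezero {m}.

Section Signs.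
Variables (F : fieldType) (n : nat).
Implicit Types u v w : {set 'I_n}.

Definition sg u v : F := (-1) ^+ inv_count u v.

Lemma inv_countE u v :
  inv_count u v = (\sum_(a in u) \sum_(b in v) (b < a)%N)%N.
Proof.
rewrite /inv_count -sum1_card pair_big_dep /= big_mkcond /=.
rewrite [RHS]big_mkcond /=; apply: eq_bigr => -[a b] _ /=.
by rewrite inE /=; case: (a \in u); case: (b \in v); case: (b < a)%N.
Qed.

Lemma disjoint_setUl u v w :
  [disjoint u :|: v & w] = [disjoint u & w] && [disjoint v & w].
Proof.
by rewrite -disjointU; apply: eq_disjoint => x; rewrite !inE.
Qed.

Lemma disjoint_setUr u v w :
  [disjoint w & u :|: v] = [disjoint w & u] && [disjoint w & v].
Proof. by rewrite disjoint_sym disjoint_setUl ![[disjoint w & _]]disjoint_sym. Qed.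

Lemma sum_setU u v (G : 'I_n -> nat) : [disjoint u & v] ->
  (\sum_(a in u :|: v) G a = \sum_(a in u) G a + \sum_(a in v) G a)%N.
Proof. by move=> d; rewrite -bigU //; apply: eq_bigl => a; rewrite !inE. Qed.

Lemma inv_countUl u v w : [disjoint u & v] ->
  inv_count (u :|: v) w = (inv_count u w + inv_count v w)%N.
Proof. by move=> d; rewrite !inv_countE sum_setU. Qed.

Lemma inv_countUr u v w : [disjoint v & w] ->
  inv_count u (v :|: w) = (inv_count u v + inv_count u w)%N.
Proof.
move=> d; rewrite !inv_countE -big_split /=; apply: eq_bigr => a _.
by rewrite sum_setU.
Qed.

(** Two distinct indices form an inversion in exactly one of the two orders. *)
Lemma inv_countC u v : [disjoint u & v] ->
  (inv_count u v + inv_count v u = #|u| * #|v|)%N.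
Proof.
move=> d; rewrite !inv_countE [X in (_ + X)%N]exchange_big /= -big_split /=.
rewrite -sum_nat_const; apply: eq_bigr => a au.
rewrite -big_split /= -sum1_card; apply: eq_bigr => b bv.
have ab : a != b by apply: contraTneq bv => <-; rewrite (disjointFr d).
by move: ab; rewrite -val_eqE /=; case: ltngtP.
Qed.

Lemma inv_count0l v : inv_count set0 v = 0%N.
Proof. by rewrite inv_countE big_set0. Qed.

Lemma inv_count0r v : inv_count v set0 = 0%N.
Proof. by rewrite inv_countE big1 // => i _; rewrite big_set0. Qed.

Lemma inv_count1 k u : inv_count [set k] u = #|[set a in u | (a < k)%N]|.
Proof.
rewrite inv_countE big_set1 -sum1_card [RHS]big_mkcond /= [LHS]big_mkcond /=.
by apply: eq_bigr => b _; rewrite inE; case: (b \in u); case: (b < k)%N.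
Qed.

Lemma sgUl u v w : [disjoint u & v] -> sg (u :|: v) w = sg u w * sg v w.
Proof. by move=> d; rewrite /sg inv_countUl // exprD. Qed.

Lemma sgUr u v w : [disjoint v & w] -> sg u (v :|: w) = sg u v * sg u w.
Proof. by move=> d; rewrite /sg inv_countUr // exprD. Qed.

Lemma sgC u v : [disjoint u & v] ->
  sg u v = (-1) ^+ (odd #|u| && odd #|v|) * sg v u.
Proof.
move=> d; rewrite /sg -oddM signr_odd -(inv_countC d) exprD -mulrA -expr2.
by rewrite sqrr_sign mulr1.
Qed.

Lemma sg0l v : sg set0 v = 1. Proof. by rewrite /sg inv_count0l. Qed.
Lemma sg0r v : sg v set0 = 1. Proof. by rewrite /sg inv_count0r. Qed.
Lemma sg_sqr u v : sg u v * sg u v = 1.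
Proof. by rewrite -expr2 sqrr_sign. Qed.
Lemma sg_neq0 u v : sg u v != 0. Proof. by rewrite signr_eq0. Qed.

End Signs.

Section Algebra.
Variables (F : fieldType) (p m n : nat) (t : 'I_m -> nat).
Local Notation A := (Alg F p n t).
Local Notation W := (Wt F p n t).
Local Notation pi_ := (piexp p t).
Local Notation "f ** g" := (Defs.mulA f g) (at level 40, left associativity).
Implicit Types (a b : {ffun 'I_m -> nat}) (u v w : {set 'I_n}) (f g h : A).

(** Basis exponents are bounded; the proofs compute with unbounded functions to [nat], so that sums
    and differences carry no range proofs. *)
Definition e2n (al : expo p t) : {ffun 'I_m -> nat} :=
  [ffun i => nat_of_ord (al i)].

(* [monomial a u] is [0] as soon as some [a i] exceeds [pi_i]. *)
Definition monomial a u : A := [ffun nu => ((e2n nu.1 == a) && (nu.2 == u))%:R].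

Lemma e2n_inj : injective e2n.
Proof.
move=> x y /ffunP xy; apply/ffunP=> i; apply: val_inj.
by have := xy i; rewrite !ffunE.
Qed.

Lemma mono_elE (mu : mono p n t) : mono_el F mu = monomial (e2n mu.1) mu.2.
Proof.
apply/ffunP=> nu; rewrite !ffunE (inj_eq e2n_inj).
by case: nu mu => [? ?] [? ?].
Qed.

Lemma e2n_le al i : (e2n al i <= pi_ i)%N.
Proof. by rewrite ffunE -ltnS. Qed.

Lemma e2n_surj a : (forall i, a i <= pi_ i)%N -> {al | a = e2n al}.
Proof.
move=> h; exists [ffun i => inord (a i)]; apply/ffunP=> i.
by rewrite !ffunE inordK // ltnS.
Qed.

Variant mon_spec a : Type :=
| MonIn al of a = e2n al
| MonOut i of (pi_ i < a i)%N & (forall u, monomial a u = 0).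

Lemma monP a : mon_spec a.
Proof.
case: (boolP [forall i, a i <= pi_ i]%N) => [/forallP h|].
  by have [al] := e2n_surj h; apply: MonIn.
move=> h; have /sigW [i hi] : exists i, (pi_ i < a i)%N.
  by move: h; rewrite negb_forall => /existsP [i]; rewrite -ltnNge; exists i.
apply: (MonOut hi) => u; apply/ffunP=> nu; rewrite !ffunE.
case: eqP => //= e; move: hi; rewrite -e ltnNge e2n_le //.
Qed.

Lemma mon_out a u i : (pi_ i < a i)%N -> monomial a u = 0.
Proof.
move=> hi; case: (monP a) => [al e|j _ -> //].
by move: hi; rewrite e ltnNge e2n_le.
Qed.

Lemma mon_e2n al u : monomial (e2n al) u = mono_el F (al, u).
Proof. by rewrite mono_elE. Qed.

Lemma alg_expand f : f = \sum_mu f mu *: monomial (e2n mu.1) mu.2.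
Proof.
apply/ffunP=> nu; rewrite sum_ffunE (bigD1 nu) //= big1 ?addr0.
  by rewrite !ffunE !eqxx /= [_ *: _]mulr1.
move=> mu ne; rewrite -mono_elE !ffunE eq_sym (negPf ne).
by rewrite [_ *: _]mulr0.
Qed.

(** Linearity as a predicate on plain functions, since [mulA], [DA], [appW] and [brW] are not packed
    as linear maps. *)
Definition lin (U V : lmodType F) (phi : U -> V) :=
  forall (k : F) x y, phi (k *: x + y) = k *: phi x + phi y.

Lemma lin_sum (U V : lmodType F) (phi : U -> V) (I : finType) (c : I -> F) (x : I -> U) :
  lin phi ->
  phi (\sum_i c i *: x i) = \sum_i c i *: phi (x i).
Proof.
move=> lp; have l0 : phi 0 = 0.
  by have := lp (-1) 0 0; rewrite scaler0 addr0 scaleN1r addNr.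
by elim/big_rec2: _ => // i y1 y2 _ <-; rewrite lp.
Qed.

Lemma lin_ext_par (V : lmodType F) (phi psi : A -> V) (b : bool) :
  lin phi -> lin psi ->
  (forall a u, odd #|u| = b -> phi (monomial a u) = psi (monomial a u)) ->
  forall f, Alg_par b f -> phi f = psi f.
Proof.
move=> lp lq e f hf; rewrite (alg_expand f) !lin_sum //.
apply: eq_bigr => mu _; have [->|/hf hmu] := eqVneq (f mu) 0.
  by rewrite !scale0r.
by rewrite e.
Qed.

Lemma lin_ext (V : lmodType F) (phi psi : A -> V) :
  lin phi -> lin psi ->
  (forall a u, phi (monomial a u) = psi (monomial a u)) ->
  forall f, phi f = psi f.
Proof.
move=> lp lq e f; rewrite (alg_expand f) !lin_sum //.
by apply: eq_bigr => mu _; rewrite e.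
Qed.

Lemma mulA_linl g : lin (fun f => f ** g).
Proof.
move=> k f1 f2; rewrite /Defs.mulA scaler_sumr -big_split /=.
apply: eq_bigr => mu _; rewrite scaler_sumr -big_split /=.
apply: eq_bigr => nu _; rewrite !ffunE scalerA mulrA -scalerDl; congr (_ *: _).
by rewrite mulrDl.
Qed.

Lemma mulA_linr f : lin (fun g => f ** g).
Proof.
move=> k g1 g2; rewrite /Defs.mulA scaler_sumr -big_split /=.
apply: eq_bigr => mu _; rewrite scaler_sumr -big_split /=.
apply: eq_bigr => nu _; rewrite !ffunE scalerA -scalerDl; congr (_ *: _).
by rewrite mulrDr mulrCA.
Qed.

Lemma lin_comp (U V T : lmodType F) (phi : V -> T) (psi : U -> V) :
  lin phi -> lin psi -> lin (fun x => phi (psi x)).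
Proof. by move=> lp lq k x y; rewrite lq lp. Qed.

Lemma lin_scale (U V : lmodType F) (c : F) (phi : U -> V) :
  lin phi -> lin (fun x => c *: phi x).
Proof. by move=> lp k x y; rewrite lp scalerDr !scalerA mulrC. Qed.

Lemma lin_add (U V : lmodType F) (phi psi : U -> V) :
  lin phi -> lin psi -> lin (fun x => phi x + psi x).
Proof. by move=> lp lq k x y; rewrite lp lq scalerDr addrACA. Qed.

Lemma lin_summ (U V : lmodType F) (I : finType) (phi : I -> U -> V) :
  (forall i, lin (phi i)) -> lin (fun x => \sum_i phi i x).
Proof.
move=> lp k x y; rewrite scaler_sumr -big_split /=.
by apply: eq_bigr => i _; rewrite lp.
Qed.

Lemma lin_id (U : lmodType F) : lin (fun x : U => x). Proof. by []. Qed.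

Lemma mulADl f1 f2 g : (f1 + f2) ** g = f1 ** g + f2 ** g.
Proof. by have := mulA_linl g 1 f1 f2; rewrite !scale1r. Qed.
Lemma mulADr f g1 g2 : f ** (g1 + g2) = f ** g1 + f ** g2.
Proof. by have := mulA_linr f 1 g1 g2; rewrite !scale1r. Qed.
Lemma mulA0l g : 0 ** g = 0.
Proof. by have := mulA_linl g (-1) 0 0; rewrite !scaleN1r oppr0 addr0 addNr. Qed.
Lemma mulA0r f : f ** 0 = 0.
Proof. by have := mulA_linr f (-1) 0 0; rewrite !scaleN1r oppr0 addr0 addNr. Qed.
Lemma mulAZl (k : F) f g : (k *: f) ** g = k *: (f ** g).
Proof. by have := mulA_linl g k f 0; rewrite !addr0 mulA0l addr0. Qed.
Lemma mulAZr (k : F) f g : f ** (k *: g) = k *: (f ** g).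
Proof. by have := mulA_linr f k g 0; rewrite !addr0 mulA0r addr0. Qed.
Lemma mulANl f g : (- f) ** g = - (f ** g).
Proof. by rewrite -scaleN1r mulAZl scaleN1r. Qed.
Lemma mulANr f g : f ** (- g) = - (f ** g).
Proof. by rewrite -scaleN1r mulAZr scaleN1r. Qed.
Lemma mulABl f1 f2 g : (f1 - f2) ** g = f1 ** g - f2 ** g.
Proof. by rewrite mulADl mulANl. Qed.
Lemma mulABr f g1 g2 : f ** (g1 - g2) = f ** g1 - f ** g2.
Proof. by rewrite mulADr mulANr. Qed.
Lemma mulA_suml (I : finType) (G : I -> A) g : (\sum_i G i) ** g = \sum_i G i ** g.
Proof. by elim/big_rec2: _ => [|i x y _ <-]; rewrite ?mulA0l ?mulADl. Qed.
Lemma mulA_sumr (I : finType) (G : I -> A) f : f ** (\sum_i G i) = \sum_i f ** G i.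
Proof. by elim/big_rec2: _ => [|i x y _ <-]; rewrite ?mulA0r ?mulADr. Qed.

Lemma mulA_mono (mu nu : mono p n t) :
  mono_el F mu ** mono_el F nu = mulb F mu nu.
Proof.
rewrite /Defs.mulA (bigD1 mu) //= (bigD1 nu) //= !ffunE !eqxx mulr1 scale1r.
rewrite big1 ?addr0 ?big1 ?addr0 // => [r rn|r rn].
  rewrite big1 // => s _; rewrite ffunE (negPf rn) mul0r scale0r //.
by rewrite !ffunE (negPf rn) mulr0 scale0r.
Qed.

Definition bino a b : F := (\prod_(i < m) 'C(a i + b i, a i))%:R.

(** The range test of [mulb] disappears: when some exponent sum exceeds its bound, the monomial on
    the right is already 0. *)
Lemma mul_mon a u b v : monomial a u ** monomial b v =
  if [disjoint u & v] then (bino a b * sg F u v) *: monomial (eadd a b) (u :|: v)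
  else 0.
Proof.
case: (monP a) => [al ea|i hi /(_ u) ->]; last first.
  rewrite mulA0l; case: ifP => // _; rewrite (@mon_out _ _ i) ?scaler0 //.
  by rewrite ffunE ltn_addr.
case: (monP b) => [be eb|i hi /(_ v) ->]; last first.
  rewrite mulA0r; case: ifP => // _; rewrite (@mon_out _ _ i) ?scaler0 //.
  by rewrite ffunE ltn_addl.
rewrite ea eb !mon_e2n mulA_mono /mulb /=.
case: ifP => [/andP [/forallP h ->]|].
  rewrite mono_elE /=; congr (_ *: _).
    by rewrite /bino; congr (_%:R * _); apply: eq_bigr => i _; rewrite !ffunE.
  congr monomial; apply/ffunP=> i; rewrite !ffunE inordK // ltnS.
  exact: h.
case: ifP => // d; rewrite andbT => /forallP/forallP.
rewrite negb_forall => /existsP [i]; rewrite -ltnNge => hi.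
by rewrite (@mon_out _ _ i) ?scaler0 // !ffunE.
Qed.

Lemma DA_lin r : lin (DA r : A -> A).
Proof.
move=> k f1 f2; rewrite /DA scaler_sumr -big_split /=.
apply: eq_bigr => mu _; rewrite !ffunE scalerA -scalerDl //.
Qed.

Lemma DA_mono r (mu : mono p n t) : DA r (mono_el F mu) = Db F r mu.
Proof.
rewrite /DA (bigD1 mu) //= ffunE eqxx scale1r big1 ?addr0 // => s sn.
by rewrite ffunE (negPf sn) scale0r.
Qed.

Lemma DAD r f g : DA r (f + g) = DA r f + DA r g.
Proof. by have := DA_lin r 1 f g; rewrite !scale1r. Qed.
Lemma DA0 r : DA r (0 : A) = 0.
Proof. by have := DA_lin r (-1) 0 0; rewrite !scaleN1r oppr0 addr0 addNr. Qed.
Lemma DAZ r (k : F) f : DA r (k *: f) = k *: DA r f.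
Proof. by have := DA_lin r k f 0; rewrite !addr0 DA0 addr0. Qed.
Lemma DA_sum r (I : finType) (G : I -> A) : DA r (\sum_i G i) = \sum_i DA r (G i).
Proof. by elim/big_rec2: _ => [|i x y _ <-]; rewrite ?DA0 ?DAD. Qed.

(** The upper bound matters at [a i = pi_i + 1]: there [monomial a u] is 0, but the lowered monomial
    need not be. *)
Lemma DA_even i a u : DA (inl i) (monomial a u) =
  if (0 < a i <= pi_ i)%N then monomial (esub a (eps i 1)) u else 0.
Proof.
case: (monP a) => [al ea|j hj h0].
  rewrite ea mon_e2n DA_mono /= e2n_le andbT ffunE.
  case: ifP => // ai; rewrite mono_elE /=; congr monomial; apply/ffunP=> j.
  rewrite !ffunE inordK; last by have := e2n_le al j; rewrite ffunE; lia.
  by case: eqP.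
rewrite h0 DA0; case: ifP => // hi.
rewrite (@mon_out _ _ j) // !ffunE; case: eqP hi hj => [->|_]; lia.
Qed.

Lemma DA_odd k a u : DA (inr k) (monomial a u) =
  if k \in u then sg F [set k] (u :\ k) *: monomial a (u :\ k) else 0.
Proof.
case: (monP a) => [al ea|j hj h0].
  rewrite ea mon_e2n DA_mono /=; case: ifP => // ku.
  rewrite mono_elE /= /sg inv_count1; congr (_ ^+ _ *: _).
  apply: eq_card => l; rewrite !inE; case: eqVneq => //= ->.
  by rewrite ltnn !andbF.
by rewrite !h0 DA0; case: ifP; rewrite ?scaler0.
Qed.

Lemma addeC a b : eadd a b = eadd b a.
Proof. by apply/ffunP=> i; rewrite !ffunE addnC. Qed.
Lemma addeA a b c : eadd a (eadd b c) = eadd (eadd a b) c.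
Proof. by apply/ffunP=> i; rewrite !ffunE addnA. Qed.
Lemma adde0 a : eadd a ezero = a.
Proof. by apply/ffunP=> i; rewrite !ffunE addn0. Qed.
Lemma add0e a : eadd ezero a = a.
Proof. by apply/ffunP=> i; rewrite !ffunE. Qed.

Lemma binoC a b : bino a b = bino b a.
Proof.
rewrite /bino; congr _%:R; apply: eq_bigr => i _.
by rewrite -bin_sub ?leq_addr // addnC addnK.
Qed.

(** In each coordinate both sides become (a + b + c)! after multiplication by a! b! c!. The
    comparison is made in [nat], since factorials may vanish in F. *)
Lemma binoA a b c : bino a (eadd b c) * bino b c = bino a b * bino (eadd a b) c.
Proof.
rewrite /bino -!natrM -!big_split /=; congr _%:R; apply: eq_bigr => i _.
rewrite !ffunE.
have H x y z : ('C(x + (y + z), x) * 'C(y + z, y) * (x`! * y`! * z`!) = (x + y + z)`!)%N.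
  have := @bin_fact (x + (y + z)) x (leq_addr _ _); rewrite addKn.
  have := @bin_fact (y + z) y (leq_addr _ _); rewrite addKn addnA => <- <-.
  by rewrite -!mulnA !(mulnCA _ 'C(y+z,y)) !(mulnCA _ x`!).
have H' x y z : ('C(x + y, x) * 'C(x + y + z, x + y) * (x`! * y`! * z`!) = (x + y + z)`!)%N.
  have := @bin_fact (x + y + z) (x + y) (leq_addr _ _); rewrite addKn.
  have := @bin_fact (x + y) x (leq_addr _ _); rewrite addKn => <- <-.
  by rewrite -!mulnA !(mulnCA _ 'C(x+y,x)).
apply/eqP; rewrite -(@eqn_pmul2r ((a i)`! * (b i)`! * (c i)`!)%N) ?muln_gt0 ?fact_gt0 //.
by rewrite H H'.
Qed.

Lemma bino0l a : bino ezero a = 1.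
Proof. by rewrite /bino big1 // => i _; rewrite ffunE bin0. Qed.
Lemma bino0r a : bino a ezero = 1.
Proof. by rewrite binoC bino0l. Qed.

Lemma mulA_assoc f g h : f ** (g ** h) = f ** g ** h.
Proof.
have ll x := @mulA_linl x; have lr x := @mulA_linr x.
move: f; apply: lin_ext => [||a u].
- exact: ll.
- exact: (lin_comp (ll h) (ll g)).
move: g; apply: lin_ext => [||b v].
- exact: (lin_comp (lr _) (ll h)).
- exact: (lin_comp (ll h) (lr _)).
move: h; apply: lin_ext => [||c w].
- exact: (lin_comp (lr _) (lr _)).
- exact: lr.
rewrite !mul_mon.
case: (boolP [disjoint v & w]) => vw; case: (boolP [disjoint u & v]) => uv;
  rewrite ?mulA0l ?mulA0r ?mulAZl ?mulAZr ?mul_mon ?disjoint_setUl ?disjoint_setUr ?setUA //.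
- rewrite uv vw /= andbT.
  case: ifP => // uw; rewrite ?scaler0 // !scalerA addeA; congr (_ *: _).
  rewrite sgUr // sgUl //.
  have -> : bino b c * sg F v w * (bino a (eadd b c) * (sg F u v * sg F u w)) =
    (bino a (eadd b c) * bino b c) * (sg F v w * (sg F u v * sg F u w)) by ring.
  by rewrite binoA; ring.
- by rewrite (negPf uv) scaler0.
- by rewrite (negPf vw) andbF scaler0.
Qed.

End Algebra.

(** * Parity, supercommutativity and the Leibniz rule *)

Section Superalgebra.
Variables (F : fieldType) (p m n : nat) (t : 'I_m -> nat).
Hypothesis hp : p \in [pchar F].
Local Notation A := (Alg F p n t).
Local Notation W := (Wt F p n t).
Local Notation pi_ := (piexp p t).
Local Notation mon := (@monomial F p m n t).
Local Notation "f ** g" := (Defs.mulA f g) (at level 40, left associativity).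
Implicit Types (a b : {ffun 'I_m -> nat}) (u v w : {set 'I_n}) (f g h : A).
Implicit Types (r s q : Y m n) (c d e : bool) (E : W).

Lemma p_prime : prime p. Proof. exact: pcharf_prime hp. Qed.

Lemma piexpS i : (pi_ i).+1 = (p ^ t i)%N.
Proof. by rewrite prednK // expn_gt0 prime_gt0 ?p_prime. Qed.

(** From x C(N, x) = N C(N - 1, x - 1): if p did not divide C(N, x), then p^k would divide x, which
    is too small. *)
Lemma bin_dvd_eq0 (N k x : nat) : (p ^ k %| N)%N -> (0 < x < p ^ k)%N ->
  ('C(N, x)%:R : F) = 0.
Proof.
case: x => // x dN /= xk; apply/eqP; rewrite -(dvdn_pcharf hp).
apply: contraTT xk => nd; rewrite -leqNgt dvdn_leq //.
have cp : coprime (p ^ k) 'C(N, x.+1).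
  by rewrite coprimeXl // prime_coprime ?p_prime.
by rewrite -(Gauss_dvdl _ cp) -mul_bin_diag dvdn_mulr.
Qed.

Lemma bin_ppow_eq0 (k x : nat) : (0 < x < p ^ k)%N -> ('C(p ^ k, x)%:R : F) = 0.
Proof. exact: bin_dvd_eq0 (dvdnn _). Qed.

Lemma par_eq c d f : Alg_par c f -> c = d -> Alg_par d f. Proof. by move=> h <-. Qed.
Lemma par0 c : Alg_par c (0 : A).
Proof. by move=> mu; rewrite ffunE eqxx. Qed.
Lemma parD c f g : Alg_par c f -> Alg_par c g -> Alg_par c (f + g).
Proof.
move=> hf hg mu; rewrite ffunE => h.
have [f0|/hf //] := eqVneq (f mu) 0; apply: hg.
by move: h; rewrite f0 add0r.
Qed.
Lemma parZ c k f : Alg_par c f -> Alg_par c (k *: f).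
Proof.
move=> hf mu; rewrite ffunE => h; apply: hf; apply: contraNneq h => ->.
by rewrite scaler0.
Qed.
Lemma parN c f : Alg_par c f -> Alg_par c (- f).
Proof. by move=> hf; rewrite -scaleN1r; apply: parZ. Qed.
Lemma parB c f g : Alg_par c f -> Alg_par c g -> Alg_par c (f - g).
Proof. by move=> hf hg; apply: parD => //; apply: parN. Qed.
Lemma par_sum c (I : Type) (s : seq I) (P : pred I) (G : I -> A) :
  (forall i, P i -> Alg_par c (G i)) -> Alg_par c (\sum_(i <- s | P i) G i).
Proof. by move=> h; elim/big_ind: _ => //; [apply: par0|move=> *; apply: parD]. Qed.
Lemma par_mon a u : Alg_par (odd #|u|) (mon a u).
Proof.
move=> mu; rewrite ffunE; case: (e2n mu.1 == a); rewrite /= ?eqxx //=.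
by have [<-//|_] := eqVneq mu.2 u; rewrite eqxx.
Qed.

Lemma par_expand (V : lmodType F) (Q : V -> Prop) (phi : A -> V) c f :
  lin phi -> Q 0 -> (forall x y, Q x -> Q y -> Q (x + y)) ->
  (forall k x, Q x -> Q (k *: x)) ->
  (forall a u, odd #|u| = c -> Q (phi (mon a u))) ->
  Alg_par c f -> Q (phi f).
Proof.
move=> lp q0 qD qZ qm hf; rewrite (alg_expand f) lin_sum //.
elim/big_ind: _ => // mu _; have [->|/hf hmu] := eqVneq (f mu) 0.
  by rewrite scale0r.
by apply/qZ/qm.
Qed.

Lemma par_mul c d f g : Alg_par c f -> Alg_par d g -> Alg_par (c (+) d) (f ** g).
Proof.
move=> hf hg.
apply: (par_expand (Q := Alg_par (c (+) d)) (@mulA_linl _ _ _ _ _ g) _ _ _ _ hf);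
  [exact: par0|exact: parD|by move=> *; apply: parZ|move=> a u ou].
apply: (par_expand (Q := Alg_par (c (+) d)) (@mulA_linr _ _ _ _ _ _) _ _ _ _ hg);
  [exact: par0|exact: parD|by move=> *; apply: parZ|move=> b v ov].
rewrite mul_mon; case: ifP => duv; last exact: par0.
apply: parZ; apply: (par_eq (@par_mon _ _)).
rewrite -ou -ov cardsU disjoint_setI0 // cards0 subn0 oddD //.
Qed.

Lemma par_DA r c f : Alg_par c f -> Alg_par (tau r (+) c) (DA r f).
Proof.
move=> hf.
apply: (par_expand (Q := Alg_par _) (@DA_lin _ _ _ _ _ r) _ _ _ _ hf);
  [exact: par0|exact: parD|by move=> *; apply: parZ|move=> a u ou].
case: r => [i|k] /=; rewrite ?DA_even ?DA_odd; case: ifP => hr; try exact: par0.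
  by apply: (par_eq (@par_mon _ _)).
apply: parZ; apply: (par_eq (@par_mon _ _)).
by rewrite -ou (cardsD1 k u) hr /= negbK.
Qed.

Lemma oneAE : oneA F p n t = mon ezero set0.
Proof.
rewrite /oneA mono_elE /=; congr (monomial _ _ _ _).
by apply/ffunP=> i; rewrite !ffunE.
Qed.

Lemma mulA1 f : f ** oneA F p n t = f.
Proof.
move: f; apply: lin_ext; [exact: mulA_linl|exact: lin_id|move=> a u].
rewrite oneAE mul_mon /= disjoint_sym disjoints_subset sub0set.
by rewrite setU0 adde0 bino0r sg0r mulr1 scale1r.
Qed.

Lemma mulAC c d f g : Alg_par c f -> Alg_par d g ->
  f ** g = (-1) ^+ (c && d) *: (g ** f).
Proof.
move=> hf hg; move: f hf; apply: lin_ext_par;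
  [exact: mulA_linl|apply: lin_scale; exact: mulA_linr|move=> a u ou].
move: g hg; apply: lin_ext_par;
  [exact: mulA_linr|apply: lin_scale; exact: mulA_linl|move=> b v ov].
rewrite !mul_mon disjoint_sym; case: ifP => d1; last by rewrite scaler0.
rewrite scalerA binoC addeC setUC [sg F u v]sgC 1?disjoint_sym //.
by rewrite ou ov mulrCA.
Qed.

Lemma mul1A f : oneA F p n t ** f = f.
Proof.
move: f; apply: lin_ext; [exact: mulA_linr|exact: lin_id|move=> a u].
have h0 := @par_mon ezero set0; have h1 := @par_mon a u.
by rewrite oneAE (mulAC h0 h1) cards0 /= scale1r -oneAE mulA1.
Qed.

Lemma bino_split a b (i : 'I_m) : bino F a b =
  'C(a i + b i, a i)%:R * \prod_(j < m | j != i) 'C(a j + b j, a j)%:R.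
Proof. by rewrite /bino natr_prod (bigD1 i). Qed.

Lemma esubDl a b i : (0 < a i)%N ->
  eadd (esub a (eps i 1)) b = esub (eadd a b) (eps i 1).
Proof. by clear hp; move=> h; apply/ffunP=> j; rewrite !ffunE; case: eqP => [->|]; lia. Qed.

Lemma esubDr a b i : (0 < b i)%N ->
  eadd a (esub b (eps i 1)) = esub (eadd a b) (eps i 1).
Proof. by clear hp; move=> h; apply/ffunP=> j; rewrite !ffunE; case: eqP => [->|]; lia. Qed.

(* For [x + y = z + 1] the truncated product is [0], and so is ['C(p ^ k, x)]. *)
Lemma pascal_trunc (x y z : nat) k : (x <= z)%N -> (y <= z)%N -> z.+1 = (p ^ k)%N ->
  (if (0 < x + y <= z)%N then 'C(x + y, x)%:R else 0 : F) =
  (if (0 < x)%N && (x + y <= z.+1)%N then 'C(x.-1 + y, x.-1)%:R else 0) +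
  (if (0 < y)%N && (x + y <= z.+1)%N then 'C(x + y.-1, x)%:R else 0).
Proof.
move=> xz yz zk.
have [le|gt] := leqP (x + y) z.
  rewrite (leqW le) !andbT; case: x xz le => [|x] xz le; case: y yz le => [|y] yz le;
    rewrite /= ?add0n ?addn0 ?binn ?bin0 ?addr0 ?add0r //.
  by rewrite addSn binS natrD addrC addSnnS.
rewrite andbF; have [eq|ne] := leqP (x + y) z.+1; last by rewrite !andbF addr0.
have exy : (x + y = z.+1)%N by lia.
have [x0|x0] := posnP x; first by lia.
have [y0|y0] := posnP y; first by lia.
rewrite -natrD -(@bin_ppow_eq0 k x); last by rewrite -zk x0 /=; lia.
rewrite -zk -exy; case: x x0 {xz exy gt eq} => // x _; case: y y0 {yz} => // y _.
by rewrite /= addSn binS addnC addSnnS.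
Qed.

(** The exceptions are genuine: for [a i = pi_i + 1] and [b = 0] the left side is 0 while the right
    side may not be. In these cases one of the two monomials vanishes, so the Leibniz rule is
    trivial there. *)
Lemma leibniz_even_mon i a b w :
  bino F a b *: DA (inl i) (mon (eadd a b) w : A) =
  (if (0 < a i)%N then bino F (esub a (eps i 1)) b *:
      mon (eadd (esub a (eps i 1)) b) w else 0) +
  (if (0 < b i)%N then bino F a (esub b (eps i 1)) *:
      mon (eadd a (esub b (eps i 1))) w else 0)
  \/ (pi_ i < a i)%N \/ (pi_ i < b i)%N.
Proof.
have [ai|ai] := leqP (a i) (pi_ i); last by right; left.
have [bi|bi] := leqP (b i) (pi_ i); last by right; right.
left; rewrite DA_even ffunE.
set R := \prod_(j < m | j != i) ('C(a j + b j, a j)%:R : F).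
have -> : bino F a b = 'C(a i + b i, a i)%:R * R by rewrite (bino_split _ _ i).
have -> : bino F (esub a (eps i 1)) b = 'C((a i).-1 + b i, (a i).-1)%:R * R.
  rewrite (bino_split _ _ i) !ffunE eqxx subn1; congr (_ * _).
  by apply: eq_bigr => j /negPf ji; rewrite !ffunE ji subn0.
have -> : bino F a (esub b (eps i 1)) = 'C(a i + (b i).-1, a i)%:R * R.
  rewrite (bino_split _ _ i) !ffunE eqxx subn1; congr (_ * _).
  by apply: eq_bigr => j /negPf ji; rewrite !ffunE ji subn0.
have out : ((pi_ i).+1 < a i + b i)%N -> mon (esub (eadd a b) (eps i 1)) w = 0 :> A.
  by move=> h; rewrite (@mon_out _ _ _ _ _ _ _ i) // !ffunE eqxx; lia.
have P := @pascal_trunc (a i) (b i) _ (t i) ai bi (piexpS i).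
have -> : (if (0 < a i)%N then ('C((a i).-1 + b i, (a i).-1)%:R * R) *:
      mon (eadd (esub a (eps i 1)) b) w else 0 : A) =
    ((if (0 < a i)%N && (a i + b i <= (pi_ i).+1)%N then 'C((a i).-1 + b i, (a i).-1)%:R else 0) * R) *: mon (esub (eadd a b) (eps i 1)) w.
  case: ltnP => a0 /=; last by rewrite mul0r scale0r.
  by rewrite esubDl //; case: leqP => // /out ->; rewrite !scaler0.
have -> : (if (0 < b i)%N then ('C(a i + (b i).-1, a i)%:R * R) *:
      mon (eadd a (esub b (eps i 1))) w else 0 : A) =
    ((if (0 < b i)%N && (a i + b i <= (pi_ i).+1)%N then 'C(a i + (b i).-1, a i)%:R else 0) * R) *: mon (esub (eadd a b) (eps i 1)) w.
  case: ltnP => b0 /=; last by rewrite mul0r scale0r.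
  by rewrite esubDr //; case: leqP => // /out ->; rewrite !scaler0.
rewrite -scalerDl -mulrDl -P; case: ifP => _; rewrite ?mul0r ?scale0r ?scaler0 //.
Qed.

Lemma sg_D1l k u v : k \in u -> sg F u v = sg F [set k] v * sg F (u :\ k) v.
Proof.
move=> ku; rewrite -{1}(setD1K ku) sgUl // disjoints1.
by rewrite !inE eqxx.
Qed.

Lemma sg_D1r k u v : k \in u -> sg F v u = sg F v [set k] * sg F v (u :\ k).
Proof.
move=> ku; rewrite -{1}(setD1K ku) sgUr // disjoints1.
by rewrite !inE eqxx.
Qed.

(** The delicate case is an odd D_k with xi_k in both factors: the product is 0, and the two terms
    on the right cancel because moving xi_k past the rest of [u] costs exactly the sign of the
    rule. *)
Lemma leibniz_mon r a u b v : DA r (mon a u ** mon b v : A) =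
  DA r (mon a u) ** mon b v +
  (-1) ^+ (tau r && odd #|u|) *: (mon a u ** DA r (mon b v)).
Proof.
case: r => [i|k] /=.
  rewrite expr0 scale1r.
  have [a1|a1] := leqP (a i) (pi_ i); last first.
    by rewrite (@mon_out _ _ _ _ _ _ _ _ a1) DA0 !mulA0l DA0 addr0.
  have [b1|b1] := leqP (b i) (pi_ i); last first.
    by rewrite (@mon_out _ _ _ _ _ _ _ _ b1) DA0 !mulA0r DA0 addr0.
  have [duv|duv] := boolP [disjoint u & v]; last first.
    rewrite mul_mon (negPf duv) DA0 !DA_even.
    by case: ifP => _; case: ifP => _; rewrite ?mulA0l ?mulA0r ?mul_mon ?(negPf duv) addr0.
  rewrite mul_mon duv DAZ mulrC -scalerA.
  have [->|[]] := leibniz_even_mon i a b (u :|: v); try by lia.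
  rewrite scalerDr !DA_even a1 b1 !andbT; congr (_ + _).
    by case: ifP; rewrite ?scaler0 ?mulA0l // mul_mon duv scalerA mulrC.
  by case: ifP; rewrite ?scaler0 ?mulA0r // mul_mon duv scalerA mulrC.
rewrite mul_mon !DA_odd.
have [duv|duv] := boolP [disjoint u & v].
  rewrite DAZ DA_odd in_setU.
  case: (boolP (k \in u)) => ku; case: (boolP (k \in v)) => kv /=.
  - by have := disjointFr duv ku; rewrite kv.
  - rewrite mulA0r scaler0 addr0 mulAZl mul_mon.
    have E : (u :|: v) :\ k = u :\ k :|: v.
      by rewrite setDUl; congr (_ :|: _); apply/setDidPl; rewrite disjoint_sym disjoints1.
    have -> : [disjoint u :\ k & v].
      by apply: disjointWl duv; apply/subsetP => x; rewrite !inE => /andP [].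
    have d2 : [disjoint u :\ k & v].
      by apply: disjointWl duv; apply/subsetP => x; rewrite !inE => /andP [].
    rewrite E !scalerA; congr (_ *: _).
    rewrite (sg_D1l v ku) sgUr //.
    transitivity (bino F a b * sg F (u :\ k) v * sg F [set k] (u :\ k) * (sg F [set k] v * sg F [set k] v)); first by ring.
    by rewrite sg_sqr; ring.
  - rewrite mulA0l add0r mulAZr mul_mon.
    have E : (u :|: v) :\ k = u :|: v :\ k.
      by rewrite setDUl; congr (_ :|: _); apply/setDidPl; rewrite disjoint_sym disjoints1.
    have d2 : [disjoint u & v :\ k].
      by apply: disjointWr duv; apply/subsetP => x; rewrite !inE => /andP [].
    rewrite d2 E !scalerA; congr (_ *: _).
    rewrite (sg_D1r u kv) sgUr // [sg F u [set k]]sgC; last by rewrite disjoint_sym disjoints1.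
    rewrite cards1 /= andbT.
    transitivity (bino F a b * sg F u (v :\ k) * sg F [set k] (v :\ k) * (-1) ^+ odd #|u| * (sg F [set k] u * sg F [set k] u)); first by ring.
    by rewrite sg_sqr; ring.
  - by rewrite mulA0l mulA0r !scaler0 addr0.
rewrite DA0; case: (boolP (k \in u)) => ku; case: (boolP (k \in v)) => kv.
- rewrite mulAZl mulAZr !mul_mon.
  have [d1|d1] := boolP [disjoint u :\ k & v :\ k]; last first.
    have -> : [disjoint u :\ k & v] = false.
      apply: contraNF d1; apply: disjointWr.
      by apply/subsetP => x; rewrite !inE => /andP [].
    have -> : [disjoint u & v :\ k] = false.
      apply: contraNF d1; apply: disjointWl.
      by apply/subsetP => x; rewrite !inE => /andP [].
    by rewrite !scaler0 addr0.
  have k1 : [disjoint u :\ k & [set k]] by rewrite disjoint_sym disjoints1 !inE eqxx.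
  have k2 : [disjoint [set k] & v :\ k] by rewrite disjoints1 !inE eqxx.
  have d2 : [disjoint u :\ k & v] by rewrite -(setD1K kv) disjoint_setUr k1 d1.
  have d3 : [disjoint u & v :\ k] by rewrite -(setD1K ku) disjoint_setUl k2 d1.
  have E : u :\ k :|: v = u :|: v :\ k.
    apply/setP => x; rewrite !inE; case: eqP => [->|_] /=; by rewrite ?ku ?kv ?orbT.
  rewrite d2 d3 !scalerA E -scalerDl.
  rewrite [sg F (u :\ k) v](sg_D1r _ kv) [sg F u _](sg_D1l _ ku) (sgC _ k1) cards1 andbT.
  rewrite (cardsD1 k u) ku /= signrN.
  set s1 := sg F (u :\ k) (v :\ k); set s2 := sg F [set k] (u :\ k).
  set s3 := sg F [set k] (v :\ k); set e := _ ^+ odd _; set B := bino F a b.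
  have -> : s2 * (B * (e * s2 * s1)) + - e * (s3 * (B * (s3 * s1))) =
     B * e * s1 * (s2 * s2) - B * e * s1 * (s3 * s3) by ring.
  by rewrite !sg_sqr subrr scale0r.
- by rewrite mulA0r scaler0 addr0 mulAZl mul_mon; case: ifP => d1; rewrite ?scaler0 //;
    move: duv; rewrite -(setD1K ku) disjoint_setUl d1 disjoints1 kv.
- rewrite mulA0l add0r mulAZr mul_mon; case: ifP => d1; rewrite ?scaler0 //.
  by move: duv; rewrite -(setD1K kv) disjoint_setUr d1 disjoint_sym disjoints1 ku.
- by rewrite mulA0l mulA0r scaler0 addr0.
Qed.

Lemma leibniz r c f g : Alg_par c f ->
  DA r (f ** g) = DA r f ** g + (-1) ^+ (tau r && c) *: (f ** DA r g).
Proof.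
have ll x := @mulA_linl F p m n t x; have lr x := @mulA_linr F p m n t x.
have lD := @DA_lin F p m n t r.
move: f; apply: lin_ext_par.
- exact: (lin_comp lD (ll g)).
- by apply: lin_add; [exact: (lin_comp (ll g) lD)|apply: lin_scale; exact: ll].
move=> a u ou; move: g; apply: lin_ext.
- exact: (lin_comp lD (lr _)).
- by apply: lin_add; [exact: lr|apply: lin_scale; exact: (lin_comp (lr _) lD)].
by move=> b v; rewrite leibniz_mon ou.
Qed.

Lemma DAC r s f : DA r (DA s f) = (-1) ^+ (tau r && tau s) *: DA s (DA r f).
Proof.
clear hp.
have lD q := @DA_lin F p m n t q.
move: f; apply: lin_ext.
- exact: (lin_comp (lD r) (lD s)).
- apply: lin_scale; exact: (lin_comp (lD s) (lD r)).
move=> a u; case: r => [i|k]; case: s => [j|l] /=; rewrite ?expr0 ?scale1r.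
- have [->//|ij] := eqVneq i j.
  rewrite !DA_even.
  case: ifP => hj; case: ifP => hi; rewrite ?DA0 ?DA_even ?ffunE ?(negPf ij) 1?eq_sym ?(negPf ij) ?subn0 ?hi ?hj //.
  congr (monomial _ _ _ _); apply/ffunP=> x; rewrite !ffunE; lia.
- rewrite DA_odd DA_even; case: ifP => hl; case: ifP => hi;
    by rewrite ?DA0 ?DAZ ?DA_even ?DA_odd ?hi ?hl ?scaler0.
- rewrite DA_odd DA_even; case: ifP => hl; case: ifP => hi;
    by rewrite ?DA0 ?DAZ ?DA_even ?DA_odd ?hi ?hl ?scaler0.
- rewrite !DA_odd; have [->|kl] := eqVneq k l.
    by case: ifP => kl; rewrite ?DA0 ?DAZ ?DA_odd ?inE ?eqxx ?scaler0.
  case: ifP => hl; case: ifP => hk; rewrite ?DA0 ?DAZ ?DA_odd ?inE 1?eq_sym ?(negPf kl) ?hl ?hk ?scaler0 //=.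
    have -> : (l != k) by rewrite eq_sym.
    have hl2 : l \in u :\ k by rewrite !inE eq_sym kl.
    have hk2 : k \in u :\ l by rewrite !inE kl.
    have -> : u :\ k :\ l = u :\ l :\ k by rewrite !setDDl setUC.
    rewrite !scalerA; congr (_ *: _).
    rewrite (sg_D1r _ hl2) (sg_D1r _ hk2) (@sgC _ _ [set k] [set l]) ?disjoints1 ?inE // !cards1 /=.
    by rewrite !setDDl setUC; ring.
  by rewrite andbF scaler0.
Qed.

End Superalgebra.

(** * The bracket; the special algebra is closed under it *)

Section Fields.
Variables (F : fieldType) (p m n : nat) (t : 'I_m -> nat).
Hypothesis hp : p \in [pchar F].
Local Notation A := (Alg F p n t).
Local Notation W := (Wt F p n t).
Local Notation pi_ := (piexp p t).
Local Notation mon := (@monomial F p m n t).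
Local Notation "f ** g" := (Defs.mulA f g) (at level 40, left associativity).
Implicit Types (a b : {ffun 'I_m -> nat}) (u v w : {set 'I_n}) (f g h : A).
Implicit Types (r s q : Y m n) (c d e : bool) (E : W).

Definition smul f E : W := [ffun r => f ** E r].

Lemma fD_lin r : lin (fun f => fD f r).
Proof.
move=> k f g; apply/ffunP=> s; rewrite !ffunE; case: eqP => // _.
by rewrite scaler0 addr0.
Qed.

Lemma lin0 (U V : lmodType F) (phi : U -> V) : lin phi -> phi 0 = 0.
Proof. by move=> /(_ (-1) 0 0); rewrite scaler0 addr0 scaleN1r addNr. Qed.
Lemma linD (U V : lmodType F) (phi : U -> V) x y : lin phi -> phi (x + y) = phi x + phi y.
Proof. by move=> /(_ 1 x y); rewrite !scale1r. Qed.
Lemma linZ (U V : lmodType F) (phi : U -> V) k x : lin phi -> phi (k *: x) = k *: phi x.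
Proof. by move=> lp; rewrite -[k *: x]addr0 lp lin0 // addr0. Qed.
Lemma linN (U V : lmodType F) (phi : U -> V) x : lin phi -> phi (- x) = - phi x.
Proof. by move=> lp; rewrite -scaleN1r linZ // scaleN1r. Qed.

Lemma appW_linl g : lin (fun E => appW E g).
Proof.
move=> k E1 E2; rewrite /appW scaler_sumr -big_split /=; apply: eq_bigr => r _.
by rewrite !ffunE mulADl mulAZl.
Qed.

Lemma appW_linr E : lin (appW E).
Proof.
by apply: lin_summ => r; apply: (lin_comp (@mulA_linr _ _ _ _ _ _) (@DA_lin _ _ _ _ _ r)).
Qed.

Lemma brW_linr E : lin (brW E).
Proof.
move=> k E1 E2; apply/ffunP=> s.
by rewrite !ffunE (appW_linr E) (appW_linl (E s)) scalerBr opprD addrACA.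
Qed.

Lemma brWC E1 E2 : brW E1 E2 = - brW E2 E1.
Proof. by apply/ffunP=> s; rewrite !ffunE opprB. Qed.

Lemma brW_linl E : lin (fun E1 => brW E1 E).
Proof.
by move=> k E1 E2; rewrite brWC (brW_linr E) opprD -scalerN -!brWC.
Qed.

Lemma brW0r E : brW E 0 = 0. Proof. exact: (lin0 (@brW_linr E)). Qed.
Lemma brWDl E1 E2 E : brW (E1 + E2) E = brW E1 E + brW E2 E.
Proof. exact: (linD _ _ (@brW_linl E)). Qed.
Lemma brWDr E1 E2 E : brW E (E1 + E2) = brW E E1 + brW E E2.
Proof. exact: (linD _ _ (@brW_linr E)). Qed.
Lemma brWZl k E1 E : brW (k *: E1) E = k *: brW E1 E.
Proof. exact: (linZ _ _ (@brW_linl E)). Qed.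
Lemma brWZr k E1 E : brW E (k *: E1) = k *: brW E E1.
Proof. exact: (linZ _ _ (@brW_linr E)). Qed.
Lemma brWNr E1 E : brW E (- E1) = - brW E E1.
Proof. exact: (linN _ (@brW_linr E)). Qed.
Lemma brWBl E1 E2 E : brW (E1 - E2) E = brW E1 E - brW E2 E.
Proof. by rewrite brWDl -scaleN1r brWZl scaleN1r. Qed.

Lemma evenW0 : evenW (0 : W).
Proof. by move=> r; rewrite ffunE; apply: par0. Qed.
Lemma evenWD E1 E2 : evenW E1 -> evenW E2 -> evenW (E1 + E2).
Proof. by move=> h1 h2 r; rewrite ffunE; apply: parD. Qed.
Lemma evenWZ k E : evenW E -> evenW (k *: E).
Proof. by move=> h r; rewrite ffunE; apply: parZ. Qed.
Lemma evenWN E : evenW E -> evenW (- E).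
Proof. by move=> h; rewrite -scaleN1r; apply: evenWZ. Qed.
Lemma evenWB E1 E2 : evenW E1 -> evenW E2 -> evenW (E1 - E2).
Proof. by move=> h1 h2; apply/evenWD/evenWN. Qed.
Lemma evenW_fD f r : Alg_par (tau r) f -> evenW (fD f r).
Proof. by move=> h s; rewrite ffunE; case: eqP => [->|_] //; apply: par0. Qed.

Lemma par_appW E c f : evenW E -> Alg_par c f -> Alg_par c (appW E f).
Proof.
move=> hE hf; apply: par_sum => r _.
by apply: (par_eq (par_mul (hE r) (par_DA hf))); rewrite addbA addbb.
Qed.

Lemma evenW_br E1 E2 : evenW E1 -> evenW E2 -> evenW (brW E1 E2).
Proof. by move=> h1 h2 r; rewrite ffunE; apply: parB; apply: par_appW. Qed.

(** Moving f past the coefficient [E r] produces the sign of the Leibniz rule of D_r once more, so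
    the two cancel: an even field is an ordinary derivation. *)
Lemma appW_leib E c f g : evenW E -> Alg_par c f ->
  appW E (f ** g) = appW E f ** g + f ** appW E g.
Proof.
move=> hE hf; rewrite /appW mulA_suml mulA_sumr -big_split /=; apply: eq_bigr => r _.
rewrite (leibniz hp _ _ hf) mulADr !mulA_assoc; congr (_ + _).
rewrite mulAZr mulA_assoc (mulAC (hE r) hf) mulAZl scalerA -expr2 sqrr_sign.
by rewrite scale1r.
Qed.

(** In both compositions the first-order part gives the bracket, and the second-order parts agree,
    since coefficients and derivations commute up to the same sign. *)
Lemma appW_br E1 E2 f : evenW E1 -> evenW E2 ->
  appW (brW E1 E2) f = appW E1 (appW E2 f) - appW E2 (appW E1 f).
Proof.
move=> h1 h2.
have H E E' : evenW E -> evenW E' -> appW E (appW E' f) =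
    \sum_r appW E (E' r) ** DA r f + \sum_r \sum_s E' r ** E s ** DA s (DA r f).
  move=> h h'; rewrite {2}/appW (_ : appW E _ = \sum_r appW E (E' r ** DA r f)).
    rewrite -big_split; apply: eq_bigr => r _ /=; rewrite (appW_leib _ h (h' r)).
    by congr (_ + _); rewrite /appW mulA_sumr; apply: eq_bigr => s _; rewrite mulA_assoc.
  elim/big_rec2: _ => [|i x y _ <-]; first exact: (lin0 (appW_linr E)).
  by rewrite (linD _ _ (appW_linr E)).
rewrite H // (H E2) // [X in _ - (_ + X)]exchange_big /=.
rewrite opprD addrACA [X in _ + X](_ : _ = 0) ?addr0.
  rewrite /appW -sumrB; apply: eq_bigr => r _.
  by rewrite ffunE mulABl.
rewrite -sumrB big1 // => r _; rewrite -sumrB big1 // => s _.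
rewrite (mulAC (h2 r) (h1 s)) DAC.
rewrite mulAZl mulAZr scalerA [tau s && _]andbC -expr2.
by rewrite sqrr_sign scale1r subrr.
Qed.

(** Coefficientwise, [appW_br] turns both sides into the same sum of twofold actions. *)
Lemma jacobi E1 E2 E3 : evenW E1 -> evenW E2 -> evenW E3 ->
  brW E1 (brW E2 E3) = brW (brW E1 E2) E3 + brW E2 (brW E1 E3).
Proof.
move=> h1 h2 h3; apply/ffunP=> s; rewrite ![in LHS]ffunE !ffunE.
have lB E f g : appW E (f - g) = appW E f - appW E g.
  by rewrite (linD _ _ (appW_linr E)) (linN _ (appW_linr E)).
rewrite !appW_br // !lB.
move: (appW E1 (appW E2 _)) (appW E1 (appW E3 _)) (appW E2 (appW E3 _)).
move: (appW E2 (appW E1 _)) (appW E3 (appW E1 _)) (appW E3 (appW E2 _)).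
by move=> x1 x2 x3 x4 x5 x6; apply/ffunP => nu; rewrite !ffunE; ring.
Qed.

Lemma appW_fD f r g : appW (fD f r) g = f ** DA r g.
Proof.
rewrite /appW (bigD1 r) //= big1 ?addr0 ?ffunE ?eqxx // => s /negPf sr.
by rewrite ffunE sr mulA0l.
Qed.

Lemma appW_fDlin E f s r : appW E (fD f s r) = if r == s then appW E f else 0.
Proof. by rewrite ffunE; case: eqP => // _; apply: (lin0 (appW_linr E)). Qed.

Lemma br_fD f r g s :
  brW (fD f r) (fD g s) = fD (f ** DA r g) s - fD (g ** DA s f) r.
Proof.
apply/ffunP=> q; rewrite !ffunE -!/(fD _ _ _) !appW_fD; congr (_ - _).
  by case: eqP => // _; rewrite DA0 mulA0r.
by case: eqP => // _; rewrite DA0 mulA0r.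
Qed.

Lemma DA_one r : DA r (oneA F p n t) = 0.
Proof.
rewrite oneAE; case: r => [i|k]; rewrite ?DA_even ?DA_odd ?inE //.
by rewrite ffunE.
Qed.

Lemma brW_Dr i E : brW (Dr F p t (inl i)) E = [ffun r => DA (inl i) (E r)].
Proof.
apply/ffunP=> r; rewrite !ffunE -/(fD _ _ _) appW_fD mul1A.
rewrite [X in _ - X](_ : _ = 0) ?subr0 //.
rewrite /appW big1 // => s _.
by case: eqP => // _; rewrite ?DA_one ?DA0 mulA0r.
Qed.

Lemma evenW_Dr i : evenW (Dr F p t (inl i) : W).
Proof.
apply: evenW_fD => /=; rewrite oneAE; apply: (par_eq (@par_mon _ _ _ _ _ _ _)).
by rewrite cards0.
Qed.

Lemma brW_fDr E g s :
  brW E (fD g s) = fD (appW E g) s - \sum_q fD (g ** DA s (E q)) q.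
Proof.
apply/ffunP=> r; rewrite [LHS]ffunE appW_fD appW_fDlin !ffunE sum_ffunE; congr (_ - _).
rewrite (bigD1 r) //= big1 ?addr0 ?ffunE ?eqxx // => q.
by rewrite ffunE eq_sym => /negPf ->.
Qed.

Lemma appW_DA E r f : evenW E ->
  appW E (DA r f) = DA r (appW E f) - \sum_q DA r (E q) ** DA q f.
Proof.
move=> hE; apply/eqP; rewrite eq_sym subr_eq; apply/eqP.
rewrite /appW DA_sum -big_split; apply: eq_bigr => q _ /=.
rewrite (leibniz hp _ _ (hE q)) addrC; congr (_ + _).
by rewrite DAC mulAZr scalerA -expr2 sqrr_sign scale1r.
Qed.

(* [D_rs f] for [f] of parity [tau r + tau s], the case in which [D_rs f] is even. *)
Definition divfield r s f : W :=
  (-1) ^+ (tau r && tau s) *: fD (DA r f) s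
  - (-1) ^+ (tau r (+) tau s) *: fD (DA s f) r.

Lemma DF_lin r s : lin (divfield r s).
Proof.
have l1 q q' := lin_comp (@fD_lin q) (@DA_lin F p m n t q').
move=> k f g; rewrite /divfield -!scaleNr.
by apply: (lin_add (lin_scale _ (l1 s r)) (lin_scale _ (l1 r s))).
Qed.

Lemma Drs_DF r s (mu : mono p n t) : mpar mu = tau r (+) tau s ->
  Drs F r s mu = divfield r s (mon (e2n mu.1) mu.2).
Proof. by move=> h; rewrite /Drs h andbb mono_elE. Qed.

(** * The span of the fields D_rs(f) and the divergence *)

Lemma inSD E1 E2 : inS E1 -> inS E2 -> inS (E1 + E2).
Proof.
move=> [c1 ->] [c2 ->]; exists (fun r s mu => c1 r s mu + c2 r s mu).
rewrite -big_split; apply: eq_bigr => r _; rewrite -big_split; apply: eq_bigr => s _.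
by rewrite -big_split; apply: eq_bigr => mu _; rewrite scalerDl.
Qed.

Lemma inSZ k E : inS E -> inS (k *: E).
Proof.
move=> [c ->]; exists (fun r s mu => k * c r s mu).
rewrite scaler_sumr; apply: eq_bigr => r _; rewrite scaler_sumr.
apply: eq_bigr => s _; rewrite scaler_sumr; apply: eq_bigr => mu _.
by rewrite scalerA.
Qed.

Lemma inS_Drs r s mu : inS (Drs F r s mu : W).
Proof.
exists (fun r' s' mu' => ((r' == r) && (s' == s) && (mu' == mu))%:R).
rewrite (bigD1 r) //= [X in _ + X]big1 ?addr0 => [|r' /negPf rr].
  rewrite (bigD1 s) //= [X in _ + X]big1 ?addr0 => [|s' /negPf ss].
    rewrite (bigD1 mu) //= [X in _ + X]big1 ?addr0 => [|mu' /negPf mm].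
      by rewrite !eqxx scale1r.
    by rewrite mm andbF scale0r.
  by rewrite big1 // => mu' _; rewrite ss andbF scale0r.
by rewrite big1 // => s' _; rewrite big1 // => mu' _; rewrite rr scale0r.
Qed.

Lemma inSSD E1 E2 : inSS E1 -> inSS E2 -> inSS (E1 + E2).
Proof. by move=> [? ?] [? ?]; split; [apply: inSD|apply: evenWD]. Qed.
Lemma inSSZ k E : inSS E -> inSS (k *: E).
Proof. by move=> [? ?]; split; [apply: inSZ|apply: evenWZ]. Qed.
Lemma inSS0 : inSS (0 : W).
Proof.
split; last exact: evenW0.
exists (fun _ _ _ => 0); rewrite big1 // => r _; rewrite big1 // => s _.
by rewrite big1 // => mu _; rewrite scale0r.
Qed.
Lemma inSSN E : inSS E -> inSS (- E).
Proof. by move=> h; rewrite -scaleN1r; apply: inSSZ. Qed.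
Lemma inSSB E1 E2 : inSS E1 -> inSS E2 -> inSS (E1 - E2).
Proof. by move=> h1 h2; apply/inSSD/inSSN. Qed.

Lemma par_DF r s f : Alg_par (tau r (+) tau s) f -> evenW (divfield r s f).
Proof.
move=> hf; apply: evenWB; apply/evenWZ/evenW_fD; apply: (par_eq (par_DA hf)).
  by rewrite addbA addbb.
by rewrite addbC -addbA addbb addbF.
Qed.

Lemma mon_in a u : mon a u = 0 \/ exists mu : mono p n t, a = e2n mu.1 /\ u = mu.2.
Proof.
case: (@monP F p m n t a) => [al ->|i _ ->]; [right|by left].
by exists (al, u).
Qed.

Lemma inSS_DF r s f : Alg_par (tau r (+) tau s) f -> inSS (divfield r s f).
Proof.
move=> hf; apply: (par_expand (Q := @inSS F p m n t) (@DF_lin r s) _ _ _ _ hf);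
  [exact: inSS0|exact: inSSD|by move=> *; apply: inSSZ|move=> a u ou].
have [->|[mu [ea eu]]] := mon_in a u.
  by rewrite (lin0 (@DF_lin r s)); apply: inSS0.
split; last by apply: par_DF; rewrite -ou; apply: par_mon.
by rewrite ea eu -Drs_DF; [apply: inS_Drs|rewrite /mpar -eu].
Qed.

Definition evproj E : W :=
  [ffun r => [ffun mu => if mpar mu == tau r then E r mu else 0]].

Lemma evproj_lin : lin evproj.
Proof.
move=> k E1 E2; apply/ffunP=> r; apply/ffunP=> mu; rewrite !ffunE.
by case: eqP => // _; rewrite scaler0 addr0.
Qed.

Lemma evproj_even E : evenW E -> evproj E = E.
Proof.
move=> h; apply/ffunP=> r; apply/ffunP=> mu; rewrite !ffunE.
by case: eqP => // ne; have [//|/h] := eqVneq (E r mu) 0.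
Qed.

Lemma evproj_odd E : (forall r, Alg_par (~~ tau r) (E r)) -> evproj E = 0.
Proof.
move=> h; apply/ffunP=> r; apply/ffunP=> mu; rewrite !ffunE.
case: eqP => // e; have [//|/h] := eqVneq (E r mu) 0.
by rewrite e; case: (tau r).
Qed.

(** The expansion supplied by [inS] may contain odd generators although the element is even. The
    projection [evproj] fixes the element and kills these, so the even D_rs(f) of monomials span
    S_0. *)
Lemma inSS_ind (P : W -> Prop) :
  P 0 -> (forall x y, P x -> P y -> P (x + y)) -> (forall k x, P x -> P (k *: x)) ->
  (forall r s a u, odd #|u| = tau r (+) tau s -> P (divfield r s (mon a u))) ->
  forall x, inSS x -> P x.
Proof.
move=> P0 PD PZ PDF x [[c ex] ev]; rewrite -(evproj_even ev) {}ex.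
have eD x1 x2 : evproj (x1 + x2) = evproj x1 + evproj x2.
  exact: (linD _ _ evproj_lin).
have ZP : P (evproj 0) by rewrite (lin0 evproj_lin).
elim/big_ind: _ => // [x1 x2|r _]; first by rewrite eD; apply: PD.
elim/big_ind: _ => // [x1 x2|s _]; first by rewrite eD; apply: PD.
elim/big_ind: _ => // [x1 x2|mu _]; first by rewrite eD; apply: PD.
rewrite (linZ _ _ evproj_lin); apply: PZ.
have [e|ne] := eqVneq (mpar mu) (tau r (+) tau s).
  rewrite Drs_DF // evproj_even; first by apply: PDF.
  by apply: par_DF; rewrite -e; apply: par_mon.
rewrite evproj_odd // => q; have e : mpar mu = ~~ (tau r (+) tau s).
  by move: ne; case: (mpar mu); case: (tau r (+) _).
have hm : Alg_par (~~ (tau r (+) tau s)) (mono_el F mu).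
  by rewrite -e mono_elE; apply: par_mon.
rewrite /Drs !ffunE; apply: parB; apply: parZ; case: eqP => [->|_]; try exact: par0.
  by apply: (par_eq (par_DA hm)); case: (tau r); case: (tau s).
by apply: (par_eq (par_DA hm)); case: (tau r); case: (tau s).
Qed.

(** The superdivergence; with these signs the two mixed second derivatives in the divergence of
    D_rs(f) cancel. *)
Definition divW E : A := \sum_q (-1) ^+ tau q *: DA q (E q).

Lemma divW_lin : lin divW.
Proof.
apply: lin_summ => q; apply: lin_scale => k E1 E2.
by rewrite !ffunE DA_lin.
Qed.

Lemma divW_fD f r : divW (fD f r) = (-1) ^+ tau r *: DA r f.
Proof.
rewrite /divW (bigD1 r) //= big1 ?addr0 ?ffunE ?eqxx // => q /negPf qr.
by rewrite ffunE qr DA0 scaler0.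
Qed.

Lemma divW_SS x : inSS x -> divW x = 0.
Proof.
move: x; apply: inSS_ind => [|x y hx hy|k x hx|r s a u _].
- exact: (lin0 divW_lin).
- by rewrite (linD _ _ divW_lin) hx hy addr0.
- by rewrite (linZ _ _ divW_lin) hx scaler0.
rewrite (linD _ _ divW_lin) (linN _ divW_lin) !(linZ _ _ divW_lin) !divW_fD DAC.
rewrite !scalerA -scalerBl.
by case: (tau r); case: (tau s); rewrite /= ?expr0 ?expr1 ?mulrNN ?mulr1 ?mul1r ?subrr ?scale0r.
Qed.

Lemma fD_sum (I : finType) (G : I -> A) r : fD (\sum_i G i) r = \sum_i fD (G i) r.
Proof.
elim/big_rec2: _ => [|i x y _ <-]; first exact: (lin0 (@fD_lin r)).
exact: (linD _ _ (@fD_lin r)).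
Qed.

(* [D_rs f] is the divergence of a bivector; the terms [D_q (E q)] add up to [divW E]. *)
Lemma br_DF E r s f : evenW E -> divW E = 0 -> Alg_par (tau r (+) tau s) f ->
  brW E (divfield r s f) = divfield r s (appW E f)
   - \sum_q (-1) ^+ ((tau r && tau s) (+) (tau q && tau s) (+) (tau q && tau r) (+) tau q) *:
       divfield q s (DA r (E q) ** f)
   + (-1) ^+ (tau r (+) tau s (+) (tau r && tau s)) *:
     \sum_q (-1) ^+ ((tau r && tau s) (+) (tau q && tau s) (+) (tau q && tau r) (+) tau q) *:
       divfield q r (DA s (E q) ** f).
Proof.
move=> hE dE hf.
have dq r' : \sum_q (-1) ^+ tau q *: (DA r' (DA q (E q)) ** f) = 0.
  transitivity (DA r' (divW E) ** f); last by rewrite dE DA0 mulA0l.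
  by rewrite /divW DA_sum mulA_suml; apply: eq_bigr => q _; rewrite DAZ mulAZl.
have dr := dq r; have ds := dq s.
(* What the coefficient [E q] contributes beyond the action of E on f: the corrections from
   commuting E with D_r and D_s, and the terms in which [divfield r s f] differentiates [E q]. *)
pose L q : W :=
    (-1) ^+ (tau r && tau s) *: (- fD (DA r (E q) ** DA q f) s - fD (DA r f ** DA s (E q)) q)
    - (-1) ^+ (tau r (+) tau s) *: (- fD (DA s (E q) ** DA q f) r - fD (DA s f ** DA r (E q)) q).
have LE q : L q = L q := erefl.
move: LE; rewrite {2}/L => LE; clearbody L.
have -> : brW E (divfield r s f) = divfield r s (appW E f) + \sum_q L q.
  rewrite (eq_bigr _ (fun q _ => LE q)).
  rewrite sumrB -!scaler_sumr 2!sumrB 2!sumrN -2!fD_sum.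
  rewrite /divfield (linD _ _ (@brW_linr E)) (linN _ (@brW_linr E)) !(linZ _ _ (@brW_linr E)).
  rewrite !brW_fDr !appW_DA // !(linD _ _ (@fD_lin _)) !(linN _ (@fD_lin _)).
  set w1 := fD (DA r _) s; set w2 := fD (DA s _) r.
  set w3 := fD _ s; set w4 := fD _ r; set w5 := \sum_q _; set w6 := \sum_q _.
  move: w1 w2 w3 w4 w5 w6 => w1 w2 w3 w4 w5 w6.
  by apply/ffunP=> x; apply/ffunP=> nu; rewrite !ffunE; ring.
rewrite -[RHS]addrA; congr (_ + _); rewrite scaler_sumr -sumrN -big_split /=.
(* These terms add up to 0 because div E = 0. Subtracting them makes the identity hold for each q
   separately. *)
pose Z q : W :=
    (-1) ^+ (tau r && tau s) *: fD ((-1) ^+ tau q *: (DA r (DA q (E q)) ** f)) s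
    - (-1) ^+ (tau r (+) tau s) *: fD ((-1) ^+ tau q *: (DA s (DA q (E q)) ** f)) r.
have ZE q : Z q = Z q := erefl.
move: ZE; rewrite {2}/Z => ZE; clearbody Z.
have Z0 : \sum_q Z q = 0.
  rewrite (eq_bigr _ (fun q _ => ZE q)).
  by rewrite sumrB -!scaler_sumr -!fD_sum !dq !(lin0 (@fD_lin _)) !scaler0 subr0.
transitivity (\sum_q (L q - Z q)); first by rewrite sumrB Z0 subr0.
apply: eq_bigr => q _.
have hr := par_DA (r := r) (hE q); have hs := par_DA (r := s) (hE q).
have hfr := par_DA (r := r) hf; have hfs := par_DA (r := s) hf.
rewrite LE ZE /divfield !(leibniz hp _ _ hr) !(leibniz hp _ _ hs).
rewrite (mulAC hfr hs) (mulAC hfs hr).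
rewrite (DAC q r) (DAC q s) (DAC s r).
rewrite !mulAZl !(linD _ _ (@fD_lin _)) !(linZ _ _ (@fD_lin _)).
move: (fD (DA r (DA q (E q)) ** f) s) (fD (DA s (DA q (E q)) ** f) r) => y1 y2.
move: (fD (DA r (DA s (E q)) ** f) q) (fD (DA r (E q) ** DA q f) s) => y3 y4.
move: (fD (DA s (E q) ** DA q f) r) (fD (DA r (E q) ** DA s f) q) => y5 y6.
move: (fD (DA s (E q) ** DA r f) q) => y7.
apply/ffunP=> x; apply/ffunP=> nu; rewrite !ffunE.
move: (y1 x nu) (y2 x nu) (y3 x nu) (y4 x nu) (y5 x nu) (y6 x nu) (y7 x nu).
move=> {}y1 {}y2 {}y3 {}y4 {}y5 {}y6 {}y7.
have sE (k : F) (y : F^o) : k *: y = k * (y : F) :> F by [].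
(* Only an identity of signs is left, one for each choice of the three parities. *)
rewrite !sE; case: (tau r); case: (tau s); case: (tau q) => /=; rewrite ?expr0 ?expr1.
all: ring.
Qed.

Lemma inSS_br (x y : W) : inSS x -> inSS y -> inSS (brW x y).
Proof.
move=> hx; have dx := divW_SS hx; have ex : evenW x by case: hx.
move: y; apply: inSS_ind => [|y1 y2 h1 h2|k y hy|r s a u ou].
- by rewrite brW0r; apply: inSS0.
- by rewrite brWDr; apply: inSSD.
- by rewrite brWZr; apply: inSSZ.
have hf : Alg_par (tau r (+) tau s) (mon a u) by rewrite -ou; apply: par_mon.
have SSsum (G : Y m n -> W) : (forall q, inSS (G q)) -> inSS (\sum_q G q).
  by move=> h; elim/big_ind: _ => //; [apply: inSS0|apply: inSSD].
have hq r' s' q : tau r' (+) tau s' = tau r (+) tau s ->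
    Alg_par (tau q (+) tau s') (DA r' (x q) ** mon a u).
  move=> e; rewrite -e in hf.
  apply: (par_eq (par_mul (par_DA (ex q)) hf)).
  by case: (tau r'); case: (tau s'); case: (tau q).
rewrite br_DF //; apply: inSSD; first apply: inSSB.
- by apply: inSS_DF; apply: par_appW.
- by apply: SSsum => q; apply: inSSZ; apply: inSS_DF; apply: hq.
- apply: inSSZ; apply: SSsum => q; apply: inSSZ; apply: inSS_DF; apply: hq.
  by rewrite addbC.
Qed.

End Fields.

(** * Derivations, coefficients and weights *)

Section Coeffs.
Variables (F : fieldType) (p m n : nat) (t : 'I_m -> nat).
Hypothesis hp : p \in [pchar F].
Local Notation A := (Alg F p n t).
Local Notation W := (Wt F p n t).
Local Notation pi_ := (piexp p t).
Local Notation mon := (@monomial F p m n t).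
Local Notation "f ** g" := (Defs.mulA f g) (at level 40, left associativity).
Implicit Types (a b : {ffun 'I_m -> nat}) (u v w : {set 'I_n}) (f g h : A).
Implicit Types (r s q : Y m n) (c d e : bool) (E x y : W).
Implicit Types (D : W -> W).

Lemma isDer_ext D D' : (forall x, inSS x -> D x = D' x) -> isDer D' -> isDer D.
Proof.
move=> e [h1 h2 h3]; split=> [k x y hx hy|x hx|x y hx hy].
- by rewrite !e // ?h1 //; apply: inSSD => //; apply: inSSZ.
- by rewrite e //; apply: h2.
- by rewrite !e // ?h3 //; apply: inSS_br.
Qed.

Lemma isDer_add D D' : isDer D -> isDer D' -> isDer (fun x => D x + D' x).
Proof.
move=> [h1 h2 h3] [g1 g2 g3]; split=> [k x y hx hy|x hx|x y hx hy].
- by rewrite h1 // g1 // scalerDr addrACA.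
- by apply: evenWD; [apply: h2|apply: g2].
- by rewrite h3 // g3 // !brWDr opprD addrACA.
Qed.

Lemma isDer_scale k D : isDer D -> isDer (fun x => k *: D x).
Proof.
move=> [h1 h2 h3]; split=> [l x y hx hy|x hx|x y hx hy].
- by rewrite h1 // scalerDr !scalerA mulrC.
- by apply: evenWZ; apply: h2.
- by rewrite h3 // !brWZr scalerBr.
Qed.

Lemma isDer_sub D D' : isDer D -> isDer D' -> isDer (fun x => D x - D' x).
Proof.
move=> h h'; apply: (isDer_ext (D' := fun x => D x + (-1) *: D' x)).
  by move=> x _; rewrite scaleN1r.
exact: (isDer_add h (isDer_scale (-1) h')).
Qed.

Lemma isDer0 : isDer (fun _ : W => 0).
Proof.
split=> [k x y hx hy|x hx|x y hx hy]; rewrite ?scaler0 ?addr0 ?brW0r ?subr0 //.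
exact: evenW0.
Qed.

Lemma isDer_sum (I : Type) (s : seq I) (G : I -> W -> W) :
  (forall i, isDer (G i)) -> isDer (fun x => \sum_(i <- s) G i x).
Proof.
move=> h; elim: s => [|i s IH].
  by apply: (isDer_ext _ isDer0) => x _; rewrite big_nil.
by apply: (isDer_ext _ (isDer_add (h i) IH)) => x _; rewrite big_cons.
Qed.

Lemma isDer_ad E : evenW E -> isDer (brW E).
Proof.
move=> hE; split=> [k x y _ _|x [_ hx]|x y [_ hx] [_ hy]].
- exact: brW_linr.
- exact: evenW_br.
- by rewrite (jacobi hp) // addrC [brW y _]brWC opprK.
Qed.

(** Pascal's rule, as for ordinary derivations. [P] confines the Leibniz hypothesis to a subset
    stable under L; it will be evenness, where the Jacobi identity is at hand. *)
Lemma leibniz_iter (V : lmodType F) (L : V -> V) (B : V -> V -> V)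
    (P : V -> Prop) N (x y : V) :
  lin L -> (forall z, P z -> P (L z)) ->
  (forall z1 z2, P z1 -> P z2 -> L (B z1 z2) = B (L z1) z2 + B z1 (L z2)) ->
  P x -> P y ->
  iter N L (B x y) =
  \sum_(k < N.+1) 'C(N, k)%:R *: B (iter k L x) (iter (N - k) L y).
Proof.
move=> lL eL dL ex ey; have ei k z : P z -> P (iter k L z).
  by move=> ez; elim: k => //= k; apply: eL.
elim: N => [|N IH]; first by rewrite big_ord1 bin0 scale1r.
rewrite iterS IH lin_sum // [RHS]big_ord_recl /= bin0 scale1r.
pose f k l := B (iter k L x) (iter l L y).
rewrite (eq_bigr (fun k : 'I_N.+1 => 'C(N, k)%:R *: f k.+1 (N - k)%N +
   'C(N, k)%:R *: f k (N.+1 - k)%N)); last first.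
  by move=> k _; rewrite (dL _ _ (ei _ _ ex) (ei _ _ ey)) scalerDr /f subSn // -ltnS.
rewrite big_split /= addrC.
rewrite [in RHS](eq_bigr (fun k : 'I_N.+1 => 'C(N, k.+1)%:R *: f k.+1 (N - k)%N +
   'C(N, k)%:R *: f k.+1 (N - k)%N)); last first.
  by move=> k _; rewrite binS natrD scalerDl.
rewrite big_split /= addrA; congr (_ + _).
rewrite big_ord_recl /= bin0 scale1r; congr (_ + _).
rewrite [RHS]big_ord_recr /= bin_small // scale0r addr0.
by apply: eq_bigr => k _; rewrite /bump /= add1n subSS.
Qed.

(* In characteristic [p] only the extreme terms of the Leibniz rule survive. *)
Lemma isDer_iter i (r : nat) : isDer (iter (p ^ r) (brW (Dr F p t (inl i) : W))).
Proof.
set L := brW _; have eD : evenW (Dr F p t (inl i) : W) by apply: evenW_Dr.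
have eL z : evenW z -> evenW (L z) by apply: evenW_br.
have ei k z : evenW z -> evenW (iter k L z).
  by move=> ez; elim: k => //= k; apply: eL.
have lL : lin L by apply: brW_linr.
split=> [k x y _ _|x [_ hx]|x y [_ hx] [_ hy]].
- by elim: (p ^ r)%N => //= N ->; apply: lL.
- exact: ei.
have dL z1 z2 : evenW z1 -> evenW z2 -> L (brW z1 z2) = brW (L z1) z2 + brW z1 (L z2).
  by move=> h1 h2; apply: (jacobi hp).
have := prime_gt1 (p_prime hp) => p1.
rewrite (leibniz_iter _ lL eL dL) //; have : (0 < p ^ r)%N by rewrite expn_gt0 ltnW.
have bz := @bin_ppow_eq0 F p hp r.
move: (p ^ r)%N bz => N bz; case: N bz => // N bz _.
rewrite big_ord_recl big_ord_recr /= bin0 ?subn0 /bump /= ?add0n ?add1n binn subnn !scale1r.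
rewrite big1 ?add0r => [|k _].
  by rewrite [brW y _]brWC opprK.
by rewrite bz ?scale0r // /bump /= add1n !ltnS ltn_ord.
Qed.

(* [cf] and [hh] are sealed so that failing conversion tests stay cheap. *)
Fact cf_subproof : {c : A -> {ffun 'I_m -> nat} -> {set 'I_n} -> F |
  forall f a u, c f a u = \sum_(al : expo p t) (e2n al == a)%:R * f (al, u)}.
Proof. by eexists. Qed.
Definition cf := sval cf_subproof.
Lemma cfE f a u : cf f a u = \sum_(al : expo p t) (e2n al == a)%:R * f (al, u).
Proof. exact: (svalP cf_subproof). Qed.

Lemma cf_lin a u : lin (fun f => cf f a u : F^o).
Proof.
move=> k f g; rewrite !cfE scaler_sumr -big_split /=; apply: eq_bigr => al _.
rewrite !ffunE mulrDr; congr (_ + _).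
by rewrite [RHS](_ : _ = k * ((e2n al == a)%:R * f (al, u))) // mulrCA.
Qed.

Lemma cf_e2n f al u : cf f (e2n al) u = f (al, u).
Proof.
rewrite cfE (bigD1 al) //= eqxx mul1r big1 ?addr0 // => be /negPf ne.
by rewrite (inj_eq (@e2n_inj _ _ _)) ne mul0r.
Qed.

Lemma cf_out f a u i : (pi_ i < a i)%N -> cf f a u = 0.
Proof.
move=> h; rewrite cfE big1 // => al _; case: eqP => [e|_]; last by rewrite mul0r.
by move: h; rewrite -e ltnNge e2n_le.
Qed.

Lemma cf_ext f g : (forall a u, cf f a u = cf g a u) -> f = g.
Proof. by move=> h; apply/ffunP=> -[al u]; rewrite -!cf_e2n h. Qed.

Lemma cfD f g a u : cf (f + g) a u = cf f a u + cf g a u.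
Proof. exact: (linD _ _ (@cf_lin a u)). Qed.
Lemma cfN f a u : cf (- f) a u = - cf f a u.
Proof. exact: (linN _ (@cf_lin a u)). Qed.
Lemma cfZ k f a u : cf (k *: f) a u = k * cf f a u.
Proof. exact: (linZ _ _ (@cf_lin a u)). Qed.
Lemma cf0 a u : cf 0 a u = 0.
Proof. exact: (lin0 (@cf_lin a u)). Qed.
Lemma cf_par c f a u : Alg_par c f -> cf f a u != 0 -> odd #|u| = c.
Proof.
move=> hf; case: (monP F p n t a) => [al ->|i hi _].
  by rewrite cf_e2n => /hf.
by rewrite (cf_out _ _ hi) eqxx.
Qed.

Lemma cf_mon b v a u :
  cf (mon b v) a u = ((a == b) && (u == v) && [forall i, a i <= pi_ i]%N)%:R.
Proof.
case: (monP F p n t a) => [al ->|i hi _].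
  rewrite cf_e2n ffunE /=; have -> : [forall i, e2n al i <= pi_ i]%N.
    by apply/forallP=> i; apply: e2n_le.
  by rewrite andbT.
rewrite (cf_out _ _ hi); have -> : [forall i, a i <= pi_ i]%N = false.
  by apply/negbTE/negP => /forallP /(_ i); rewrite leqNgt hi.
by rewrite andbF.
Qed.

(** A derivative by x_i never reaches degree pi_i in x_i. This is the obstruction that integration
    has to overcome; divided powers cause no denominators. *)
Lemma cf_DA_even i f a u :
  cf (DA (inl i) f) a u = if (a i < pi_ i)%N then cf f (eadd a (eps i 1)) u else 0.
Proof.
clear hp.
move: f; apply: (@lin_ext F p m n t F^o (fun f => cf (DA (inl i) f) a u)
  (fun f => if (a i < pi_ i)%N then cf f (eadd a (eps i 1)) u else 0)).
- exact: (lin_comp (@cf_lin a u) (@DA_lin _ _ _ _ _ _)).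
- case: (a i < pi_ i)%N; first exact: cf_lin.
  by move=> k f g; rewrite scaler0 addr0.
move=> b v; rewrite DA_even; case: (ltnP (a i) (pi_ i)) => ai.
  rewrite cf_mon; case: ifP => [/andP [b0 bp]|bi].
    rewrite cf_mon; congr (_%:R); congr nat_of_bool; congr (_ && _ && _).
      apply/eqP/eqP => [->|<-]; apply/ffunP=> j; rewrite !ffunE; case: eqP => [->|_]; rewrite ?subnK ?addnK ?subn0 ?addn0 //.
    apply/forallP/forallP => h j; have := h j; rewrite !ffunE;
      by case: eqP => [->|_]; rewrite ?addn0 ?addn1 // => /ltnW.
  rewrite cf0 [X in X && _ && _](_ : _ = false) //; apply/negbTE; apply: contraFN bi.
  by move=> /eqP <-; rewrite !ffunE eqxx addn1.
case: ifP => [/andP [b0 bp]|bi]; last by rewrite cf0.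
rewrite cf_mon [X in X && _ && _](_ : _ = false) //; apply/negbTE/negP => /eqP e.
by move: ai; rewrite e !ffunE eqxx; lia.
Qed.

Lemma cf_mulx i (c : nat) f a u : (a i < c)%N -> cf (mon (eps i c) set0 ** f) a u = 0.
Proof.
clear hp.
move=> ac; move: f; apply: (@lin_ext F p m n t F^o (fun f => cf _ a u) (fun f => 0)).
- exact: (lin_comp (@cf_lin a u) (@mulA_linr _ _ _ _ _ _)).
- by move=> k f g; rewrite scaler0 addr0.
move=> b v; rewrite mul_mon; case: ifP => _; last by rewrite cf0.
rewrite cfZ cf_mon [X in X && _ && _](_ : _ = false) ?mulr0 //.
apply/negbTE/negP => /eqP e; move: ac; rewrite e !ffunE eqxx; lia.
Qed.

Lemma cf_mulxi f v w a : [disjoint w & v] ->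
  cf (f ** mon ezero v) a (w :|: v) = sg F w v * cf f a w.
Proof.
move=> d; move: f; apply: (@lin_ext F p m n t F^o (fun f => cf (f ** _) a _)
  (fun f => sg F w v * cf f a w)).
- exact: (lin_comp (@cf_lin a _) (@mulA_linl _ _ _ _ _ _)).
- exact: (lin_scale (sg F w v) (@cf_lin a _)).
move=> b z; rewrite mul_mon; case: (boolP [disjoint z & v]) => dz.
  rewrite bino0r mul1r adde0 cfZ !cf_mon.
  have -> : (w :|: v == z :|: v) = (w == z).
    apply/eqP/eqP => [e|-> //].
    have H (s : {set 'I_n}) : [disjoint s & v] -> (s :|: v) :\: v = s.
      by move=> ds; rewrite setDUl setDv setU0; apply/setDidPl.
    by rewrite -(H w d) -(H z dz) e.
  by have [->|_] := eqVneq w z; rewrite ?andbF // !mulr0.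
rewrite cf0 cf_mon; case: eqP => [ew|_]; rewrite ?andbF ?mulr0 //.
case: eqP => [ez|_]; rewrite /= ?mulr0 //.
by rewrite -ez d in dz.
Qed.

Hypothesis ht : forall i, (0 < t i)%N.

Lemma pi_gt0 i : (0 < pi_ i)%N.
Proof.
by rewrite -ltnS (@piexpS F p m t hp) -{1}(expn0 p) ltn_exp2l ?prime_gt1 ?(p_prime hp) // ht.
Qed.

(** * Torus elements and weights *)

Definition xx i : A := mon (eps i 1) set0.
Definition xi k : A := mon ezero [set k].

Fact hh_subproof : {h : 'I_m -> 'I_n -> W |
  forall i k, h i k = fD (xx i) (inl i) + fD (xi k) (inr k)}.
Proof. by exists (fun i k => fD (xx i) (inl i) + fD (xi k) (inr k)). Qed.
Definition hh := sval hh_subproof.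
Lemma hhE i k : hh i k = fD (xx i) (inl i) + fD (xi k) (inr k).
Proof. exact: (svalP hh_subproof). Qed.

Lemma DA_xx r i : DA r (xx i) = (r == inl i)%:R *: oneA F p n t.
Proof.
rewrite oneAE /xx; case: r => [j|k]; rewrite ?DA_even ?DA_odd ?inE ?scale0r //.
rewrite ffunE; have [->|ne] := eqVneq j i.
  rewrite !eqxx /= pi_gt0 scale1r; congr (monomial _ _ _ _).
  by apply/ffunP=> x; rewrite !ffunE subnn.
by rewrite (_ : inl j == inl i = false) ?scale0r //; apply/eqP => -[] /eqP; apply/negP.
Qed.

Lemma DA_xi r k : DA r (xi k) = (r == inr k)%:R *: oneA F p n t.
Proof.
rewrite oneAE /xi; case: r => [j|l]; rewrite ?DA_even ?DA_odd ?ffunE ?inE ?scale0r //.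
have [->|ne] := eqVneq l k.
  by rewrite !eqxx setDv sg0r.
by rewrite (_ : inr l == inr k = false) ?scale0r //; apply/eqP => -[] /eqP; apply/negP.
Qed.

Lemma appW_xx E i : appW E (xx i) = E (inl i).
Proof.
rewrite /appW (bigD1 (inl i)) //= big1 ?addr0 => [|r /negPf ri].
  by rewrite DA_xx eqxx scale1r mulA1.
by rewrite DA_xx ri scale0r mulA0r.
Qed.

Lemma appW_xi E k : appW E (xi k) = E (inr k).
Proof.
rewrite /appW (bigD1 (inr k)) //= big1 ?addr0 => [|r /negPf ri].
  by rewrite DA_xi eqxx scale1r mulA1.
by rewrite DA_xi ri scale0r mulA0r.
Qed.

Lemma appW_hh_mon i k a u :
  appW (hh i k) (mon a u) = (a i + (k \in u))%:R *: mon a u.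
Proof.
clear hp ht.
rewrite hhE (linD _ _ (@appW_linl _ _ _ _ _ _)) !appW_fD DA_even DA_odd natrD scalerDl.
congr (_ + _); rewrite /xx /xi.
  case: (ltnP 0%N (a i)) => a0 /=; last first.
    by rewrite mulA0r (_ : a i = 0%N) ?scale0r //; lia.
  case: leqP => ap; last by rewrite mulA0r (mon_out _ _ ap) scaler0.
  rewrite mul_mon disjoints_subset sub0set set0U sg0l mulr1.
  have -> : eadd (eps i 1) (esub a (eps i 1)) = a.
    by apply/ffunP=> j; rewrite !ffunE; case: eqP => [->|_]; rewrite ?subnKC ?add0n ?subn0.
  congr (_ *: _); rewrite /bino (bigD1 i) //= big1 ?muln1 => [|j /negPf ji].
    by rewrite !ffunE eqxx add1n subn1 prednK // bin1.
  by rewrite !ffunE ji bin0.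
case: (boolP (k \in u)) => ku; last by rewrite mulA0r scale0r.
rewrite mulAZr mul_mon disjoints1 !inE eqxx /= bino0l mul1r add0e setD1K //.
by rewrite scalerA sg_sqr.
Qed.

Lemma cf_appW_hh i k f a u :
  cf (appW (hh i k) f) a u = (a i + (k \in u))%:R * cf f a u.
Proof.
move: f; apply: (@lin_ext F p m n t F^o (fun f => cf (appW _ f) a u) (fun f => _ * cf f a u)).
- exact: (lin_comp (@cf_lin a u) (@appW_linr _ _ _ _ _ _)).
- exact: (lin_scale _ (@cf_lin a u)).
move=> b v; rewrite appW_hh_mon cfZ cf_mon.
by case: eqP => [->|_]; case: eqP => [->|_] //=; rewrite !mulr0.
Qed.

(** The eigenvalue of ad h_ik on x^(a) xi^u D_r. As an element of F it depends on exponents only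
    modulo p. *)
Definition wt i k a u r : F :=
  (a i + (k \in u))%:R - (r == inl i)%:R - (r == inr k)%:R.

Lemma appW_hh_coord i k E r :
  appW E (hh i k r) = ((r == inl i)%:R + (r == inr k)%:R) *: E r.
Proof.
rewrite hhE !ffunE; have [->|_] := eqVneq r (inl i).
  by rewrite addr0 appW_xx addr0 scale1r.
have [->|_] := eqVneq r (inr k); first by rewrite add0r appW_xi add0r scale1r.
by rewrite addr0 (lin0 (appW_linr _)) addr0 scale0r.
Qed.

Lemma cf_br_hh i k E r a u :
  cf (brW (hh i k) E r) a u = wt i k a u r * cf (E r) a u.
Proof.
rewrite ffunE cfD cfN cf_appW_hh appW_hh_coord cfZ /wt -mulrBl.
by rewrite opprD addrA.
Qed.

Lemma br_hh_mon i k a u r :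
  brW (hh i k) (fD (mon a u) r) = wt i k a u r *: fD (mon a u) r.
Proof.
apply/ffunP=> s; apply: cf_ext => b v; rewrite cf_br_hh !ffunE; case: eqP => [->|_].
  rewrite cfZ cf_mon; case: eqP => [->|_]; case: eqP => [->|_] //=; by rewrite !mulr0.
by rewrite scaler0 cf0 mulr0.
Qed.

End Coeffs.

(** * Killing the partial derivatives *)

Section Integration.
Variables (F : fieldType) (p m n : nat) (t : 'I_m -> nat).
Hypotheses (hp : p \in [pchar F]) (hp3 : (3 < p)%N).
Hypotheses (hm : (3 <= m)%N) (hn : (3 <= n)%N) (ht : forall i, (0 < t i)%N).
Local Notation A := (Alg F p n t).
Local Notation W := (Wt F p n t).
Local Notation pi_ := (piexp p t).
Local Notation mon := (@monomial F p m n t).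
Local Notation hh := (@hh F p m n t).
Local Notation xx := (@xx F p m n t).
Local Notation xi := (@xi F p m n t).
Local Notation Dr i := (Dr F p t (inl i) : W).
Local Notation "f ** g" := (Defs.mulA f g) (at level 40, left associativity).
Implicit Types (a b : {ffun 'I_m -> nat}) (u v w : {set 'I_n}) (f g h : A).
Implicit Types (r s q : Y m n) (c d e : bool) (E x y : W).
Implicit Types (D : W -> W).

(** Through this spare index the assumptions m >= 3 and n >= 3 enter most arguments. *)
Lemma third N (i j : 'I_N) : (3 <= N)%N -> exists q : 'I_N, (q != i) && (q != j).
Proof.
move=> hN; case: (pickP (fun q : 'I_N => (q != i) && (q != j))) => [q h|h].
  by exists q.
have : (#|'I_N| <= #|[set i; j]|)%N.
  apply/subset_leq_card/subsetP => q _; rewrite !inE.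
  by have /negbT := h q; rewrite negb_and !negbK.
by rewrite card_ord cards2; case: eqP => _ /= h2; have := leq_trans hN h2.
Qed.

Lemma eqYll (i j : 'I_m) : (inl i == inl j :> Y m n) = (i == j). Proof. by []. Qed.
Lemma eqYrr (k l : 'I_n) : (inr k == inr l :> Y m n) = (k == l). Proof. by []. Qed.

Lemma natF_neq0 (k : nat) : (0 < k < p)%N -> (k%:R : F) != 0.
Proof.
move=> /andP [k0 kp]; rewrite -(dvdn_pcharf hp); apply/negP => /(dvdn_leq k0).
by rewrite leqNgt kp.
Qed.

Lemma two_neq0 : (2 : F) != 0. Proof. by apply: natF_neq0; rewrite /= (ltn_trans _ hp3). Qed.

Lemma pi_char i : ((pi_ i)%:R : F) = -1.
Proof.
apply/eqP; rewrite -subr_eq0 opprK -(natrD _ _ 1) addn1 (@piexpS F p m t hp i).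
by rewrite -(dvdn_pcharf hp) dvdn_exp.
Qed.

(** * Monomial elements of the special algebra *)

Lemma memA i j a u : i != j -> a j = 0%N -> (a i < pi_ i)%N -> ~~ odd #|u| ->
  inSS (fD (mon a u) (inl j) : W).
Proof.
move=> ij aj ai ou.
have : inSS (divfield (inl i) (inl j) (mon (eadd a (eps i 1)) u)).
  by apply: inSS_DF; rewrite /= -(negPf ou); apply: par_mon.
rewrite /divfield /= expr0 !scale1r !DA_even !ffunE eqxx [j == i]eq_sym (negPf ij) aj /=.
rewrite (lin0 (@fD_lin _ _ _ _ _ _)) subr0 addn1 /= ai.
suff -> : esub (eadd a (eps i 1)) (eps i 1) = a by [].
by apply/ffunP=> x; rewrite !ffunE addnK.
Qed.

(** Where [memA] raises x_i, here the missing generator xi_k is inserted: up to sign the field is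
    D_kj(x^(a) xi_k xi^u). All exponents other than that of x_j may be at the top. *)
Lemma memB j k a u : a j = 0%N -> k \notin u -> ~~ odd #|u| ->
  inSS (fD (mon a u) (inl j) : W).
Proof.
move=> aj ku ou.
have : inSS (divfield (inr k) (inl j) (mon a (k |: u))).
  apply: inSS_DF; apply: (par_eq (@par_mon _ _ _ _ _ _ _)).
  by rewrite cardsU1 ku /= ou.
rewrite /divfield /= expr0 expr1 scale1r DA_even DA_odd aj !inE eqxx /=.
rewrite (lin0 (@fD_lin _ _ _ _ _ _)) scaler0 subr0 setU1K //.
rewrite (linZ _ _ (@fD_lin _ _ _ _ _ _)) => /(inSSZ (sg F [set k] u)).
by rewrite scalerA sg_sqr scale1r.
Qed.

(** For an odd index the two terms of D_kk(f) add up instead of cancelling, giving -2 times the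
    field, up to sign. *)
Lemma memC k a v : k \notin v -> odd #|v| -> inSS (fD (mon a v) (inr k) : W).
Proof.
move=> kv ov.
have : inSS (divfield (inr k) (inr k) (mon a (k |: v))).
  apply: inSS_DF; apply: (par_eq (@par_mon _ _ _ _ _ _ _)).
  by rewrite cardsU1 kv /= ov.
rewrite /divfield /= expr0 expr1 DA_odd !inE eqxx /= setU1K //.
rewrite (linZ _ _ (@fD_lin _ _ _ _ _ _)) -scalerBl scalerA.
move=> /(inSSZ ((-1 - 1) * sg F [set k] v)^-1); rewrite scalerA mulVf ?scale1r //.
by rewrite mulf_neq0 ?sg_neq0 // -opprD oppr_eq0; apply: two_neq0.
Qed.

Lemma memH i k a : (a i < pi_ i)%N ->
  inSS (fD (mon (eadd a (eps i 1)) set0) (inl i) + fD (mon a [set k]) (inr k) : W).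
Proof.
move=> ai.
have : inSS (divfield (inl i) (inr k) (mon (eadd a (eps i 1)) [set k])).
  apply: inSS_DF; apply: (par_eq (@par_mon _ _ _ _ _ _ _)).
  by rewrite cards1.
rewrite /divfield /= expr0 expr1 scale1r DA_even DA_odd !ffunE !eqxx inE eqxx addn1 ai /=.
rewrite setDv sg0r scale1r scaleN1r opprK addrC.
suff -> : esub (eadd a (eps i 1)) (eps i 1) = a by [].
by apply/ffunP=> x; rewrite !ffunE addnK.
Qed.

Lemma hh_SS i k : inSS (hh i k).
Proof.
have := @memH i k ezero; rewrite ffunE => /(_ (pi_gt0 hp ht i)).
by rewrite add0e hhE.
Qed.

Lemma Dr_SS i : inSS (Dr i).
Proof.
have [j /andP [ji _]] := third i i hm.
rewrite /Defs.Dr oneAE; by apply: (@memA j i); rewrite ?ffunE ?cards0 //; apply: (pi_gt0 hp ht).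
Qed.

Lemma n_pos : 'I_n. Proof. by apply: (@Ordinal _ 0); apply: leq_trans hn. Qed.

Lemma xD_SS i j : i != j -> inSS (fD (xx i) (inl j) : W).
Proof.
move=> ij; apply: (@memB j n_pos); rewrite ?inE ?cards0 //.
by rewrite ffunE eq_sym (negPf ij).
Qed.

Lemma xixiD_SS k l j : k != l -> inSS (fD (mon ezero [set k; l]) (inl j) : W).
Proof.
move=> kl; have [i /andP [ij _]] := third j j hm.
by apply: (@memA i j); rewrite ?ffunE ?cards2 ?kl //; apply: (pi_gt0 hp ht).
Qed.

Lemma xid_SS k l : k != l -> inSS (fD (xi k) (inr l) : W).
Proof. by move=> kl; apply: memC; rewrite ?cards1 // inE eq_sym. Qed.

Lemma cf_mulxil f v w a : [disjoint v & w] ->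
  cf (mon ezero v ** f) a (v :|: w) = sg F v w * cf f a w.
Proof.
move=> d; move: f; apply: (@lin_ext F p m n t F^o (fun f => cf (_ ** f) a _)
  (fun f => sg F v w * cf f a w)).
- exact: (lin_comp (@cf_lin _ _ _ _ _ a _) (@mulA_linr _ _ _ _ _ _)).
- exact: (lin_scale (sg F v w) (@cf_lin _ _ _ _ _ a _)).
move=> b z; rewrite mul_mon; case: (boolP [disjoint v & z]) => dz.
  rewrite bino0l mul1r add0e cfZ !cf_mon.
  have -> : (v :|: w == v :|: z) = (w == z).
    apply/eqP/eqP => [e|-> //].
    have H (s : {set 'I_n}) : [disjoint v & s] -> (v :|: s) :\: v = s.
      by move=> ds; rewrite setDUl setDv set0U; apply/setDidPl; rewrite disjoint_sym.
    by rewrite -(H w d) -(H z dz) e.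
  by have [->|_] := eqVneq w z; rewrite ?andbF // !mulr0.
rewrite cf0 cf_mon; case: eqP => [ew|_]; rewrite ?andbF ?mulr0 //.
case: eqP => [ez|_]; rewrite /= ?mulr0 //.
by rewrite -ez d in dz.
Qed.

Lemma mon_xixi k l : k != l -> mon ezero [set k; l] = sg F [set k] [set l] *: (xi k ** xi l).
Proof.
move=> kl; rewrite mul_mon disjoints1 inE kl bino0l mul1r add0e.
by rewrite scalerA sg_sqr scale1r.
Qed.

Lemma par_xi k : Alg_par true (xi k).
Proof. by apply: (par_eq (@par_mon _ _ _ _ _ _ _)); rewrite cards1. Qed.

(** The diagonal coefficients of E at xi_k d_k and xi_l d_l occur only through their sum; [pairs0]
    then separates them. *)
Lemma cf_app2 E k l a : evenW E -> k != l ->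
  cf (appW E (mon ezero [set k; l])) a [set k; l] =
  cf (E (inr k)) a [set k] + cf (E (inr l)) a [set l].
Proof.
move=> hE kl; rewrite mon_xixi // (linZ _ _ (@appW_linr _ _ _ _ _ _)) cfZ.
rewrite (appW_leib hp _ hE (@par_xi k)) !appW_xi.
rewrite (mulAC (@par_xi k) (hE (inr l))) /= expr1 scaleN1r cfD cfN.
have dkl : [disjoint [set k] & [set l]] by rewrite disjoints1 inE.
have dlk : [disjoint [set l] & [set k]] by rewrite disjoint_sym.
rewrite [X in _ - X](_ : _ = cf (E (inr l) ** xi k) a ([set l] :|: [set k])); last by rewrite setUC.
rewrite !cf_mulxi // (sgC F dlk) !cards1 /= expr1 mulN1r mulNr opprK -mulrDr.
by rewrite mulrA sg_sqr mul1r.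
Qed.

(** 2 z_k = (z_k + z_l) + (z_k + z_q) - (z_l + z_q) for three distinct indices, and 2 is
    invertible. *)
Lemma pairs0 (z : 'I_n -> F) : (forall k l, k != l -> z k + z l = 0) -> forall k, z k = 0.
Proof.
move=> h k; have [l /andP [lk _]] := third k k hn.
have [q /andP [qk ql]] := third k l hn.
have h1 := h k l; have h2 := h k q; have h3 := h l q.
rewrite eq_sym in lk; rewrite eq_sym in qk; rewrite eq_sym in ql.
have : 2 * z k = 0.
  have -> : 2 * z k = (z k + z l) + (z k + z q) - (z l + z q) by ring.
  by rewrite h1 // h2 // h3 // subr0 addr0.
by move/eqP; rewrite mulf_eq0 (negPf two_neq0) => /eqP.
Qed.

Lemma isDer_0 D : isDer D -> D 0 = 0.
Proof.
move=> [h1 _ _]; have := h1 (-1) 0 0 (inSS0 _ _ _ _) (inSS0 _ _ _ _).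
by rewrite scaler0 addr0 scaleN1r addNr.
Qed.

Lemma isDer_Z D k y : isDer D -> inSS y -> D (k *: y) = k *: D y.
Proof.
move=> hD hy; have [h1 _ _] := hD; have := h1 k y 0 hy (inSS0 _ _ _ _).
by rewrite (isDer_0 hD) !addr0.
Qed.

Lemma isDer_D D y1 y2 : isDer D -> inSS y1 -> inSS y2 -> D (y1 + y2) = D y1 + D y2.
Proof.
by move=> [h1 _ _] s1 s2; have := h1 1 y1 y2 s1 s2; rewrite !scale1r.
Qed.

Lemma brDr_mon j a u r : brW (Dr j) (fD (mon a u) r) =
  if (0 < a j <= pi_ j)%N then fD (mon (esub a (eps j 1)) u) r else 0.
Proof.
rewrite brW_Dr; apply/ffunP=> s; rewrite ffunE; rewrite [fD _ _ s]ffunE.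
case: eqP => [->|/eqP/negPf sr].
  by rewrite DA_even; case: ifP => _; rewrite !ffunE ?eqxx.
by rewrite DA0; case: ifP => _; rewrite !ffunE ?sr.
Qed.

Lemma brDr_mon0 j a u r : a j = 0%N -> brW (Dr j) (fD (mon a u) r) = 0.
Proof. by move=> aj; rewrite brDr_mon aj. Qed.

Lemma brDr_hh j i k : brW (Dr j) (hh i k) = (i == j)%:R *: Dr j.
Proof.
rewrite hhE brWDr !brDr_mon !ffunE addr0 [j == i]eq_sym; case: eqP => [->|_] /=.
  rewrite (pi_gt0 hp ht) // scale1r /Defs.Dr oneAE; congr (fD (monomial _ _ _ _ _) _).
  by apply/ffunP=> x; rewrite !ffunE subnn.
by rewrite scale0r.
Qed.

Lemma addWE E1 E2 r : (E1 + E2) r = E1 r + E2 r. Proof. exact: ffunE. Qed.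
Lemma oppWE E1 r : (- E1) r = - E1 r. Proof. exact: ffunE. Qed.
Lemma subWE E1 E2 r : (E1 - E2) r = E1 r - E2 r.
Proof. by rewrite addWE oppWE. Qed.
Lemma zeroWE r : (0 : W) r = 0. Proof. exact: ffunE. Qed.
Lemma scaleWE k E r : (k *: E) r = k *: E r. Proof. exact: ffunE. Qed.
Lemma brDrE j E r : brW (Dr j) E r = DA (inl j) (E r).
Proof. by rewrite brW_Dr ffunE. Qed.
Lemma brWE E1 E2 r : brW E1 E2 r = appW E1 (E2 r) - appW E2 (E1 r).
Proof. exact: ffunE. Qed.
Lemma fDeq f r : fD f r r = f. Proof. by rewrite ffunE eqxx. Qed.

Local Opaque brW appW Defs.mulA DA.

Lemma cf_brB_hh i j k E r a u : cf (brW (hh i k - hh j k) E r) a u =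
  (wt F i k a u r - wt F j k a u r) * cf (E r) a u.
Proof.
rewrite brWBl subWE cfD cfN mulrBl.
congr (_ - _); exact: (cf_br_hh hp ht).
Qed.

(** * Integrability of the values on the partial derivatives *)

Section Step1.
Variables (D : W -> W) (hD : isDer D).
Local Notation Z j := (D (Dr j)).

Lemma Z_even j : evenW (Z j).
Proof. by case: hD => _ h _; apply: h; apply: Dr_SS. Qed.

Lemma Dbr_Dr j y : inSS y -> D (brW (Dr j) y) = brW (Dr j) (D y) - brW y (Z j).
Proof. by case: hD => _ _ h hy; rewrite h //; apply: Dr_SS. Qed.

(* The values of [ad (D_j)] have no term of top degree in [x_j]. *)
Lemma top_rel j y r a u : inSS y -> (pi_ j <= a j)%N ->
  cf (brW y (Z j) r) a u = - cf (D (brW (Dr j) y) r) a u.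
Proof.
move=> hy aj; rewrite Dbr_Dr // subWE brDrE cfD cfN cf_DA_even ltnNge aj /=.
by rewrite add0r opprK.
Qed.

Lemma Z_closed (j q : 'I_m) r : DA (inl q) (Z j r) = DA (inl j) (Z q r).
Proof.
have := @Dbr_Dr j (Dr q) (Dr_SS q).
have -> : brW (Dr j) (Dr q) = 0 by rewrite {2}/Defs.Dr oneAE brDr_mon0 // ffunE.
rewrite isDer_0 // !brW_Dr => /ffunP /(_ r); rewrite !ffunE => /esym/eqP.
by rewrite subr_eq0 => /eqP.
Qed.

(** Such a term would survive in D_q(Z_j), which equals D_j(Z_q) and so has no top degree in x_j. *)
Lemma Z_top1 (j q : 'I_m) r a u : (pi_ j <= a j)%N -> q != j -> (0 < a q)%N -> cf (Z j r) a u = 0.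
Proof.
move=> aj qj aq; have [ap|] := leqP (a q) (pi_ q); last by move/cf_out ->.
have := congr1 (fun f => cf f (esub a (eps q 1)) u) (Z_closed j q r).
rewrite !cf_DA_even !ffunE eqxx eq_sym (negPf qj) subn0 (ltnNge (a j)) aj /=.
have -> : (a q - 1 < pi_ q)%N by rewrite subn1 prednK.
suff -> : eadd (esub a (eps q 1)) (eps q 1) = a by [].
by apply/ffunP=> x; rewrite !ffunE; case: eqP => [->|_]; rewrite ?subnK ?subn0 ?addn0.
Qed.

(** The remaining exponent, a pure top power of x_j, is invisible to closedness. For each component
    a test element y of S_0 is chosen with [D_j, y] equal to 0 or -D_j, so that [top_rel] becomes a
    linear equation for the coefficient. *)
Lemma Z_top j r u : cf (Z j r) (eps j (pi_ j)) u = 0.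
Proof.
have Pj : eps j (pi_ j) j = pi_ j by rewrite ffunE eqxx.
have Pn i : i != j -> eps j (pi_ j) i = 0%N by move=> /negPf ij; rewrite ffunE ij.
have top y r' u' : inSS y -> cf (brW y (Z j) r') (eps j (pi_ j)) u' = 
    - cf (D (brW (Dr j) y) r') (eps j (pi_ j)) u'.
  by move=> hy; apply: top_rel; rewrite ?Pj.
have [b /andP [bj _]] := third j j hm.
case: r => [i|s].
  have [->|ij] := eqVneq i j.
    (* The coefficient c has weight difference 1 - pi_j = 2 in F, and D([D_j, y]) = -Z_j returns c
       on the other side: 2c = c. *)
    have := top (hh b n_pos - hh j n_pos) (inl j) u.
    move/(_ (inSSB (hh_SS b _) (hh_SS j _))).
    rewrite (linD _ _ (@brW_linr _ _ _ _ _ _)) brWNr !brDr_hh eqxx (negPf bj) scale0r add0r scale1r.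
    rewrite -[- Dr j]scaleN1r isDer_Z //; last exact: Dr_SS.
    rewrite scaleN1r oppWE cfN opprK.
    move/(etrans (esym (cf_brB_hh _ _ _ _ _ _ _))).
    rewrite /wt Pj Pn // !eqYll eqxx [j == b]eq_sym (negPf bj) !natrD pi_char.
    move/eqP; rewrite -subr_eq0 -{2}[cf _ _ _]mul1r -mulrBl.
    rewrite (_ : _ - 1 = 1) ?mul1r; first by move/eqP.
    by rewrite /=; ring.
  (* The D_q-component of [x_i D_q, Z_j] is x_i D_q(f) - Z_j(x_i), with f the D_q-component of Z_j;
     its first term has no pure power of x_j. *)
  have [q /andP [qi qj]] := third i j hm.
  have := top (fD (xx i) (inl q)) (inl q) u (@xD_SS _ _ _).
  rewrite eq_sym => /(_ qi); rewrite brDr_mon0; last by rewrite ffunE eq_sym (negPf ij).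
  rewrite isDer_0 // zeroWE cf0 oppr0.
  rewrite brWE appW_fD fDeq appW_xx //; rewrite cfD cfN cf_mulx ?Pn //.
  by rewrite add0r => /eqP; rewrite oppr_eq0 => /eqP.
(* The weights of the h_bk, with b other than j, leave only xi_s d_s as odd part. *)
have wz k : ((k \in u)%:R - (s == k)%:R) * cf (Z j (inr s)) (eps j (pi_ j)) u = 0.
  have := top (hh b k) (inr s) u (hh_SS b k).
  rewrite brDr_hh (negPf bj) scale0r isDer_0 // zeroWE cf0 oppr0.
  by rewrite cf_br_hh // /wt Pn // subr0.
have [us|us] := eqVneq u [set s]; last first.
  apply/eqP; apply/negPn/negP => ne; case/negP: us; apply/eqP/setP => k; rewrite inE.
  have /eqP := wz k; rewrite mulf_eq0 (negPf ne) orbF [s == k]eq_sym.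
  by case: (k \in u); case: (k == s) => //; rewrite ?subr0 ?sub0r ?oppr_eq0 oner_eq0.
rewrite us {u us wz}; move: s; apply: pairs0 => k l kl.
(* Testing with xi_k xi_l D_b gives the sums required by [pairs0]; the term with D_b(Z_j) has
   positive degree in x_b before differentiation and vanishes by [Z_top1]. *)
have := top (fD (mon ezero [set k; l]) (inl b)) (inl b) [set k; l] (xixiD_SS b kl).
rewrite brDr_mon0; last by rewrite ffunE.
rewrite isDer_0 // zeroWE cf0 oppr0.
rewrite brWE appW_fD fDeq cfD cfN cf_app2 //; last exact: Z_even.
have := @cf_mulxil (DA (inl b) (Z j (inl b))) [set k; l] set0 (eps j (pi_ j)).
rewrite disjoint_sym disjoints_subset sub0set setU0 => /(_ isT) ->.
rewrite cf_DA_even Pn // (pi_gt0 hp ht) (@Z_top1 j b) ?mulr0 ?sub0r //.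
- by move/eqP; rewrite oppr_eq0 => /eqP.
- by rewrite !ffunE eqxx leq_addr.
- by rewrite !ffunE eqxx addn1.
Qed.

Lemma Z_top_all j r a u : (pi_ j <= a j)%N -> cf (Z j r) a u = 0.
Proof.
move=> aj; case: (boolP [exists q, (q != j) && (0 < a q)%N]) => [/existsP [q /andP [qj aq]]|].
  exact: Z_top1 aj qj aq.
move=> h; have [ap|] := leqP (a j) (pi_ j); last by move/cf_out ->.
suff -> : a = eps j (pi_ j) by apply: Z_top.
apply/ffunP=> i; rewrite ffunE; case: eqP => [->|/eqP ij].
  by apply/eqP; rewrite eqn_leq ap.
move: h; rewrite negb_exists => /forallP /(_ i); rewrite ij /= -leqNgt leqn0.
by move/eqP.
Qed.

(** A coefficient of E at a nonconstant exponent is read off from any Z_i whose variable occurs in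
    it; closedness makes the choice immaterial, and [Z_top_all] covers the exponents that cannot be
    raised. *)
Lemma step1 : exists E, evenW E /\ forall j, Z j = brW E (Dr j).
Proof.
pose E : W := [ffun r => [ffun nu : mono p n t =>
  - (if [pick i | 0 < e2n nu.1 i]%N is Some i then
     cf (Z i r) (esub (e2n nu.1) (eps i 1)) nu.2 else 0)]].
exists E; split.
  move=> r [al u]; rewrite !ffunE oppr_eq0 /=; case: pickP => [i _|_]; last by rewrite eqxx.
  exact: (cf_par (@Z_even i r)).
move=> j; rewrite brWC brW_Dr; apply/ffunP=> r; apply: cf_ext => a u.
rewrite oppWE ffunE cfN cf_DA_even.
case: ltnP => aj; last by rewrite Z_top_all // oppr0.
case: (monP F p n t a) => [al ea|i hi _]; last first.
  rewrite (cf_out _ _ hi) (@cf_out _ _ _ _ _ _ _ _ i) ?oppr0 //.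
  by rewrite ffunE ltn_addr.
have [be eb] : {be : expo p t | eadd a (eps j 1) = e2n be}.
  apply: e2n_surj => i; rewrite !ffunE ea; case: eqP => [->|_].
    by rewrite addn1 -ea.
  by rewrite addn0 e2n_le.
rewrite eb cf_e2n !ffunE /= opprK -eb; case: pickP => [i hi|/(_ j)]; last first.
  by rewrite !ffunE eqxx addn1.
have [->|ij] := eqVneq i j.
  by congr cf; apply/ffunP=> x; rewrite !ffunE addnK.
(* The definition of E picked x_i rather than x_j here; closedness identifies the two
   coefficients. *)
move: hi; rewrite !ffunE (negPf ij) addn0 => hi.
have := congr1 (fun f => cf f (esub a (eps i 1)) u) (Z_closed j i r).
rewrite !cf_DA_even !ffunE eqxx eq_sym (negPf ij) subn0 aj.
have ai : (a i <= pi_ i)%N by rewrite ea e2n_le.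
have -> : (a i - 1 < pi_ i)%N by rewrite subn1 prednK.
have -> : eadd (esub a (eps i 1)) (eps i 1) = a.
  by apply/ffunP=> x; rewrite !ffunE; case: eqP => [->|_]; rewrite ?subnK ?subn0 ?addn0.
move=> ->; congr cf; apply/ffunP=> x; rewrite !ffunE.
case: (eqVneq x i) => [->|_]; last by rewrite !subn0.
by rewrite (negPf ij) !addn0.
Qed.

End Step1.

End Integration.

(** * Killing the torus and the odd linear part *)

Local Opaque brW appW Defs.mulA DA.

Section Normalisation.
Variables (F : fieldType) (p m n : nat) (t : 'I_m -> nat).
Hypotheses (hp : p \in [pchar F]) (hp3 : (3 < p)%N).
Hypotheses (hm : (3 <= m)%N) (hn : (3 <= n)%N) (ht : forall i, (0 < t i)%N).
Local Notation A := (Alg F p n t).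
Local Notation W := (Wt F p n t).
Local Notation pi_ := (piexp p t).
Local Notation mon := (@monomial F p m n t).
Local Notation hh := (@hh F p m n t).
Local Notation xx := (@xx F p m n t).
Local Notation xi := (@xi F p m n t).
Local Notation Dr i := (Dr F p t (inl i) : W).
Local Notation "f ** g" := (Defs.mulA f g) (at level 40, left associativity).
Implicit Types (a b : {ffun 'I_m -> nat}) (u v w : {set 'I_n}) (f g h : A).
Implicit Types (r s q : Y m n) (c d e : bool) (E x y : W).
Implicit Types (D : W -> W).

Notation n_pos := (n_pos hn).
Notation third_m i j := (third i j hm).
Notation third_n k l := (third k l hn).

Lemma brDr_fD_xi j f r u : f = mon ezero u -> brW (Dr j) (fD f r) = 0.
Proof. by move=> ->; rewrite brDr_mon0 // ffunE. Qed.

Section Kernel.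
Variables (D : W -> W) (hD : isDer D).
Hypothesis D0 : forall i, D (Dr i) = 0.

Lemma D_even y : inSS y -> evenW (D y).
Proof. by case: hD => _ h _; apply: h. Qed.

Lemma D_br x y : inSS x -> inSS y -> D (brW x y) = brW x (D y) - brW y (D x).
Proof. by case: hD => _ _ h; apply: h. Qed.

Lemma Dconst y : inSS y -> (forall q : 'I_m, D (brW (Dr q) y) = 0) ->
  forall (q : 'I_m) r, DA (inl q) (D y r) = 0.
Proof.
move=> hy hq q r; have := hq q; rewrite (D_br (Dr_SS n hp hm ht q) hy) D0 brW0r subr0.
by move=> /(congr1 (fun E : W => E r)); rewrite brDrE zeroWE.
Qed.

Lemma cf_const f : (forall q : 'I_m, DA (inl q) f = 0) ->
  forall a u, cf f a u != 0 -> a = ezero.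
Proof.
move=> h a u; have [[q aq]|hz] : (exists q : 'I_m, (0 < a q)%N) \/ (forall q : 'I_m, a q = 0%N).
- case: (pickP (fun q : 'I_m => 0 < a q)%N) => [q hq|hq]; first by left; exists q.
  by right=> q; have := hq q; case: (a q).
- have [ap|] := leqP (a q) (pi_ q); last by move/cf_out ->; rewrite eqxx.
  have := congr1 (fun f => cf f (esub a (eps q 1)) u) (h q).
  rewrite cf_DA_even !ffunE eqxx cf0.
  have -> : (a q - 1 < pi_ q)%N by rewrite subn1 prednK.
  have -> : eadd (esub a (eps q 1)) (eps q 1) = a.
    by apply/ffunP=> x; rewrite !ffunE; case: eqP => [->|_]; rewrite ?subnK ?subn0 ?addn0.
  by move=> ->; rewrite eqxx.
by move=> _; apply/ffunP=> q; rewrite hz ffunE.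
Qed.

(** A derivation that kills the torus commutes with its action, so D(y) consists of constant fields
    with the weights of y. *)
Lemma D_weight (w : 'I_m -> 'I_n -> F) y :
  (forall i k, D (hh i k) = 0) ->
  inSS y -> (forall q : 'I_m, D (brW (Dr q) y) = 0) ->
  (forall i k, brW (hh i k) y = w i k *: y) ->
  forall r a u, cf (D y r) a u != 0 ->
    a = ezero /\ forall i k, w i k = wt F i k ezero u r.
Proof.
move=> Dh hy hq hw r a u ne; have a0 := cf_const (fun q : 'I_m => Dconst hy hq q r) ne.
split=> // i k; have := D_br (hh_SS hp ht i k) hy.
rewrite hw (@isDer_Z _ _ _ _ _ _ _ _ hD) // Dh brW0r subr0.
move=> /(congr1 (fun E : W => cf (E r) a u)); rewrite scaleWE cfZ (cf_br_hh hp ht) a0.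
by rewrite a0 in ne; move/(mulIf ne).
Qed.

Lemma wt_inl i k u j : wt F i k ezero u (inl j : Y m n) = (k \in u)%:R - (j == i)%:R.
Proof. by rewrite /wt ffunE eqYll subr0. Qed.
Lemma wt_inr i k u l : wt F i k ezero u (inr l : Y m n) = (k \in u)%:R - (l == k)%:R.
Proof. by rewrite /wt ffunE eqYrr subr0. Qed.

Lemma boolF (b1 b2 : bool) : (b1%:R : F) = b2%:R -> b1 = b2.
Proof.
by case: b1; case: b2 => // /eqP; rewrite ?[0 == 1]eq_sym oner_eq0.
Qed.

Lemma wt_diff i i' k u r : wt F i k ezero u r - wt F i' k ezero u r =
  (r == inl i')%:R - (r == inl i)%:R.
Proof. by rewrite /wt !ffunE; ring. Qed.

(** Differences of weights in two even indices recover an even D_j; an even index avoiding it then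
    shows the odd part. The condition excludes fields xi_b xi^w d_b, whose weights do not depend on
    b outside w. For odd s, a wrong derivation would force -1 to be 0 or 1. *)
Lemma wt_inj r s u v : (if s is inr b then b \notin v else true) ->
  (forall i k, wt F i k ezero v s = wt F i k ezero u r) -> r = s /\ u = v.
Proof.
move=> hs h; have dd i i' : ((s == inl i')%:R - (s == inl i)%:R : F) =
    (r == inl i')%:R - (r == inl i)%:R.
  by rewrite -(wt_diff i i' n_pos v s) -(wt_diff i i' n_pos u r) !h.
case: s hs h dd => [j|b] hs h dd.
  have rj : r = inl j.
    case: r {h} dd => [j'|l] dd.
      have [->//|jj'] := eqVneq j' j.
      have [i /andP [ij ij']] := third_m j j'.
      have := dd j i; rewrite !eqYll eqxx (negPf jj') ![_ == i]eq_sym (negPf ij) (negPf ij').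
      by move=> /eqP; rewrite sub0r subr0 oppr_eq0 oner_eq0.
    have [i /andP [ij _]] := third_m j j.
    have := dd j i; rewrite !eqYll eqxx [j == i]eq_sym (negPf ij).
    by move=> /eqP; rewrite sub0r subr0 oppr_eq0 oner_eq0.
  split=> //; apply/setP => k; have [i /andP [ij _]] := third_m j j.
  have := h i k; rewrite rj !wt_inl [j == i]eq_sym (negPf ij) !subr0 => /boolF //.
case: r h dd => [j|l] h dd.
  have [i /andP [ij _]] := third_m j j.
  have := dd j i; rewrite !eqYll eqxx [j == i]eq_sym (negPf ij).
  by move=> /esym/eqP; rewrite /= subrr sub0r oppr_eq0 oner_eq0.
have [i _] := third_m (Ordinal (leq_trans (isT : 0 < 3)%N hm)) (Ordinal (leq_trans (isT : 0 < 3)%N hm)).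
have lb : l = b.
  apply/eqP/negPn/negP => lb; have := h i b; rewrite !wt_inr eqxx (negPf hs) (negPf lb).
  rewrite subr0 sub0r; case: (b \in u) => /eqP.
    by rewrite eq_sym -subr_eq0 opprK (negPf (two_neq0 hp hp3)).
  by rewrite oppr_eq0 oner_eq0.
rewrite lb in h *; split=> //; apply/setP => k.
by have := h i k; rewrite !wt_inr => /addIr /boolF.
Qed.

Lemma D_eigen v s : (if s is inr b then b \notin v else true) ->
  (forall i k, D (hh i k) = 0) -> inSS (fD (mon ezero v) s : W) ->
  D (fD (mon ezero v) s) = cf (D (fD (mon ezero v) s) s) ezero v *: fD (mon ezero v) s.
Proof.
move=> hs Dh hy; set y := fD _ _ in hy *.
have H r a u := D_weight (w := fun i k => wt F i k ezero v s) Dh hy _ _ (r := r) (a := a) (u := u).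
apply/ffunP=> r; apply: cf_ext => a u; rewrite scaleWE cfZ.
have Hy : cf (y r) a u = ((r == s) && (a == ezero) && (u == v))%:R.
  rewrite /y ffunE; case: eqP => _ /=; last exact: cf0.
  rewrite cf_mon; have [->|] := eqVneq a ezero => //=.
  rewrite (_ : [forall i, _]) ?andbT //; apply/forallP => i; rewrite ffunE //.
rewrite Hy; have [z0|ne] := eqVneq (cf (D y r) a u) 0.
  rewrite z0; case: eqP => [er|] /=; last by rewrite mulr0.
  case: eqP => [ea|] /=; last by rewrite mulr0.
  by case: eqP => [eu|] /=; rewrite ?mulr0 // mulr1 -er -ea -eu z0.
have [|i k|ea ew] := H _ _ r a u ne.
- by move=> q; rewrite (@brDr_fD_xi _ _ _ v) // isDer_0.
- exact: (br_hh_mon hp ht).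
have [er eu] := wt_inj hs ew.
by rewrite er ea eu !eqxx mulr1.
Qed.

Lemma br_hh_hh i k i' k' : brW (hh i k) (hh i' k') = 0.
Proof.
rewrite [X in brW _ X]hhE brWDr !(br_hh_mon hp ht) /wt !ffunE !inE eqYll eqYrr /=.
rewrite addn0 add0n !subr0 [i' == i]eq_sym [k' == k]eq_sym.
by case: (i == i'); case: (k == k'); rewrite ?subrr ?scale0r ?addr0.
Qed.

(** Where some weight is nonzero, the coefficient of E is, up to sign, the value of D divided by it;
    [rel], which is D applied to [h, h'] = 0, makes the quotient independent of the choice. Where
    all weights vanish no correction is possible, and D(h) must be shown to have no such
    component. *)
Lemma step2 : exists E, [/\ evenW E, forall i, brW E (Dr i) = 0 &
  forall i k, D (hh i k) = brW E (hh i k)].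
Proof.
have hS (i : 'I_m) (k : 'I_n) : inSS (hh i k) := hh_SS hp ht i k.
have hc i k : forall (q : 'I_m) r, DA (inl q) (D (hh i k) r) = 0.
  apply: Dconst => // q; rewrite brDr_hh // (@isDer_Z _ _ _ _ _ _ _ _ hD) ?D0 ?scaler0 //.
  exact: Dr_SS.
have W0 i k r a u := cf_const (fun q : 'I_m => hc i k q r) (a := a) (u := u).
have rel i k i' k' r u : wt F i k ezero u r * cf (D (hh i' k') r) ezero u =
    wt F i' k' ezero u r * cf (D (hh i k) r) ezero u.
  have := D_br (hS i k) (hS i' k'); rewrite br_hh_hh (isDer_0 hD).
  move=> /(congr1 (fun E : W => cf (E r) ezero u)); rewrite zeroWE cf0 subWE cfD cfN.
  move=> /esym/eqP; rewrite subr_eq0 => /eqP E0.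
  exact: etrans (esym (cf_br_hh hp ht i k _ _ _ _)) (etrans E0 (cf_br_hh hp ht i' k' _ _ _ _)).
pose e r u : F := if [pick ik : 'I_m * 'I_n | wt F ik.1 ik.2 ezero u r != 0] is Some ik
  then cf (D (hh ik.1 ik.2) r) ezero u / wt F ik.1 ik.2 ezero u r else 0.
pose E : W := [ffun r => [ffun nu : mono p n t => - (if e2n nu.1 == ezero then e r nu.2 else 0)]].
have cE r a u : cf (E r) a u = - (if a == ezero then e r u else 0).
  case: (monP F p n t a) => [al ->|i hi _]; first by rewrite cf_e2n !ffunE.
  rewrite (cf_out _ _ hi); case: eqP => [ea|]; last by rewrite oppr0.
  by move: hi; rewrite ea ffunE.
exists E; split.
- move=> r [al u]; rewrite -cf_e2n cE /e /mpar /= oppr_eq0; case: ifP => _; last by rewrite eqxx.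
  case: pickP => [ik _|_]; last by rewrite eqxx.
  rewrite mulf_eq0 negb_or => /andP [ne _].
  exact: (cf_par (@D_even _ (hS ik.1 ik.2) r) ne).
- move=> i; rewrite brWC; apply/ffunP=> r; rewrite oppWE brDrE zeroWE.
  apply: cf_ext => a u; rewrite cfN cf_DA_even cf0; case: ifP => _; last by rewrite oppr0.
  rewrite cE; case: eqP => [/ffunP /(_ i)|]; last by rewrite !oppr0.
  by rewrite !ffunE eqxx addn1.
move=> i k; rewrite brWC; apply/ffunP=> r; rewrite oppWE; apply: cf_ext => a u.
rewrite cfN (cf_br_hh hp ht) cE; case: eqP => [->|/eqP ne]; last first.
  rewrite oppr0 mulr0 oppr0; apply/eqP/negPn/negP => /W0 ea.
  by rewrite ea eqxx in ne.
rewrite mulrN opprK /e; case: pickP => [[i' k'] /= nz|none].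
  by rewrite mulrA rel mulrAC mulfV // mul1r.
rewrite mulr0.
(* Only the fields xi_s d_s have all weights 0. Applying D to [h, y] = w y with y = xi_a xi_b D_i
   eliminates D(y) and yields the pair sums. *)
have w0 i' k' : wt F i' k' ezero u r = 0.
  by have /negbT := none (i', k'); rewrite negbK => /eqP.
case: r {rel none} w0 => [j|s] w0.
  have [q /andP [qj _]] := third_m j j.
  have := wt_diff j q k u (inl j); rewrite !w0 !eqYll eqxx [j == q]eq_sym (negPf qj) subrr sub0r.
  by move=> /esym/eqP; rewrite oppr_eq0 oner_eq0.
have -> : u = [set s].
  apply/setP => l; rewrite inE; have := w0 i l; rewrite wt_inr => /eqP.
  by rewrite subr_eq0 => /eqP /boolF ->; rewrite eq_sym.
move: s {w0}; apply: (pairs0 hp hp3) => // a1 a2 a12.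
pose j := i; have hy := xixiD_SS hp hm ht j a12; set y := fD _ _ in hy.
have := D_br (hS i k) hy; rewrite (br_hh_mon hp ht) (@isDer_Z _ _ _ _ _ _ _ _ hD) // -/y.
move=> /(congr1 (fun E : W => cf (E (inl j)) ezero [set a1; a2])).
rewrite scaleWE cfZ subWE cfD cfN (cf_br_hh hp ht i k) => /eqP.
rewrite -subr_eq0 opprD addrA subrr sub0r opprK => /eqP.
rewrite brWE appW_fD fDeq hc mulA0r sub0r cfN (cf_app2 hp) //; last exact: (D_even (hS _ _)).
by move=> /eqP; rewrite oppr_eq0 => /eqP.
Qed.

End Kernel.

(** * The odd linear part *)

Lemma xi_dxi k a u : xi k ** DA (inr k) (mon a u) = (k \in u)%:R *: mon a u.
Proof.
rewrite DA_odd; case: (boolP (k \in u)) => ku; last by rewrite mulA0r scale0r.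
rewrite mulAZr mul_mon disjoints1 !inE eqxx /= bino0l mul1r add0e setD1K //.
by rewrite scalerA sg_sqr.
Qed.

Lemma br_xidxi_mon k a u r : brW (fD (xi k) (inr k)) (fD (mon a u) r) =
  ((k \in u)%:R - (r == inr k)%:R) *: fD (mon a u) r.
Proof.
rewrite br_fD xi_dxi (linZ _ _ (@fD_lin _ _ _ _ _ _)) DA_xi mulAZr mulA1.
rewrite scalerBl; congr (_ - _); case: eqP => [->|_]; rewrite ?scale1r ?scale0r //.
exact: (lin0 (@fD_lin _ _ _ _ _ _)).
Qed.

Definition j0 : 'I_m := Ordinal (leq_trans (isT : 0 < 3)%N hm).

(** The single index [j0] suffices in the last clause: bracketing with x_(j0) D_j later moves it to
    any j. *)
Record normalised (D : W -> W) : Prop := Normalised {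
  nDr : forall i, D (Dr i) = 0;
  nhh : forall i k, D (hh i k) = 0;
  nxid : forall k l, k != l -> D (fD (xi k) (inr l)) = 0;
  nxixi : forall k l, k != l -> D (fD (mon ezero [set k; l]) (inl j0)) = 0 }.

(** By [D_eigen], D acts by scalars be(a, b) on xi_a d_b and al(a, b) on xi_a xi_b D_(j0), whereas a
    sum of ga_k xi_k d_k acts by ga_a - ga_b and ga_a + ga_b. The relation [R] makes this system
    solvable, with division by 2. *)
Lemma step3 D : isDer D -> (forall i, D (Dr i) = 0) -> (forall i k, D (hh i k) = 0) ->
  exists E, evenW E /\ normalised (fun x => D x - brW E x).
Proof.
move=> hD D0 Dh.
pose be (a b : 'I_n) := cf (D (fD (xi a) (inr b)) (inr b)) ezero [set a].
pose al (a b : 'I_n) := cf (D (fD (mon ezero [set a; b]) (inl j0)) (inl j0)) ezero [set a; b].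
have Dxid (a b : 'I_n) : a != b -> D (fD (xi a) (inr b)) = be a b *: fD (xi a) (inr b).
  move=> ab; apply: (D_eigen hD D0) => //; first by rewrite inE eq_sym.
  exact: (xid_SS t hp hp3 ab).
have Dxx (a b : 'I_n) : a != b -> D (fD (mon ezero [set a; b]) (inl j0)) =
    al a b *: fD (mon ezero [set a; b]) (inl j0).
  by move=> ab; apply: (D_eigen hD D0) => //; exact: (xixiD_SS hp hm ht _ ab).
have alC (a b : 'I_n) : al a b = al b a by rewrite /al setUC.
(* D is applied to the bracket of xi_a d_b and xi_b xi_l D_(j0), a nonzero multiple of xi_a xi_l
   D_(j0). *)
have R (a b l : 'I_n) : a != b -> a != l -> b != l -> al a l = be a b + al b l.
  move=> ab la lb.
  have [c c0 E] : exists2 c : F, c != 0 & brW (fD (xi a) (inr b)) (fD (mon ezero [set b; l]) (inl j0)) =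
      c *: fD (mon ezero [set a; l]) (inl j0) :> W.
    exists (sg F [set b] [set l] * sg F [set a] [set l]); first by rewrite mulf_neq0 ?sg_neq0.
    rewrite br_fD DA_odd DA_even ffunE /= mulA0r (lin0 (@fD_lin _ _ _ _ _ _)) subr0.
    rewrite !inE eqxx /= mulAZr (linZ _ _ (@fD_lin _ _ _ _ _ _)).
    have -> : [set b; l] :\ b = [set l].
      apply/setP => x; rewrite !inE; have [->|_] //= := eqVneq x b.
      by rewrite (negPf lb).
    rewrite mul_mon disjoints1 inE la bino0l mul1r add0e.
    by rewrite (linZ _ _ (@fD_lin _ _ _ _ _ _)) scalerA.
  have hx := xid_SS t hp hp3 ab; have hy := xixiD_SS hp hm ht j0 lb.
  have := D_br hD hx hy; rewrite E (@isDer_Z _ _ _ _ _ _ _ _ hD); last exact: (xixiD_SS hp hm ht _ la).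
  rewrite Dxx // Dxx // Dxid // !brWZr E [brW (fD (mon _ _) _) _]brWC E.
  rewrite scalerN opprK -scalerDl => /(congr1 (fun E : W => cf (E (inl j0)) ezero [set a; l])).
  rewrite !scaleWE !cfZ fDeq cf_mon !eqxx /=.
  have -> : [forall i, ezero i <= pi_ i]%N by apply/forallP => i; rewrite ffunE.
  rewrite !mulr1 => H; apply: (mulfI c0); by rewrite H mulrDr [c * al b l]mulrC [c * be a b]mulrC mulrDl addrC.
have beC (a b : 'I_n) : a != b -> be a b = - be b a.
  move=> ab; have [l /andP [la lb]] := third_n a b.
  rewrite eq_sym in la; rewrite eq_sym in lb.
  have h1 := R a b l ab la lb; rewrite eq_sym in ab; have h2 := R b a l ab lb la.
  apply/eqP; rewrite -addr_eq0; apply/eqP.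
  have -> : be a b + be b a = (be a b + al b l) + (be b a + al a l) - al b l - al a l by ring.
  by rewrite -h1 -h2; ring.
have [nxt hnxt] : {nxt : 'I_n -> 'I_n | forall a : 'I_n, nxt a != a}.
  exists (fun a : 'I_n => if [pick q : 'I_n | q != a] is Some q then q else a) => a.
  case: pickP => // none; have [q /andP [qa _]] := third_n a a.
  by have := none q; rewrite qa.
clearbody be al.
(* By [R] this value does not depend on the second index, so an arbitrary [nxt a] is used. *)
pose ga (a : 'I_n) := (al a (nxt a) + be a (nxt a)) / 2.
have two0 := two_neq0 hp hp3.
have gaE (a l : 'I_n) : a != l -> ga a = (al a l + be a l) / 2.
  move=> la; rewrite /ga; congr (_ / _).
  have [->//|ne] := eqVneq (nxt a) l.
  have an : a != nxt a by rewrite eq_sym hnxt.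
  have h1 := R a (nxt a) l an la ne.
  rewrite eq_sym in ne; have h2 := R a l (nxt a) la an ne.
  by rewrite h1 h2 (alC (nxt a) l); ring.
have ga_add (a l : 'I_n) : a != l -> ga a + ga l = al a l.
  move=> la; rewrite (gaE a l la) (gaE l a) 1?eq_sym // (alC l a) (beC l a) 1?eq_sym //.
  by field.
have ga_sub (a l : 'I_n) : a != l -> ga a - ga l = be a l.
  move=> la; rewrite (gaE a l la) (gaE l a) 1?eq_sym // (alC l a) (beC l a) 1?eq_sym //.
  by field.
pose E : W := \sum_k ga k *: fD (xi k) (inr k).
have brE a u r : brW E (fD (mon a u) r) =
    (\sum_k ga k * ((k \in u)%:R - (r == inr k)%:R)) *: fD (mon a u) r.
  rewrite /E (lin_sum _ _ (@brW_linl _ _ _ _ _ _)) scaler_suml.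
  by apply: eq_bigr => k _; rewrite br_xidxi_mon scalerA.
have eE : evenW E.
  rewrite /E; elim/big_ind: _ => [|x y|k _]; [exact: evenW0|exact: evenWD|].
  by apply/evenWZ/evenW_fD; apply: par_xi.
have sum2 (G : 'I_n -> F) (k l : 'I_n) : k != l -> (forall q : 'I_n, q != k -> q != l -> G q = 0) ->
    \sum_q G q = G k + G l.
  move=> kl h; rewrite (bigD1 k) //= (bigD1 l) ?[l == k]eq_sym //= big1 ?addr0 // => q.
  by case/andP; apply: h.
exists E; split=> //; split.
- move=> i; rewrite D0 {1}/Defs.Dr oneAE brE big1 ?scale0r ?subrr // => k _.
  by rewrite inE subrr mulr0.
- move=> i k; rewrite Dh [X in brW _ X]hhE brWDr !brE !big1 ?scale0r ?addr0 ?subr0 // => l _.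
    by rewrite inE eqYrr eq_sym subrr mulr0.
  by rewrite inE subrr mulr0.
- move=> k l kl; rewrite Dxid // brE (sum2 _ k l) //=; last first.
    by move=> q qk ql; rewrite inE eqYrr (negPf qk) eq_sym (negPf ql) subrr mulr0.
  rewrite !inE !eqYrr !eqxx [l == k]eq_sym (negPf kl) subr0 sub0r mulr1 mulrN1 ga_sub //.
  by rewrite subrr.
- move=> k l kl; rewrite Dxx // brE (sum2 _ k l) //=; last first.
    by move=> q qk ql; rewrite !inE (negPf qk) (negPf ql) subrr mulr0.
  by rewrite !inE !eqxx orbT !subr0 !mulr1 ga_add // subrr.
Qed.

Lemma normalisable D : isDer D ->
  exists E, evenW E /\ normalised (fun x => D x - brW E x).
Proof.
move=> hD; have [E1 [e1 z1]] := step1 hp hp3 hm hn ht hD.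
have hD1 := isDer_sub hp hD (isDer_ad hp e1).
have d1 i : D (Dr i) - brW E1 (Dr i) = 0 by rewrite z1 subrr.
have [E2 [e2 z2 h2]] := step2 hD1 d1.
have hD2 := isDer_sub hp hD1 (isDer_ad hp e2).
have d2 i : D (Dr i) - brW E1 (Dr i) - brW E2 (Dr i) = 0 by rewrite d1 z2 subrr.
have g2 i k : D (hh i k) - brW E1 (hh i k) - brW E2 (hh i k) = 0 by rewrite h2 subrr.
have [E3 [e3 [n1 n2 n3 n4]]] := step3 hD2 d2 g2.
exists (E1 + E2 + E3); split; first by apply: evenWD => //; apply: evenWD.
have eq x : D x - brW (E1 + E2 + E3) x = D x - brW E1 x - brW E2 x - brW E3 x.
  by rewrite !brWDl !opprD !addrA.
by split=> *; rewrite eq; [apply: n1|apply: n2|apply: n3|apply: n4].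
Qed.

End Normalisation.

(** * Generation of the special algebra *)

Local Opaque brW appW Defs.mulA DA.

Section Generation.
Variables (F : fieldType) (p m n : nat) (t : 'I_m -> nat).
Hypotheses (hp : p \in [pchar F]) (hp3 : (3 < p)%N).
Hypotheses (hm : (3 <= m)%N) (hn : (3 <= n)%N) (ht : forall i, (0 < t i)%N).
Local Notation A := (Alg F p n t).
Local Notation W := (Wt F p n t).
Local Notation pi_ := (piexp p t).
Local Notation mon := (@monomial F p m n t).
Local Notation hh := (@hh F p m n t).
Local Notation xx := (@xx F p m n t).
Local Notation xi := (@xi F p m n t).
Local Notation Dr i := (Dr F p t (inl i) : W).
Local Notation "f ** g" := (Defs.mulA f g) (at level 40, left associativity).
Implicit Types (a : {ffun 'I_m -> nat}) (u v : {set 'I_n}) (f g : A).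
Implicit Types (r s : Y m n) (E : W).

Local Notation n_pos := (n_pos hn).
Local Notation third_m i j := (third i j hm).
Local Notation third_n k l := (third k l hn).
Local Notation smul := (@smul F p m n t).
Local Notation V a u r := (fD (mon a u) r : W).
Local Notation DF := (@divfield F p m n t).

(** * Multiplying fields by functions *)

Lemma smul_fD f g r : smul f (fD g r) = fD (f ** g) r.
Proof.
apply/ffunP=> s; rewrite !ffunE; case: eqP => // _; exact: mulA0r.
Qed.

Lemma smulD f E1 E2 : smul f (E1 + E2) = smul f E1 + smul f E2.
Proof. by apply/ffunP=> s; rewrite !ffunE mulADr. Qed.
Lemma smulZr f k E : smul f (k *: E) = k *: smul f E.
Proof. by apply/ffunP=> s; rewrite !ffunE mulAZr. Qed.
Lemma smul0r f : smul f 0 = 0.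
Proof. by apply/ffunP=> s; rewrite !ffunE mulA0r. Qed.
Lemma smulA f g E : smul f (smul g E) = smul (f ** g) E.
Proof. by apply/ffunP=> s; rewrite !ffunE mulA_assoc. Qed.
Lemma smulE f E r : smul f E r = f ** E r. Proof. exact: ffunE. Qed.

Lemma appW_smul f E g : appW (smul f E) g = f ** appW E g.
Proof.
Local Transparent appW.
rewrite /appW mulA_sumr; apply: eq_bigr => r _.
by rewrite smulE mulA_assoc.
Local Opaque appW.
Qed.

Lemma br_smul_l f E E' : Alg_par false f -> evenW E' -> appW E' f = 0 ->
  brW (smul f E) E' = smul f (brW E E').
Proof.
move=> hf hE f0; apply/ffunP=> r; rewrite smulE !brWE smulE appW_smul.
by rewrite (appW_leib hp _ hE hf) f0 mulA0l add0r mulABr.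
Qed.

Lemma br_smul_hh i k a u (w : F) E : ~~ odd #|u| -> brW (hh i k) E = w *: E ->
  brW (hh i k) (smul (mon a u) E) = ((a i + (k \in u))%:R + w) *: smul (mon a u) E.
Proof.
move=> ou hE; have pm : Alg_par false (mon a u) by rewrite -(negPf ou); apply: par_mon.
have eh : evenW (hh i k) by case: (hh_SS hp ht i k).
apply/ffunP=> r; rewrite brWE appW_smul smulE (appW_leib hp _ eh pm).
rewrite -addrA -mulABr -brWE hE !scaleWE mulAZr appW_hh_mon mulAZl smulE.
by rewrite -scalerDl.
Qed.

Lemma Dr_smul f q : fD f (inl q) = smul f (Dr q).
Proof. by rewrite /Defs.Dr smul_fD mulA1. Qed.

(** The two vanishing conditions make f D_q commute with E, so only the derivative of g remains.
    With g = x_q the bracket multiplies E by f. *)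
Lemma br_comp f q g E : Alg_par false f -> Alg_par false g -> evenW E ->
  appW E f = 0 -> brW (Dr q) E = 0 ->
  brW (fD f (inl q)) (smul g E) = smul (f ** DA (inl q) g) E.
Proof.
move=> hf hg eE Ef DE; have h0 : brW (fD f (inl q)) E = 0.
  by rewrite Dr_smul br_smul_l // DE smul0r.
have eX : evenW (fD f (inl q)) by apply: evenW_fD.
apply/ffunP=> r; rewrite brWE appW_smul !smulE (appW_leib hp _ eX hg).
by rewrite -addrA -mulABr -brWE h0 zeroWE mulA0r addr0 appW_fD.
Qed.

Lemma bino_disj (a b : {ffun 'I_m -> nat}) : (forall i, a i = 0%N \/ b i = 0%N) -> bino F a b = 1.
Proof.
move=> h; rewrite /bino big1 // => i _.
by case: (h i) => ->; rewrite ?bin0 // addn0 binn.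
Qed.

Lemma mon_mul0 (a b : {ffun 'I_m -> nat}) v : (forall i, a i = 0%N \/ b i = 0%N) ->
  mon a set0 ** mon b v = mon (eadd a b) v.
Proof.
move=> h; rewrite mul_mon disjoints_subset sub0set set0U sg0l mulr1 bino_disj //.
by rewrite scale1r.
Qed.

Lemma mon_0mul (a b : {ffun 'I_m -> nat}) v : (forall i, a i = 0%N \/ b i = 0%N) ->
  mon a v ** mon b set0 = mon (eadd a b) v.
Proof.
move=> h; rewrite mul_mon disjoint_sym disjoints_subset sub0set setU0 sg0r mulr1 bino_disj //.
by rewrite scale1r.
Qed.

Lemma par_mon0 a : Alg_par false (mon a set0).
Proof. by apply: (par_eq (@par_mon _ _ _ _ _ _ _)); rewrite cards0. Qed.

Lemma par_even a u : ~~ odd #|u| -> Alg_par false (mon a u).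
Proof. by move=> h; rewrite -(negPf h); apply: par_mon. Qed.

Lemma DA_mon_eps0 r q (c : nat) : r != inl q -> DA r (mon (eps q c) set0) = 0.
Proof.
case: r => [j|k] h; rewrite ?DA_even ?DA_odd ?inE // ffunE.
by rewrite (negPf (h : j != q)).
Qed.

Lemma DA_even0 j a u : a j = 0%N -> DA (inl j) (mon a u) = 0.
Proof. by move=> h; rewrite DA_even h. Qed.

Lemma DA_odd0 k a u : k \notin u -> DA (inr k) (mon a u) = 0.
Proof. by move=> h; rewrite DA_odd (negPf h). Qed.

Lemma hh_mul i k a : a i = 0%N -> smul (mon a set0) (hh i k) =
  V (eadd a (eps i 1)) set0 (inl i) + V a [set k] (inr k).
Proof.
move=> ai; rewrite hhE smulD !smul_fD !mon_mul0; first by rewrite adde0.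
  by move=> x; right; rewrite ffunE.
by move=> x; rewrite ffunE; case: eqP => [->|_]; [left|right].
Qed.

Section Kill.
Variables (D : Wt F p n t -> Wt F p n t) (hD : isDer D) (nD : normalised hm D).
(** The scalars in [Dpp] are what the normalisation leaves free. One D_j for each i is enough: the
    others come from a bracket with x_(nx i) D_j. *)
Variable nx : 'I_m -> 'I_m.
Hypothesis nxP : forall i, nx i != i.
Hypothesis Dpp : forall (i : 'I_m) (k : nat), (0 < k < t i)%N ->
  cf (D (V (eps i (p ^ k)) set0 (inl (nx i))) (inl (nx i))) ezero set0 = 0.

(** Membership is part of the notion, as D is a derivation on S_0 only; thus [killed] is closed
    under brackets. *)
Definition killed y := inSS y /\ D y = 0.

Lemma killedD y1 y2 : killed y1 -> killed y2 -> killed (y1 + y2).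
Proof.
move=> [s1 d1] [s2 d2]; split; first exact: inSSD.
by rewrite isDer_D // d1 d2 addr0.
Qed.
Lemma killedZ k y : killed y -> killed (k *: y).
Proof.
move=> [s1 d1]; split; first exact: inSSZ.
by rewrite isDer_Z // d1 scaler0.
Qed.
Lemma killedB y1 y2 : killed y1 -> killed y2 -> killed (y1 - y2).
Proof. by move=> h1 h2; apply: killedD => //; rewrite -scaleN1r; apply: killedZ. Qed.
Lemma killed0 : killed 0. Proof. by split; [exact: inSS0|exact: isDer_0]. Qed.
Lemma killed_br y1 y2 : killed y1 -> killed y2 -> killed (brW y1 y2).
Proof.
move=> [s1 d1] [s2 d2]; split; first exact: inSS_br.
by rewrite D_br // d1 d2 !brW0r subrr.
Qed.
Lemma killed_unscale k y : k != 0 -> killed (k *: y) -> killed y.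
Proof. by move=> k0 /(killedZ k^-1); rewrite scalerA mulVf // scale1r. Qed.
Lemma killed_even y : killed y -> evenW y. Proof. by move=> [[_ h] _]. Qed.

(** In most applications no constant field has the weights of y, and the last condition holds
    vacuously. *)
Lemma killed_weight (w : 'I_m -> 'I_n -> F) y : inSS y ->
  (forall q : 'I_m, killed (brW (Dr q) y)) ->
  (forall i k, brW (hh i k) y = w i k *: y) ->
  (forall r u, (forall i k, w i k = wt F i k ezero u r) ->
     cf (D y r) ezero u = 0) ->
  killed y.
Proof.
move=> hy hq hw hc; split=> //; apply/ffunP=> r; apply: cf_ext => a u.
rewrite zeroWE cf0; apply/eqP/negPn/negP => ne.
have [|ea ew] := D_weight hp hm ht hD (nDr nD) (nhh nD) hy _ hw ne.
  by move=> q; case: (hq q).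
by move: ne; rewrite ea hc ?eqxx.
Qed.

Lemma killed_Dr i : killed (Dr i).
Proof. by split; [apply: Dr_SS hp hm ht i|apply: nDr nD i]. Qed.
Lemma killed_hh i k : killed (hh i k).
Proof. by split; [apply: hh_SS hp ht i k|apply: nhh nD i k]. Qed.
Lemma killed_V0 j : killed (V ezero set0 (inl j)).
Proof. by have := killed_Dr j; rewrite /Defs.Dr oneAE. Qed.

Lemma wt_diff2 i i' k a u r : wt F i k a u r - wt F i' k a u r =
  (a i)%:R - (a i')%:R + (r == inl i')%:R - (r == inl i)%:R.
Proof. by rewrite /wt !natrD; ring. Qed.

Lemma three_neq0 : (3 : F) != 0. Proof. by apply: (natF_neq0 hp). Qed.
Lemma two0 : (2 : F) != 0. Proof. exact: two_neq0 hp hp3. Qed.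

(** The weights along q and j differ by 2, those of a constant field by -1, 0 or 1. The value -1 is
    excluded by 3 being nonzero in F, which is where p > 3 is used. *)
Lemma killed_xD a q j : q != j -> a q = 1%N -> a j = 0%N ->
  (forall i : 'I_m, killed (brW (Dr i) (V a set0 (inl j)))) -> killed (V a set0 (inl j)).
Proof.
move=> qj aq aj hl.
apply: (killed_weight (w := fun i k => wt F i k a set0 (inl j))) => //.
- by apply: (@memB F p m n t j n_pos); rewrite ?inE ?cards0.
- by move=> i k; apply: (br_hh_mon hp ht).
move=> r u h; exfalso; have := wt_diff2 q j n_pos a set0 (inl j).
rewrite !h wt_diff2 !ffunE aq aj !eqYll eqxx [j == q]eq_sym (negPf qj).
have E2 (z : F) : z = 2 -> z = 1%:R - 0%:R + 1%:R - 0%:R by move=> ->; ring.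
case: (r == inl j); case: (r == inl q) => /= /eqP.
- rewrite -subr_eq0 (_ : _ - _ = -2); last by ring.
  by rewrite oppr_eq0 (negPf two0).
- rewrite -subr_eq0 (_ : _ - _ = -1); last by ring.
  by rewrite oppr_eq0 oner_eq0.
- rewrite -subr_eq0 (_ : _ - _ = -3); last by ring.
  by rewrite oppr_eq0 (negPf three_neq0).
- rewrite -subr_eq0 (_ : _ - _ = -2); last by ring.
  by rewrite oppr_eq0 (negPf two0).
Qed.

Lemma killed_xiDj i j : i != j -> killed (V (eps i 1) set0 (inl j)).
Proof.
move=> ij; apply: (@killed_xD _ i) => //; rewrite ?ffunE ?eqxx //.
  by rewrite eq_sym (negPf ij).
move=> q; rewrite brDr_mon; case: ifP => h; last exact: killed0.
have qi : q = i by move: h; rewrite ffunE; case: eqP.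
have -> : esub (eps i 1) (eps q 1) = ezero by apply/ffunP=> x; rewrite !ffunE qi subnn.
exact: killed_V0.
Qed.

(** Since D_s kills the first coefficient, the bracket is a single monomial field, and its
    coefficient is a binomial up to sign. *)
Lemma killed_compV a u q b v s c w :
  killed (V a u (inl q)) -> killed (V b v s) -> (0 < b q <= pi_ q)%N ->
  DA s (mon a u) = 0 -> [disjoint u & v] -> bino F a (esub b (eps q 1)) != 0 ->
  eadd a (esub b (eps q 1)) = c -> u :|: v = w -> killed (V c w s).
Proof.
move=> k1 k2 bq ds duv nb <- <-; have := killed_br k1 k2.
rewrite br_fD DA_even bq ds mulA0r (lin0 (@fD_lin _ _ _ _ _ _)) subr0 mul_mon duv.
rewrite (linZ _ _ (@fD_lin _ _ _ _ _ _)); apply: killed_unscale.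
by rewrite mulf_neq0 // sg_neq0.
Qed.

Lemma killed_xixiD k l j : k != l -> killed (V ezero [set k; l] (inl j)).
Proof.
move=> kl; have h0 : killed (V ezero [set k; l] (inl (j0 hm))).
  by split; [exact: (xixiD_SS hp hm ht _ kl)|exact: (nxixi nD kl)].
have [->//|jj] := eqVneq j (j0 hm); rewrite eq_sym in jj.
apply: (killed_compV h0 (killed_xiDj jj)).
- by rewrite ffunE eqxx (pi_gt0 hp ht).
- by rewrite DA_even0 // ffunE.
- by rewrite disjoint_sym disjoints_subset sub0set.
- by rewrite bino0l oner_eq0.
- by apply/ffunP=> x; rewrite !ffunE subnn.
- by rewrite setU0.
Qed.

Lemma brDr_smul f q E : Alg_par false f ->
  brW (Dr q) (smul f E) = smul (DA (inl q) f) E + smul f (brW (Dr q) E).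
Proof.
move=> hf; apply/ffunP=> r; rewrite brDrE addWE !smulE brDrE.
by rewrite (leibniz hp _ _ hf) /= scale1r.
Qed.

Lemma smul1 E : smul (oneA F p n t) E = E.
Proof. by apply/ffunP=> r; rewrite smulE mul1A. Qed.
Lemma smulZl k f E : smul (k *: f) E = k *: smul f E.
Proof. by apply/ffunP=> r; rewrite scaleWE !smulE mulAZl. Qed.

(** The torus element has weight 0, so x_j alone gives the weights: 1 along j and 0 along i and a
    third index. A constant field matching the latter two has difference 0 or -1 along j. *)
Lemma killed_xhh j i k : i != j -> killed (smul (mon (eps j 1) set0) (hh i k)).
Proof.
move=> ij; have [q /andP [qi qj]] := third_m i j.
apply: (killed_weight (w := fun i' k' => ((eps j 1 i') + (k' \in (set0 : {set 'I_n})))%:R + 0)).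
- rewrite hh_mul; last by rewrite ffunE (negPf ij).
  by apply: memH; rewrite ffunE (negPf ij) (pi_gt0 hp ht).
- move=> x; rewrite brDr_smul; last exact: par_mon0.
  apply: killedD.
    rewrite -/(xx j) (DA_xx hp ht) smulZl smul1; apply: killedZ; exact: killed_hh.
  rewrite (brDr_hh hp ht) smulZr; have [ix|ix] := eqVneq i x.
    by rewrite scale1r -Dr_smul -ix; apply: killed_xiDj; rewrite eq_sym.
  by rewrite scale0r; apply: killed0.
- move=> i' k'; apply: br_smul_hh; rewrite ?cards0 //.
  by rewrite (br_hh_hh hp ht) scale0r.
move=> r u h; exfalso.
have w1 := wt_diff F i q n_pos u r; have w2 := wt_diff F j q n_pos u r.
move: w1 w2; rewrite -!h !ffunE !inE eqxx (negPf ij) (negPf qj) /= !addr0 subrr subr0.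
move=> /esym/eqP; rewrite subr_eq0 => /eqP /boolF e1.
have rq : (r == inl q) = false.
  by apply/negP => rq; move: e1; rewrite rq => /esym /eqP e; move: rq; rewrite e eqYll eq_sym (negPf qi).
rewrite rq sub0r; case: (r == inl j) => /eqP; last by rewrite oppr0 oner_eq0.
by rewrite -subr_eq0 opprK (negPf two0).
Qed.

(** Write a = p^k c with c prime to p and c > 1, and take b = p^k. Then C(a, b) = c C(a - 1, b - 1),
    and C(a - 1, j) = (-1)^j in F for j < p^k, by Pascal's rule and the vanishing of C(a, j) for 0 <
    j < p^k. *)
Lemma bin_nonppow (a : nat) : (0 < a)%N ->
  (exists k, a = (p ^ k)%N) \/ exists b, (0 < b < a)%N /\ ('C(a, b)%:R : F) != 0.
Proof.
move=> a0; have pp := p_prime hp; have [c cpc ea] := pfactor_coprime pp a0.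
set k := logn p a in ea; have pk : (0 < p ^ k)%N by rewrite expn_gt0 prime_gt0.
have c0 : (0 < c)%N by move: a0; rewrite ea muln_gt0 => /andP [].
have [c1|c1] := leqP c 1; [left; exists k|right; exists (p ^ k)%N].
  by rewrite {1}ea (_ : c = 1%N) ?mul1n //; apply/eqP; rewrite eqn_leq c1.
have pka : (p ^ k < a)%N by rewrite [X in (_ < X)%N]ea ltn_Pmull.
split; first by rewrite pk.
have da : (p ^ k %| a)%N by rewrite [X in (_ %| X)%N]ea dvdn_mull.
have E : 'C(a, p ^ k) = (c * 'C(a.-1, (p ^ k).-1))%N.
  apply/eqP; rewrite -(eqn_pmul2l pk); apply/eqP.
  have := mul_bin_diag a (p ^ k).-1; rewrite prednK // => <-.
  by rewrite mulnA [(p ^ k * c)%N]mulnC -ea.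
have S (j : nat) : (j < p ^ k)%N -> ('C(a.-1, j)%:R : F) = (-1) ^+ j.
  elim: j => [|j IH] jk; first by rewrite bin0.
  have := bin_dvd_eq0 hp da (x := j.+1); rewrite jk => /(_ isT).
  rewrite -{1}(prednK a0) binS natrD (IH (ltnW jk)) exprS mulN1r => /eqP.
  by rewrite addr_eq0 => /eqP.
rewrite E natrM S; last by rewrite prednK.
by rewrite mulf_neq0 ?signr_eq0 // -(dvdn_pcharf hp) -prime_coprime.
Qed.

Lemma bino_eps (i : 'I_m) (b c : nat) : bino F (eps i b) (eps i c) = 'C(b + c, b)%:R.
Proof.
rewrite /bino (bigD1 i) //= big1 ?muln1 => [|j /negPf ji]; first by rewrite !ffunE eqxx.
by rewrite !ffunE ji.
Qed.

Lemma eps_add (i : 'I_m) (b c : nat) : eadd (eps i b) (eps i c) = eps i (b + c).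
Proof. by apply/ffunP=> x; rewrite !ffunE; case: eqP. Qed.
Lemma eps_sub (i : 'I_m) (b c : nat) : esub (eps i b) (eps i c) = eps i (b - c).
Proof. by apply/ffunP=> x; rewrite !ffunE; case: eqP. Qed.
Lemma eps0 (i : 'I_m) : eps i 0 = ezero.
Proof. by apply/ffunP=> x; rewrite !ffunE; case: eqP. Qed.
Lemma eaddK (a b : {ffun 'I_m -> nat}) : esub (eadd a b) b = a.
Proof. by apply/ffunP=> x; rewrite !ffunE addnK. Qed.
Lemma disj0l u : [disjoint (set0 : {set 'I_n}) & u].
Proof. by rewrite disjoints_subset sub0set. Qed.

Lemma eps_neq (i j : 'I_m) (c : nat) : j != i -> eps i c j = 0%N.
Proof. by move=> /negPf h; rewrite ffunE h. Qed.
Lemma epsE (i : 'I_m) (c : nat) : eps i c i = c.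
Proof. by rewrite ffunE eqxx. Qed.

(** A joint induction: x_i^(a) D_j is obtained from [x_i^(b) D_q, x_i^(a - b) x_q D_j], whose
    factors are of the first and the second kind. The second kind at a follows from the first by
    [killed_xD]. *)
Lemma killed_PQ i (a : nat) :
  (forall j, j != i -> killed (V (eps i a) set0 (inl j))) /\
  (forall q j, q != i -> j != i -> q != j ->
     killed (V (eadd (eps i a) (eps q 1)) set0 (inl j))).
Proof.
elim/ltn_ind: a => a IH.
have P j : j != i -> killed (V (eps i a) set0 (inl j)).
  move=> ji; have [a0|a0] := posnP a; first by rewrite a0 eps0; apply: killed_V0.
  have [ap|ap] := leqP a (pi_ i); last first.
    by rewrite (@mon_out _ _ _ _ _ _ _ i) ?epsE // (lin0 (@fD_lin _ _ _ _ _ _)); apply: killed0.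
  have [[k ak]|[b [/andP [b0 ba] nb]]] := bin_nonppow a0; last first.
    have [q /andP [qi qj]] := third_m i j.
    have ab0 : (a - b < a)%N by rewrite ltn_subrL b0.
    apply: (killed_compV ((IH b ba).1 q qi) ((IH _ ab0).2 q j qi ji qj)).
    - by rewrite ffunE eps_neq // epsE (pi_gt0 hp ht).
    - by rewrite DA_even0 // eps_neq.
    - exact: disj0l.
    - by rewrite eaddK bino_eps subnKC // ltnW.
    - by rewrite eaddK eps_add subnKC // ltnW.
    - by rewrite setU0.
  have [k0|k0] := posnP k.
    by rewrite ak k0 expn0; apply: killed_xiDj; rewrite eq_sym.
  have kt : (0 < k < t i)%N.
    rewrite k0 -(ltn_exp2l _ _ (prime_gt1 (p_prime hp))) -ak -(@piexpS F p m t hp i) ltnS.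
    exact: ap.
  have a1 : (a - 1 < a)%N by rewrite ltn_subrL a0.
  have knx : killed (V (eps i a) set0 (inl (nx i))).
    apply: (killed_weight (w := fun i' k' => wt F i' k' (eps i a) set0 (inl (nx i)))).
    - by apply: (@memB F p m n t _ n_pos); rewrite ?inE ?cards0 // eps_neq.
    - move=> q; rewrite brDr_mon; case: ifP => h; last exact: killed0.
      have qi : q = i by move: h; rewrite ffunE; case: eqP.
      by rewrite qi eps_sub; apply: (IH _ a1).1.
    - by move=> i' k'; apply: (br_hh_mon hp ht).
    (* As p divides p^k, the weights are those of D_(nx i), so the value is a multiple of that field
       and [Dpp] applies. *)
    move=> r u h; have ez (x : 'I_m) : ((eps i a x)%:R : F) = 0.
      rewrite ffunE; case: eqP => // _; apply/eqP.
      by rewrite -(dvdn_pcharf hp) ak dvdn_exp.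
    have [||-> ->] := wt_inj hp hp3 hm hn (r := r) (s := inl (nx i)) (u := u) (v := set0) => //.
      by move=> i' k'; rewrite -h /wt !natrD ez ffunE.
    by rewrite ak; apply: Dpp.
  have [->//|jn] := eqVneq j (nx i); rewrite eq_sym in jn.
  apply: (killed_compV knx (killed_xiDj jn)).
  - by rewrite epsE (pi_gt0 hp ht).
  - by rewrite DA_even0 // eps_neq.
  - exact: disj0l.
  - by rewrite eps_sub subnn eps0 bino0r oner_eq0.
  - by rewrite eps_sub subnn eps0 adde0.
  - by rewrite setU0.
split=> // q j qi ji qj; apply: (@killed_xD _ q) => //.
- by rewrite ffunE eps_neq // epsE.
- by rewrite ffunE !eps_neq // eq_sym.
move=> x; rewrite brDr_mon; case: ifP => hx; last exact: killed0.
have [->|xq] := eqVneq x q; first by rewrite eaddK; apply: P.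
have xi' : x = i by move: hx; rewrite !ffunE (negPf xq) addn0; case: eqP.
have a0 : (0 < a)%N by move: hx; rewrite xi' !ffunE eqxx eq_sym (negPf qi) addn0 => /andP [].
have -> : esub (eadd (eps i a) (eps q 1)) (eps x 1) = eadd (eps i (a - 1)) (eps q 1).
  apply/ffunP=> y; rewrite !ffunE xi'; case: (eqVneq y i) => [->|_]; last by rewrite subn0.
  by rewrite eq_sym (negPf qi) !addn0.
by apply: (IH _ _).2 => //; rewrite ltn_subrL a0.
Qed.

Lemma killed_P i (a : nat) j : j != i -> killed (V (eps i a) set0 (inl j)).
Proof. exact: (killed_PQ i a).1. Qed.

Lemma appW_hh0 i k a u : a i = 0%N -> k \notin u -> appW (hh i k) (mon a u) = 0.
Proof. by move=> ai ku; rewrite appW_hh_mon ai (negPf ku) scale0r. Qed.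

(** Obtained as [x_q^(c) D_j, x_j h_ik] with a third index j. *)
Lemma killed_e q (c : nat) i k : i != q -> killed (smul (mon (eps q c) set0) (hh i k)).
Proof.
move=> iq; have [j /andP [jq ji]] := third_m q i.
have ij : i != j by rewrite eq_sym.
have := killed_br (killed_P c jq) (killed_xhh k ij).
rewrite br_comp; first by rewrite -/(xx j) (DA_xx hp ht) eqxx scale1r mulA1.
- exact: par_mon0.
- exact: par_mon0.
- exact: killed_even (killed_hh i k).
- by rewrite appW_hh0 ?inE // eps_neq.
- by rewrite (brDr_hh hp ht) (negPf ij) scale0r.
Qed.

(** Bracketing with x_q^(c) h_ik multiplies a weight vector free of x_q and D_q by x_q^(c), up to
    its weight. One nonzero weight thus allows a whole divided power to be inserted at once. *)
Lemma killed_mul q (c : nat) a u r i k : killed (V a u r) -> a q = 0%N -> r != inl q ->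
  i != q -> wt F i k a u r != 0 -> killed (V (eadd (eps q c) a) u r).
Proof.
move=> hk aq rq iq nw; have := killed_br (killed_e c k iq) hk.
rewrite br_smul_l.
- rewrite (br_hh_mon hp ht) smulZr smul_fD mon_mul0; first exact: killed_unscale.
  by move=> x; have [->|xq] := eqVneq x q; [right|left; rewrite eps_neq].
- exact: par_mon0.
- exact: killed_even hk.
- by rewrite appW_fD DA_mon_eps0 // mulA0r.
Qed.

(** * Monomials with many odd and even variables *)

Lemma set_peel u (N : nat) : #|u| = N.+2 -> exists k l v,
  [/\ k != l, k \notin v, l \notin v, #|v| = N & [set k; l] :|: v = u].
Proof.
move=> cu; have /card_gt0P [k ku] : (0 < #|u|)%N by rewrite cu.
have c1 : #|u :\ k| = N.+1 by move: cu; rewrite (cardsD1 k) ku => -[].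
have /card_gt0P [l lu] : (0 < #|u :\ k|)%N by rewrite c1.
have c2 : #|u :\ k :\ l| = N by move: c1; rewrite (cardsD1 l) lu => -[].
exists k, l, (u :\ k :\ l); split=> //.
- by move: lu; rewrite !inE eq_sym => /andP [].
- by rewrite !inE eqxx andbF.
- by rewrite !inE eqxx.
- by rewrite -setUA setD1K // setD1K.
Qed.

Lemma disj_pair k l v : k \notin v -> l \notin v -> [disjoint [set k; l] & v].
Proof. by move=> kv lv; rewrite disjoint_setUl !disjoints1 kv. Qed.

(** Odd generators are inserted in pairs: [xi_k xi_l D_i, x_i xi^v D_j]. The auxiliary x_i comes
    from [killed_mul], the weight along (j, k) being -1. *)
Lemma killed_xiuD (N : nat) u j : #|u| = N.*2 -> killed (V ezero u (inl j)).
Proof.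
elim: N u j => [|N IH] u j.
  by move=> /eqP; rewrite cards_eq0 => /eqP ->; apply: killed_V0.
rewrite doubleS => /set_peel [k [l [v [kl kv lv cv <-]]]].
have [i /andP [ij _]] := third_m j j.
have h1 : killed (V (eadd (eps i 1) ezero) v (inl j)).
  apply: (@killed_mul _ _ _ _ _ j k (IH v j cv)); rewrite ?ffunE //.
  - by rewrite eqYll eq_sym.
  - by rewrite eq_sym.
  by rewrite wt_inl (negPf kv) eqxx sub0r oppr_eq0 oner_eq0.
rewrite adde0 in h1; apply: (killed_compV (killed_xixiD i kl) h1).
- by rewrite epsE (pi_gt0 hp ht).
- by rewrite DA_even0 // ffunE.
- exact: disj_pair.
- by rewrite bino0l oner_eq0.
- by rewrite eps_sub subnn eps0 adde0.
- by [].
Qed.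

Lemma killed_xivd (N : nat) u (b : 'I_n) : #|u| = N.*2.+1 -> b \notin u -> killed (V ezero u (inr b)).
Proof.
elim: N u => [|N IH] u.
  move=> /eqP /cards1P [k ->]; rewrite inE => bk.
  split; last by apply: (nxid nD); rewrite eq_sym.
  by apply: (memC t hp hp3); rewrite ?inE ?cards1.
rewrite doubleS => /set_peel [k [l [v [kl kv lv cv <-]]]].
rewrite !inE !negb_or => /andP [/andP [bk bl] bv].
have [i' /andP [ij _]] := third_m (j0 hm) (j0 hm).
have h1 : killed (V (eadd (eps (j0 hm) 1) ezero) v (inr b)).
  apply: (@killed_mul _ _ _ _ _ i' b (IH v cv bv)); rewrite ?ffunE //.
  by rewrite wt_inr (negPf bv) eqxx sub0r oppr_eq0 oner_eq0.
rewrite adde0 in h1; apply: (killed_compV (killed_xixiD (j0 hm) kl) h1).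
- by rewrite epsE (pi_gt0 hp ht).
- by rewrite DA_odd0 // !inE negb_or bk.
- exact: disj_pair.
- by rewrite bino0l oner_eq0.
- by rewrite eps_sub subnn eps0 adde0.
- by [].
Qed.

(** The exponent is built one coordinate at a time, each with its full power; at every stage b
    agrees with a or is 0 in each coordinate. *)
Lemma grow (Q : {ffun 'I_m -> nat} -> Prop) a : Q ezero ->
  (forall (b : {ffun 'I_m -> nat}) (q : 'I_m), b q = 0%N -> (forall i, b i = a i \/ b i = 0%N) -> (0 < a q)%N ->
     Q b -> Q (eadd (eps q (a q)) b)) -> Q a.
Proof.
move=> Q0 QS; pose tr (s : nat) : {ffun 'I_m -> nat} := [ffun i : 'I_m => if (i < s)%N then a i else 0%N].
have H (s : nat) : (s <= m)%N -> Q (tr s).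
  elim: s => [_|s IH sm].
    by have -> : tr 0%N = ezero by apply/ffunP=> x; rewrite !ffunE.
  pose q := Ordinal sm; have [aq|aq] := posnP (a q).
    have -> : tr s.+1 = tr s; last exact: IH (ltnW sm).
    apply/ffunP=> x; rewrite !ffunE ltnS leq_eqVlt.
    have [xs|//] := eqVneq (x : nat) s; rewrite -xs ltnn /=.
    by rewrite (_ : x = q) //; apply: val_inj.
  have -> : tr s.+1 = eadd (eps q (a q)) (tr s).
    apply/ffunP=> x; rewrite !ffunE ltnS leq_eqVlt -val_eqE /=.
    have [xs|_] := eqVneq (x : nat) s; last by rewrite add0n.
    by rewrite -{2}xs ltnn addn0 (_ : x = q) //; apply: val_inj.
  apply: QS (IH (ltnW sm)) => //; first by rewrite ffunE ltnn.
  by move=> x; rewrite ffunE; case: ifP; [left|right].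
have <- : tr m = a by apply/ffunP=> x; rewrite ffunE ltn_ord.
exact: H.
Qed.

(** The weight along (j, k) remains -1 during the construction, because neither x_j nor xi_k ever
    occurs. *)
Lemma killed_xuD a u j k : a j = 0%N -> k \notin u -> ~~ odd #|u| -> killed (V a u (inl j)).
Proof.
move=> aj ku ou; apply: (grow (Q := fun a => killed (V a u (inl j)))) => [|b q bq bc aq IH].
  by apply: (@killed_xiuD #|u|./2); rewrite -{1}[#|u|]odd_double_half (negPf ou).
have qj : q != j by apply: contraTneq aq => ->; rewrite aj.
have bj : b j = 0%N by case: (bc j) => // ->.
apply: (@killed_mul _ _ _ _ _ j k) => //.
- by rewrite eqYll eq_sym.
- by rewrite eq_sym.
- by rewrite /wt bj (negPf ku) eqYll eqxx subr0 sub0r oppr_eq0 oner_eq0.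
Qed.

(** With a single even variable, u may contain all odd generators: then the weight along a third
    even index is 1. *)
Lemma killed_x1uD i (c : nat) u j : i != j -> ~~ odd #|u| -> killed (V (eps i c) u (inl j)).
Proof.
move=> ij ou; rewrite -[eps i c]adde0.
have h0 : killed (V ezero u (inl j)).
  by apply: (@killed_xiuD #|u|./2); rewrite -{1}[#|u|]odd_double_half (negPf ou).
case: (pickP (fun k => k \notin u)) => [k ku|full].
  apply: (@killed_mul _ _ _ _ _ j k h0); rewrite ?ffunE //.
  - by rewrite eqYll eq_sym.
  - by rewrite eq_sym.
  by rewrite wt_inl (negPf ku) eqxx sub0r oppr_eq0 oner_eq0.
have [q /andP [qi qj]] := third_m i j.
apply: (@killed_mul _ _ _ _ _ q n_pos h0); rewrite ?ffunE //.
  by rewrite eqYll eq_sym.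
have ku : n_pos \in u by have /negbT := full n_pos; rewrite negbK.
by rewrite wt_inl ku [j == q]eq_sym (negPf qj) /= subr0 oner_eq0.
Qed.

(** For k in v, the weights along (i, k) and (i, b) are c_i + 1 and c_i - 1. They differ by 2, so
    one of them is nonzero. *)
Lemma killed_xvd a v (b : 'I_n) : b \notin v -> odd #|v| -> killed (V a v (inr b)).
Proof.
move=> bv ov; apply: (grow (Q := fun a => killed (V a v (inr b)))).
  by apply: (@killed_xivd #|v|./2) => //; rewrite -{1}[#|v|]odd_double_half ov.
move=> c q cq _ _ IH; have [i /andP [iq _]] := third_m q q.
have /card_gt0P [k kv] : (0 < #|v|)%N by case: #|v| ov.
have bk : (b == k) = false by apply: contraNF bv => /eqP ->.
have [z|nz] := eqVneq ((c i)%:R + 1 : F) 0.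
  apply: (@killed_mul _ _ _ _ _ i b IH) => //.
  rewrite /wt (negPf bv) eqYrr eqxx subr0 addn0.
  have -> : ((c i)%:R - 1 : F) = ((c i)%:R + 1) - 2 by ring.
  by rewrite z sub0r oppr_eq0 two0.
apply: (@killed_mul _ _ _ _ _ i k IH) => //.
by rewrite /wt kv eqYrr bk !subr0 natrD.
Qed.

(** * The spanning fields D_rs of monomials *)

Lemma mon_peel i a u :
  mon a u = mon [ffun x => if x == i then 0%N else a x] set0 ** mon (eps i (a i)) u.
Proof.
rewrite mon_mul0; last by move=> x; rewrite !ffunE; case: eqP; [left|right].
by congr (monomial _ _ _ _); apply/ffunP=> x; rewrite !ffunE; case: eqP => [->|_]; rewrite ?addn0.
Qed.

(** The monomial is split as f g, with the power of x_i and the odd part in g. Then D_i(f) = D_j(g)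
    = 0, and D_ij(f g) = [f D_i, g D_j]. *)
Lemma killed_DFee i j a u : ~~ odd #|u| -> killed (DF (inl i) (inl j) (mon a u)).
Proof.
move=> ou; have [->|ij] := eqVneq i j; first by rewrite /divfield subrr; apply: killed0.
rewrite (mon_peel i); set f := mon _ set0; set g := mon _ u.
have hf : Alg_par false f by apply: par_mon0.
have hg : Alg_par false g by apply: par_even.
have ji : j != i by rewrite eq_sym.
have k1 : killed (fD f (inl i)).
  by apply: (@killed_xuD _ _ _ n_pos); rewrite ?ffunE ?eqxx ?inE ?cards0.
have k2 : killed (fD g (inl j)) by apply: killed_x1uD.
have := killed_br k1 k2; rewrite br_fD.
suff -> : DF (inl i) (inl j) (f ** g) = fD (f ** DA (inl i) g) (inl j) - fD (g ** DA (inl j) f) (inl i) by [].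
rewrite /divfield /= expr0 !scale1r !(leibniz hp _ _ hf) /= !scale1r.
have -> : DA (inl i) f = 0 by rewrite DA_even0 // ffunE eqxx.
have -> : DA (inl j) g = 0 by rewrite DA_even0 // eps_neq.
rewrite mulA0l add0r mulA0r addr0; congr (_ - fD _ _).
by rewrite (mulAC (par_DA hf) hg) /= scale1r.
Qed.

Lemma xi_mon k l v : k \notin v -> xi k ** mon l v = sg F [set k] v *: mon l (k |: v).
Proof. by move=> kv; rewrite mul_mon disjoints1 kv bino0l mul1r add0e. Qed.

Lemma mon_xi_peel k a u : k \in u -> mon a u = sg F [set k] (u :\ k) *: (xi k ** mon a (u :\ k)).
Proof. by move=> ku; rewrite xi_mon ?inE ?eqxx // scalerA sg_sqr scale1r setD1K. Qed.

Lemma DA_xi_mul l k f : DA (inr l) (xi k ** f) = (l == k)%:R *: f - xi k ** DA (inr l) f.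
Proof.
rewrite (leibniz hp _ _ (@par_xi F p m n t k)) /= expr1 scaleN1r DA_xi mulAZl mul1A.
by rewrite eqYrr.
Qed.

Lemma killed_fDd k l a u : l \notin u :\ k -> ~~ odd #|u| ->
  killed (fD (DA (inr k) (mon a u)) (inr l)).
Proof.
move=> lu ou; rewrite DA_odd; case: ifP => ku; last first.
  by rewrite (lin0 (@fD_lin _ _ _ _ _ _)); apply: killed0.
rewrite (linZ _ _ (@fD_lin _ _ _ _ _ _)); apply/killedZ/killed_xvd => //.
by move: ou; rewrite (cardsD1 k) ku /= negbK.
Qed.

(** If k = l or one of the generators is missing, each nonzero term is killed by itself. Otherwise,
    with f the monomial without xi_l, the field is a multiple of [f d_l, xi_l d_k]. *)
Lemma killed_DFoo k l a u : ~~ odd #|u| -> killed (DF (inr k) (inr l) (mon a u)).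
Proof.
move=> ou; rewrite /divfield /= expr0 expr1 scale1r.
have [kl|kl] := eqVneq k l.
  by rewrite kl; apply: killedB; rewrite ?scaleN1r -?scaleN1r; [apply: killedZ|];
    apply: killed_fDd => //; rewrite !inE eqxx.
case: (boolP (l \in u)) => lu; last first.
  rewrite [DA (inr l) _]DA_odd0 // (lin0 (@fD_lin _ _ _ _ _ _)) subr0.
  by apply/killedZ/killed_fDd => //; rewrite !inE negb_and lu orbT.
case: (boolP (k \in u)) => ku; last first.
  rewrite [DA (inr k) _]DA_odd0 // (lin0 (@fD_lin _ _ _ _ _ _)) scaler0 sub0r -scaleN1r.
  by apply/killedZ/killed_fDd => //; rewrite !inE negb_and ku orbT.
rewrite (mon_xi_peel _ lu); set f := mon a (u :\ l).
have k1 : killed (fD f (inr l)).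
  by apply: killed_xvd; rewrite ?inE ?eqxx //; move: ou; rewrite (cardsD1 l) lu /= negbK.
have k2 : killed (fD (xi l) (inr k)).
  by split; [apply: (xid_SS t hp hp3)|apply: (nxid nD)]; rewrite eq_sym.
have := killed_br k1 k2; rewrite br_fD DA_xi eqxx scale1r mulA1.
rewrite !DAZ !DA_xi_mul eqxx (negPf kl) scale0r sub0r scale1r.
have -> : DA (inr l) f = 0 by rewrite DA_odd0 // !inE eqxx.
rewrite mulA0r subr0 !(linZ _ _ (@fD_lin _ _ _ _ _ _)) (linN _ (@fD_lin _ _ _ _ _ _)).
rewrite scaleN1r scalerN opprK -scalerBr => /(killedZ (- sg F [set l] (u :\ l))).
by rewrite scaleNr -scalerN opprB.
Qed.

(* [D_ik (x^(l + e_i) xi_k xi^v)] for [k] not in [v]. *)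
Definition Yf i k l v : W :=
  fD (xi k ** mon l v) (inr k) + V (eadd l (eps i 1)) v (inl i).

Lemma even_Y i k l v : ~~ odd #|v| -> evenW (Yf i k l v).
Proof.
move=> ov; apply: evenWD; apply: evenW_fD; last exact: par_even.
have h := par_mul (@par_xi F p m n t k) (@par_even l v ov); exact: h.
Qed.

Lemma mon_mulc (b : {ffun 'I_m -> nat}) (w : {set 'I_n}) (l : {ffun 'I_m -> nat}) v : w = set0 \/ v = set0 -> (forall x, b x = 0%N \/ l x = 0%N) ->
  mon b w ** mon l v = mon (eadd b l) (w :|: v).
Proof. by move=> [->|->] h; rewrite ?set0U ?setU0; [apply: mon_mul0|apply: mon_0mul]. Qed.

Lemma smulY (b : {ffun 'I_m -> nat}) (w : {set 'I_n}) i k (l : {ffun 'I_m -> nat}) v : ~~ odd #|w| -> w = set0 \/ v = set0 ->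
  (forall x, b x = 0%N \/ (l x = 0%N /\ x != i)) ->
  smul (mon b w) (Yf i k l v) = Yf i k (eadd b l) (w :|: v).
Proof.
move=> ow wv h; rewrite /Yf smulD !smul_fD; congr (fD _ _ + fD _ _).
  rewrite mulA_assoc (mulAC (@par_even b w ow) (@par_xi F p m n t k)) /= scale1r -mulA_assoc.
  by rewrite mon_mulc // => x; case: (h x) => [|[]]; [left|right].
rewrite mon_mulc // ?addeA // => x; case: (h x) => [|[lx xi']]; [by left|right].
by rewrite !ffunE lx (negPf xi').
Qed.

Lemma appW_Y0 i k l v (b : {ffun 'I_m -> nat}) (w : {set 'I_n}) : b i = 0%N -> k \notin w -> appW (Yf i k l v) (mon b w) = 0.
Proof.
move=> bi kw; rewrite (linD _ _ (@appW_linl _ _ _ _ _ _)) !appW_fD DA_odd0 // DA_even0 //.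
by rewrite !mulA0r addr0.
Qed.

Lemma brDr_Y0 j i k (l : {ffun 'I_m -> nat}) v : l j = 0%N -> j != i -> k \notin v -> brW (Dr j) (Yf i k l v) = 0.
Proof.
move=> lj ji kv; rewrite /Yf xi_mon // (linZ _ _ (@fD_lin _ _ _ _ _ _)) brWDr brWZr.
by rewrite !brDr_mon0 ?scaler0 ?addr0 // !ffunE lj (negPf ji).
Qed.

Lemma br_hh_Y j i k (l : {ffun 'I_m -> nat}) v : j != i -> k \notin v ->
  brW (hh j k) (Yf i k l v) = (l j)%:R *: Yf i k l v.
Proof.
move=> ji kv; rewrite /Yf xi_mon // (linZ _ _ (@fD_lin _ _ _ _ _ _)) brWDr brWZr.
rewrite !(br_hh_mon hp ht) scalerDr /wt !inE eqxx /= (negPf kv) !ffunE eqYrr eqYll eqxx.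
rewrite (negPf ji) [i == j]eq_sym (negPf ji) !addn0 !subr0 natrD addrK.
by rewrite !scalerA mulrC.
Qed.

Lemma cancel3 (U : zmodType) (x y z : U) : (x + y) - (x - z) = y + z.
Proof. by rewrite opprB [z - x]addrC addrACA subrr add0r. Qed.

(* Modulo [D_ij], the pair [x_i D_i], [xi_k d_k] is traded for [x_j D_j], [xi_k d_k]. *)
Lemma Y0_red i j k (l : {ffun 'I_m -> nat}) : i != j -> l j = 0%N -> (l i < pi_ i)%N ->
  killed (smul (mon l set0) (hh j k)) -> killed (Yf i k l set0).
Proof.
move=> ij lj li hk.
have ji : j != i by rewrite eq_sym.
have := killedB hk (@killed_DFee i j (eadd (eadd l (eps i 1)) (eps j 1)) set0 _).
rewrite cards0 => /(_ isT); rewrite hh_mul // /divfield /= expr0 !scale1r !DA_even.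
rewrite !ffunE !eqxx (negPf ij) (negPf ji) lj !addn0 !addn1 li (pi_gt0 hp ht) /= eaddK.
have -> : esub (eadd (eadd l (eps i 1)) (eps j 1)) (eps i 1) = eadd l (eps j 1).
  by rewrite -addeA [eadd (eps i 1) _]addeC addeA eaddK.
rewrite cancel3.
rewrite /Yf xi_mon ?inE // sg0r scale1r setU0 addrC.
by [].
Qed.

(** This is [x_i^(c) h_qk, x_q h_jk]: the factor x_q has weight 1 along (q, k). *)
Lemma killed_xxh i (c : nat) q j k : q != i -> j != i -> j != q ->
  killed (smul (mon (eadd (eps i c) (eps q 1)) set0) (hh j k)).
Proof.
move=> qi ji jq; have := killed_br (killed_e c k qi) (killed_xhh k jq).
rewrite br_smul_l.
- have -> : brW (hh q k) (smul (mon (eps q 1) set0) (hh j k)) =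
      1 *: smul (mon (eps q 1) set0) (hh j k).
    rewrite (@br_smul_hh q k (eps q 1) set0 0) ?cards0 ?(br_hh_hh hp ht) ?scale0r //.
    by rewrite epsE inE addr0.
  rewrite scale1r smulA mon_mul0 // => x.
  by have [->|xi'] := eqVneq x i; [right; rewrite eps_neq // eq_sym|left; rewrite eps_neq].
- exact: par_mon0.
- exact: killed_even (killed_xhh k jq).
- by rewrite appW_smul appW_hh0 ?inE ?mulA0r // eps_neq.
Qed.

Lemma killed_Yq i (c : nat) q k : q != i -> (c < pi_ i)%N ->
  killed (Yf i k (eadd (eps i c) (eps q 1)) set0).
Proof.
move=> qi ci; have [j /andP [ji jq]] := third_m i q.
apply: (@Y0_red i j); first by rewrite eq_sym.
- by rewrite ffunE !eps_neq.
- by rewrite ffunE epsE eps_neq ?addn0 // eq_sym.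
- exact: killed_xxh.
Qed.

(** By [br_comp] it is the bracket of x_j^(b) D_q with x_q times [Yf], the latter supplied by
    [killed_Yq]. *)
Lemma killed_Yj i (c : nat) j (b : nat) k : j != i -> (c < pi_ i)%N ->
  killed (Yf i k (eadd (eps j b) (eps i c)) set0).
Proof.
move=> ji ci; have [q /andP [qi qj]] := third_m i j.
have sY x d : x != i -> smul (mon (eps x d) set0) (Yf i k (eps i c) set0) =
    Yf i k (eadd (eps x d) (eps i c)) set0.
  move=> xi'; rewrite smulY ?cards0 ?setU0 //; first by left.
  move=> y; have [->|yx] := eqVneq y x; last by left; rewrite eps_neq.
  by right; rewrite eps_neq.
have := killed_br (killed_P b qj) (killed_Yq k qi ci).
rewrite addeC -sY // br_comp; first by rewrite -/(xx q) (DA_xx hp ht) eqxx scale1r mulA1 sY.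
- exact: par_mon0.
- exact: par_mon0.
- by apply: even_Y; rewrite cards0.
- by rewrite appW_Y0 ?inE // eps_neq // eq_sym.
- by rewrite brDr_Y0 ?inE // eps_neq.
Qed.

(* [Yf i k l v] is the bracket of [x^b xi^v D_j] with [x_j^(l_j + 1) (Yf i k (l_i e_i) 0)]. *)
Lemma killed_Y1 i k (l : {ffun 'I_m -> nat}) v j : j != i -> (l i < pi_ i)%N -> (l j < pi_ j)%N ->
  k \notin v -> ~~ odd #|v| -> killed (Yf i k l v).
Proof.
move=> ji li lj kv ov; have ij : i != j by rewrite eq_sym.
pose b : {ffun 'I_m -> nat} := [ffun x => if (x == i) || (x == j) then 0%N else l x].
have bi : b i = 0%N by rewrite ffunE eqxx.
have bj : b j = 0%N by rewrite ffunE eqxx orbT.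
have sY : smul (mon (eps j (l j).+1) set0) (Yf i k (eps i (l i)) set0) =
    Yf i k (eadd (eps j (l j).+1) (eps i (l i))) set0.
  rewrite smulY ?cards0 ?setU0 //; first by left.
  move=> y; have [->|yx] := eqVneq y j; last by left; rewrite eps_neq.
  by right; rewrite eps_neq.
have := killed_br (killed_xuD bj kv ov) (killed_Yj (l j).+1 k ji li).
rewrite -sY br_comp.
- rewrite DA_even epsE lj /= eps_sub subn1 mon_0mul; last first.
    by move=> x; have [->|xj] := eqVneq x j; [left|right; rewrite eps_neq].
  rewrite smulY ?setU0 //; last first.
  + move=> x; have [->|xi'] := eqVneq x i; last by right; rewrite eps_neq.
    by left; rewrite ffunE bi eps_neq.
  + by right.
  suff -> : eadd (eadd b (eps j (l j).+1.-1)) (eps i (l i)) = l by [].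
  apply/ffunP=> x; rewrite !ffunE /=.
  have [->|xi'] := eqVneq x i; first by rewrite /= (negPf ij) !add0n.
  by have [->|xj] := eqVneq x j; rewrite /= ?addn0.
- exact: par_even.
- exact: par_mon0.
- by apply: even_Y; rewrite cards0.
- by rewrite appW_Y0.
- by rewrite brDr_Y0 ?inE // eps_neq.
Qed.

(** [killed_Y1] needs some even index other than i below its top exponent. If x_j and x_q are both
    at the top, the power of x_q is removed and reinserted by x_q^(l_q) h_jk; the weight is then l_j
    = pi_j, which is -1 in F. *)
Lemma killed_Y i k (l : {ffun 'I_m -> nat}) v : (l i < pi_ i)%N -> k \notin v -> ~~ odd #|v| -> killed (Yf i k l v).
Proof.
move=> li kv ov; have [j /andP [ji _]] := third_m i i.
have [q /andP [qi qj]] := third_m i j.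
have [lj|lj] := ltnP (l j) (pi_ j); first exact: (killed_Y1 ji).
have [lq|lq] := ltnP (l q) (pi_ q); first exact: (killed_Y1 qi).
have [lj'|lj'] := leqP (l j) (pi_ j); last first.
  have out : forall a w, a j = l j -> mon a w = 0.
    by move=> a w aj; rewrite (@mon_out _ _ _ _ _ _ _ j) // aj.
  rewrite /Yf !out //; last by rewrite ffunE eps_neq // addn0.
  by rewrite mulA0r !(lin0 (@fD_lin _ _ _ _ _ _)) addr0; apply: killed0.
pose l' : {ffun 'I_m -> nat} := [ffun x => if x == q then 0%N else l x].
have el : eadd (eps q (l q)) l' = l.
  by apply/ffunP=> x; rewrite !ffunE; case: eqP => [->|_]; rewrite ?addn0.
have hY : killed (Yf i k l' v).
  apply: (killed_Y1 qi) => //; rewrite !ffunE ?eqxx ?(pi_gt0 hp ht) //.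
  by rewrite eq_sym (negPf qi).
have jq : j != q by rewrite eq_sym.
have := killed_br (killed_e (l q) k jq) hY; rewrite br_smul_l.
- rewrite br_hh_Y // smulZr smulY ?cards0 ?el ?set0U //; first last.
  + move=> x; have [->|xq] := eqVneq x q; last by left; rewrite eps_neq.
    by right; rewrite ffunE eqxx.
  + by left.
  apply: killed_unscale; rewrite ffunE (negPf jq).
  have -> : l j = pi_ j by apply/eqP; rewrite eqn_leq lj'.
  by rewrite (pi_char hp ht) oppr_eq0 oner_eq0.
- exact: par_mon0.
- exact: killed_even hY.
- by rewrite appW_Y0 ?inE // eps_neq // eq_sym.
Qed.

(** If xi_k or x_i is absent, only one term survives. Otherwise the field is, up to sign, a [Yf]
    with exponent a - eps_i. *)
Lemma killed_DFeo i k a u : odd #|u| -> killed (DF (inl i) (inr k) (mon a u)).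
Proof.
move=> ou; rewrite /divfield /= expr0 expr1 scale1r scaleN1r opprK.
have [ai|ai] := leqP (a i) (pi_ i); last first.
  rewrite (@mon_out _ _ _ _ _ _ _ i) // !DA0 !(lin0 (@fD_lin _ _ _ _ _ _)) addr0.
  exact: killed0.
case: (boolP (k \in u)) => ku; last first.
  rewrite [DA (inr k) _]DA_odd0 // [X in _ + X](lin0 (@fD_lin _ _ _ _ _ _)) addr0 DA_even.
  case: ifP => _; last by rewrite (lin0 (@fD_lin _ _ _ _ _ _)); apply: killed0.
  exact: killed_xvd.
have kv : k \notin u :\ k by rewrite !inE eqxx.
have ov : ~~ odd #|u :\ k| by move: ou; rewrite (cardsD1 k) ku.
rewrite (mon_xi_peel _ ku); set v := u :\ k in kv ov *.
rewrite !DAZ !(linZ _ _ (@fD_lin _ _ _ _ _ _)) -scalerDr; apply: killedZ.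
rewrite DA_xi_mul eqxx scale1r [DA (inr k) _]DA_odd0 // mulA0r subr0.
rewrite (leibniz hp _ _ (@par_xi F p m n t k)) /= scale1r DA_xi scale0r mulA0l add0r.
rewrite DA_even; have [a0|a0] := posnP (a i).
  by rewrite mulA0r (lin0 (@fD_lin _ _ _ _ _ _)) add0r; apply: (killed_xuD a0 kv).
rewrite ai /=; have := @killed_Y i k (esub a (eps i 1)) v; rewrite /Yf.
have -> : eadd (esub a (eps i 1)) (eps i 1) = a.
  by apply/ffunP=> x; rewrite !ffunE; case: eqP => [->|_]; rewrite ?subnK ?subn0 ?addn0.
by apply=> //; rewrite !ffunE eqxx subn1 prednK.
Qed.

Lemma killed_all x : inSS x -> D x = 0.
Proof.
move=> hx; suff [] : killed x by [].
move: x hx; apply: inSS_ind => [|x y|k x|[i|k] [j|l] a u /= ou].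
- exact: killed0.
- exact: killedD.
- exact: killedZ.
- by apply: killed_DFee; rewrite ou.
- exact: killed_DFeo.
- have -> : DF (inr k) (inl j) (mon a u) = DF (inl j) (inr k) (mon a u).
    by rewrite /divfield /= expr0 expr1 !scale1r !scaleN1r !opprK addrC.
  exact: killed_DFeo.
- by apply: killed_DFoo; rewrite ou.
Qed.

End Kill.

End Generation.

(** * Powers of the partial derivatives and the theorem *)

Local Opaque brW appW Defs.mulA DA.

Section Powers.
Variables (F : fieldType) (p m n : nat) (t : 'I_m -> nat).
Hypotheses (hp : p \in [pchar F]) (hp3 : (3 < p)%N).
Hypotheses (hm : (3 <= m)%N) (hn : (3 <= n)%N) (ht : forall i, (0 < t i)%N).
Local Notation A := (Alg F p n t).
Local Notation W := (Wt F p n t).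
Local Notation pi_ := (piexp p t).
Local Notation mon := (@monomial F p m n t).
Local Notation hh := (@hh F p m n t).
Local Notation xx := (@xx F p m n t).
Local Notation xi := (@xi F p m n t).
Local Notation Dr i := (Dr F p t (inl i) : W).
Local Notation "f ** g" := (Defs.mulA f g) (at level 40, left associativity).
Implicit Types (a : {ffun 'I_m -> nat}) (u v : {set 'I_n}) (f g : A).
Implicit Types (s : Y m n) (E x : W) (k : nat).

Local Notation V a u r := (fD (mon a u) r : W).

Lemma ppow_le (i : 'I_m) k : (k < t i)%N -> (p ^ k <= pi_ i)%N.
Proof. by move=> kt; rewrite -ltnS (@piexpS F p m t hp i) ltn_exp2l ?prime_gt1 ?(p_prime hp). Qed.

Lemma ppow_gt1 k : (0 < k)%N -> (1 < p ^ k)%N.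
Proof. by move=> k0; rewrite -{1}(expn0 p) ltn_exp2l ?prime_gt1 ?(p_prime hp). Qed.

Lemma iter_Dr_mon N (i : 'I_m) a u s : (a i <= pi_ i)%N ->
  iter N (brW (Dr i)) (V a u s) = if (N <= a i)%N then V (esub a (eps i N)) u s else 0.
Proof.
move=> ai; elim: N => [|N IH].
  rewrite leq0n /= (_ : esub a (eps i 0) = a) //.
  by apply/ffunP=> x; rewrite !ffunE; case: eqP; rewrite subn0.
rewrite iterS IH; case: (ltnP N (a i)) => Na.
  rewrite (ltnW Na) brDr_mon !ffunE eqxx subn_gt0 Na (leq_trans (leq_subr _ _) ai) /=.
  suff -> : esub (esub a (eps i N)) (eps i 1) = esub a (eps i N.+1) by [].
  by apply/ffunP=> x; rewrite !ffunE; case: eqP => _; rewrite ?subn0 // subn1 subnS.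
case: ifP => aN; last by rewrite brW0r.
by rewrite brDr_mon0 // !ffunE eqxx; apply/eqP; rewrite subn_eq0.
Qed.

Lemma iter_lin N (i : 'I_m) : lin (iter N (brW (Dr i))).
Proof. by elim: N => [|N IH] k x y //=; rewrite IH; apply: brW_linr. Qed.

Definition powers (c : 'I_m -> nat -> F) (x : W) : W :=
  \sum_(i < m) \sum_(1 <= r < t i) c i r *: iter (p ^ r) (brW (Dr i)) x.

Lemma isDer_powers c : isDer (powers c).
Proof.
pose G (i : 'I_m) r (x : W) : W := c i r *: iter (p ^ r) (brW (Dr i)) x.
have h i r : isDer (G i r) by exact: (isDer_scale (c i r) (@isDer_iter F p m n t hp i r)).
exact: (isDer_sum hp _ (fun i => isDer_sum hp (index_iota 1 (t i)) (h i))).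
Qed.

Lemma powersD c x1 x2 : powers c (x1 + x2) = powers c x1 + powers c x2.
Proof.
rewrite /powers -big_split; apply: eq_bigr => i _ /=.
rewrite -big_split; apply: eq_bigr => r _ /=.
by rewrite (linD _ _ (@iter_lin _ i)) scalerDr.
Qed.

(** All fields in the normalisation have exponents at most 1 < p^r, so subtracting [powers] does not
    disturb it. *)
Lemma powers_low c a u s : (forall i, a i <= 1)%N -> powers c (V a u s) = 0.
Proof.
move=> h; rewrite /powers big1 // => i _; rewrite big_nat big1 // => r /andP [r1 _].
rewrite iter_Dr_mon; last exact: leq_trans (h i) (pi_gt0 hp ht i).
by rewrite leqNgt (leq_ltn_trans (h i) (ppow_gt1 r1)) scaler0.
Qed.

Lemma cf_sum (I : Type) (l : seq I) (G : I -> W) s a u :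
  cf ((\sum_(i <- l) G i) s) a u = \sum_(i <- l) cf (G i s) a u.
Proof.
elim: l => [|i l IH]; first by rewrite !big_nil zeroWE cf0.
by rewrite !big_cons addWE cfD IH.
Qed.

(** On x_i^(p^k) D_s only (ad D_i)^(p^k) leaves a constant term, so the coefficients can be read off
    one by one. *)
Lemma cf_powers c (i : 'I_m) k s : (0 < k < t i)%N ->
  cf (powers c (V (eps i (p ^ k)) set0 s) s) ezero set0 = c i k.
Proof.
move=> /andP [k0 kt]; have pk := ppow_le kt.
have E j r : (0 < r)%N -> cf ((c j r *: iter (p ^ r) (brW (Dr j)) (V (eps i (p ^ k)) set0 s)) s)
    ezero set0 = c j r * ((j == i) && (r == k))%:R.
  move=> r0; rewrite scaleWE cfZ iter_Dr_mon; last first.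
    by rewrite ffunE; case: eqP => [->|].
  rewrite ffunE; have [->|_] := eqVneq j i; last first.
    by rewrite leqNgt (ltnW (ppow_gt1 r0)) zeroWE cf0.
  case: leqP => rk; last first.
    rewrite zeroWE cf0; case: eqP rk => [->|_ _] //; first by rewrite ltnn.
  rewrite fDeq cf_mon eqxx; have -> : [forall i, ezero i <= pi_ i]%N.
    by apply/forallP => x; rewrite ffunE.
  rewrite /= !andbT; congr (_ * _%:R); congr nat_of_bool.
  apply/eqP/eqP => [/ffunP /(_ i)|->].
    rewrite !ffunE eqxx => /esym/eqP; rewrite subn_eq0 => kr.
    by apply/eqP; rewrite -(@eqn_exp2l p) ?prime_gt1 ?(p_prime hp) // eqn_leq rk.
  by apply/ffunP=> x; rewrite !ffunE subnn.
rewrite /powers cf_sum (bigD1 i) //= [X in _ + X]big1 ?addr0 => [|j /negPf ji].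
  rewrite cf_sum (bigD1_seq k) ?mem_index_iota ?k0 ?iota_uniq //= E // !eqxx mulr1.
  rewrite big_seq_cond big1 ?addr0 // => r /andP [].
  by rewrite mem_index_iota => /andP [r1 _] /negPf rk; rewrite E // rk andbF mulr0.
rewrite cf_sum big_nat big1 // => r /andP [r1 _].
by rewrite E // ji mulr0.
Qed.

(** This gives more than directness: the powers are linearly independent modulo inner
    derivations. *)
Lemma powers_inner c E : evenW E ->
  (forall x, inSS x -> brW E x = powers c x) ->
  forall (i : 'I_m) k, (0 < k < t i)%N -> c i k = 0.
Proof.
move=> hE h i k kt; have [j /andP [ji _]] := third i i hm.
have hy : inSS (V (eps i (p ^ k)) set0 (inl j)).
  by apply: (@memB F p m n t j (n_pos hn)); rewrite ?inE ?cards0 // eps_neq.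
rewrite -(cf_powers c (inl j) kt) -h // brWE appW_fD fDeq cfD cfN.
(* Both terms of the bracket keep a factor x_i: one carries x_i^(p^k - 1), nonconstant as k > 0, the
   other x_i^(p^k). *)
have pk : (1 < p ^ k)%N by apply: ppow_gt1; case/andP: kt.
rewrite [X in _ - X]cf_mulx ?ffunE ?(ltnW pk) // subr0.
Local Transparent appW.
rewrite /appW (bigD1 (inl i)) //= big1 ?addr0 => [|r ri]; last first.
  by rewrite DA_mon_eps0 // mulA0r.
Local Opaque appW.
rewrite DA_even epsE (ltnW pk) ppow_le /=; last by case/andP: kt.
rewrite eps_sub (mulAC (hE (inl i)) (@par_mon0 F p m n t _)) /= scale1r.
by rewrite cf_mulx // ffunE subn_gt0.
Qed.

Lemma derivation_form D : isDer D -> exists E : W, evenW E /\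
  exists c, forall x, inSS x -> D x = brW E x + powers c x.
Proof.
move=> hD; have [E [hE nE]] := normalisable hp hp3 hm hn ht hD.
exists E; split=> //.
have hD1 := isDer_sub hp hD (isDer_ad hp hE); set D1 := (fun x => _) in nE hD1.
have [nx nxP] : {nx : 'I_m -> 'I_m | forall i : 'I_m, nx i != i}.
  exists (fun i : 'I_m => if [pick q : 'I_m | q != i] is Some q then q else i) => i.
  case: pickP => // none; have [q /andP [qi _]] := third i i hm.
  by have := none q; rewrite qi.
(* With these multiples subtracted, [cf_powers] yields exactly [Dpp] for the corrected
   derivation. *)
pose c (i : 'I_m) k := cf (D1 (V (eps i (p ^ k)) set0 (inl (nx i))) (inl (nx i))) ezero set0.
exists c => x hx.
have hD2 := isDer_sub hp hD1 (isDer_powers c).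
have nD2 : normalised hm (fun x => D1 x - powers c x).
  case: nE => n1 n2 n3 n4.
  have z (i : 'I_m) : (@ezero m i <= 1)%N by rewrite ffunE.
  split=> [i|i k|k l kl|k l kl].
  - by rewrite n1 /Defs.Dr oneAE powers_low // subrr.
  - rewrite n2 hhE powersD !powers_low ?addr0 ?subrr // => j.
    by rewrite ffunE; case: eqP.
  - by rewrite n3 // powers_low // subrr.
  - by rewrite n4 // powers_low // subrr.
have := killed_all hp hp3 hn ht hD2 nD2 nxP _ hx.
move=> H; have : D1 x - powers c x = 0.
  apply: H => i k kt.
  by rewrite subWE cfD cfN cf_powers // subrr.
by move=> /eqP; rewrite subr_eq0 /D1 => /eqP <-; rewrite addrC subrK.
Qed.

End Powers.

Theorem theorem4p3p6 (F : fieldType) (p : nat) (hp : p \in [pchar F]) (hp3 : (3 < p)%N)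
  (m n : nat) (hm : (3 <= m)%N) (hn : (3 <= n)%N) (t : 'I_m -> nat)
  (ht : forall i, (0 < t i)%N) :
  (forall D : Wt F p n t -> Wt F p n t,
     isDer D <->
     exists E : Wt F p n t, evenW E /\
       exists c : 'I_m -> nat -> F,
         forall x, inSS x ->
           D x = brW E x
                 + \sum_(i < m) \sum_(1 <= r < t i)
                      c i r *: iter (p ^ r) (brW (Dr F p t (inl i))) x)
  /\
  (forall (E : Wt F p n t) (c : 'I_m -> nat -> F),
     evenW E ->
     (forall x, inSS x ->
        brW E x = \sum_(i < m) \sum_(1 <= r < t i)
                     c i r *: iter (p ^ r) (brW (Dr F p t (inl i))) x) ->
     forall x, inSS x -> brW E x = 0).
Proof.
split=> [D|E c hE h x hx].
  split=> [|[E [hE [c h]]]]; first exact: derivation_form.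
  have hP := isDer_add (isDer_ad hp hE) (@isDer_powers F p m n t hp c).
  exact: (isDer_ext hp h hP).
rewrite h // big1 // => i _; rewrite big_nat big1 // => r hr.
by rewrite (powers_inner hp hm hn hE h hr) scale0r.
Qed.
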